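(* Let $\xi$ be a (non-trivial) potentially killed non-decreasing compound Poisson process with Laplace exponent $\phi$, killing rate $q\geq 0$ and (finite) Lévy measure $\mu$, and let $f_{I_\phi}$ be the density of its exponential functional $I_\phi=\int_0^\infty e^{-\xi_s}\,\mathrm ds$. Let $n\in\{0,1,2,\dots\}$. (1) If $\int_0^1 v^{-1}\mu(\mathrm dv)<\infty$, then, as $x\to\infty$, $$f_{I_\phi}^{(n)}(x)\sim C e^{-\phi(\infty)x},\qquad C=(-1)^n\phi^n(\infty)\sqrt{\phi(\infty)}\;\exp\left(\phi(\infty)\phi_*(1)+\int_0^\infty\int_{\phi_*(1)}^\infty e^{-\varphi_*(y)v}\,\mathrm dy\,\mu(\mathrm dv)\right)\frac{e^{-T_{\phi_*}}}{\sqrt{2\pi\phi_*(1)}}.$$ (2) If $\int_0^1 v^{-1}\mu(\mathrm dv)=\infty$, then, as $x\to\infty$, $$f_{I_\phi}^{(n)}(x)\sim C e^{-\phi(\infty)(x+\mathrm o(x))},\qquad C=(-1)^n\phi^n(\infty)\sqrt{\phi(\infty)}\;e^{\phi(\infty)\phi_*(1)}\frac{e^{-T_{\phi_*}}}{\sqrt{2\pi\phi_*(1)}},$$ that is, there is a function $r$ with $r(x)/x\to0$ such that $f_{I_\phi}^{(n)}(x)\sim Ce^{-\phi(\infty)(x+r(x))}$. (3) In all cases, $f_{I_\phi}$ is analytic in (i.e. extends to an analytic function on) the cone $\{z\in\mathbb C:\mathrm{Re}(z)>0,\ |\arg z|<\pi/2\}$.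
   Context: A potentially killed subordinator $\xi=(\xi_s)_{s\ge0}$ is a non-decreasing Lévy process sent to $+\infty$ at an independent exponential time $\mathbf e_q$ of rate $q\ge0$ ($\mathbf e_0=\infty$ a.s.), so that $I_\phi=\int_0^\infty e^{-\xi_s}\,\mathrm ds=\int_0^{\mathbf e_q}e^{-\xi_s}\,\mathrm ds$. Here $\xi$ is a compound Poisson process, i.e. it has no drift and $\mu$ is a finite measure on $(0,\infty)$, and its Laplace exponent is $$\phi(z)=q+\int_0^\infty(1-e^{-zy})\,\mu(\mathrm dy),\qquad \mathrm{Re}(z)\ge0,$$ assumed not identically zero. Write $\phi(\infty)=\lim_{x\to\infty}\phi(x)=q+\mu((0,\infty))\in(0,\infty)$. The variable $I_\phi$ has an infinitely differentiable density on $(0,\infty)$. For $\mathrm{Re}(z)>0$ put $\phi_*(z)=z/\phi(z)$. On $(0,\infty)$ the function $\phi_*$ is increasing with $\lim_{x\to\infty}\phi_*(x)=\infty$, and its inverse is $\varphi_*=\phi_*^{-1}:\left(\mathbb I_{\{q=0\}}/\phi'(0+),\infty\right)\to(0,\infty)$. The constant $T_{\phi_*}$ is $$T_{\phi_*}=\frac12\int_1^\infty (u-\lfloor u\rfloor)\bigl(1-(u-\lfloor u\rfloor)\bigr)\left(\frac1{u^2}-\left(\frac{\phi'(u)}{\phi(u)}\right)^2+\frac{\phi''(u)}{\phi(u)}\right)\mathrm du .$$ The relation $f\sim g$ as $x\to\infty$ means $f(x)/g(x)\to1$. *)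

(* Defs.v *)
From HB Require Import structures.
From mathcomp Require Import all_boot all_order all_algebra.
From mathcomp Require Import complex.
From mathcomp Require Import all_classical all_reals all_analysis.
From mathcomp Require Import measurable_realfun.

Set Implicit Arguments.
Unset Strict Implicit.
Unset Printing Implicit Defensive.

Import Order.TTheory GRing.Theory Num.Theory.
Import numFieldNormedType.Exports.

Local Open Scope classical_set_scope.
Local Open Scope ring_scope.

Section Processes.
Context {d : measure_display} {T : measurableType d} {R : realType}.
Variable P : probability T R.

Definition indep_systems (G H : set (set T)) : Prop :=
  forall A B, G A -> H B -> P (A `&` B) = (P A * P B)%E.

Definition sigma_rv {d' : measure_display} {T' : measurableType d'}
    (Y : T -> T') : set (set T) :=
  preimage_set_system [set: T] Y measurable.

Definition sigma_process (D : set R) (X : R -> {RV P >-> R}) : set (set T) :=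
  <<s \bigcup_(s in D) sigma_rv (X s) >>.

(* Time runs over [0, +oo[; the values [X s] for [s < 0] are never used.
   Path regularity is required of every path: modifying a process on a null
   set does not change the law of its exponential functional. *)
Record levy_process (X : R -> {RV P >-> R}) : Prop := LevyProcess {
  levy_start : {ae P, forall w, X 0 w = 0};
  levy_indep_increments : forall s t : R, 0 <= s -> s <= t ->
    indep_systems (sigma_process `[0, s] X)
                  (sigma_rv (fun w => X t w - X s w));
  levy_stationary_increments : forall s t : R, 0 <= s -> s <= t ->
    forall B : set R, measurable B ->
      P ((fun w => X t w - X s w) @^-1` B) = P (X (t - s) @^-1` B);
  levy_right_continuous : forall (w : T) (t : R), 0 <= t ->
    X s w @[s --> t^'+] --> X t w;
  levy_left_limits : forall (w : T) (t : R), 0 < t ->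
    cvg (X s w @[s --> t^'-])
}.

(* An exponential time of rate [q >= 0], almost surely infinite if [q = 0]. *)
Definition exponential_time (q : R) (e : {RV P >-> \bar R}) : Prop :=
  (0 < q -> forall B : set R, measurable B ->
     P (e @^-1` (EFin @` B)) = exponential_prob q B) /\
  (q = 0 -> {ae P, forall w, e w = +oo%E}).

Definition killed (X : R -> {RV P >-> R}) (e : {RV P >-> \bar R})
    (s : R) (w : T) : \bar R :=
  if (s%:E < e w)%E then (X s w)%:E else +oo%E.

Definition exponential_functional (xi : R -> T -> \bar R) (w : T) : \bar R :=
  (\int[lebesgue_measure]_(s in `[0%R, +oo[) expeR (- xi s w))%E.

(* [f] is the infinitely differentiable density on (0, +oo) of the random
   variable [I]; as such it is unique on (0, +oo). Its values on ]-oo, 0] are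
   irrelevant. *)
Record smooth_density (I : T -> \bar R) (f : R -> R) : Prop := SmoothDensity {
  density_ge0 : forall x : R, 0 < x -> 0 <= f x;
  density_smooth : forall (n : nat) (x : R), 0 < x -> derivable (derive1n n f) x 1;
  density_law : forall B : set R, measurable B ->
    P (I @^-1` (EFin @` B)) =
    (\int[lebesgue_measure]_(x in B `&` `]0%R, +oo[) (f x)%:E)%E
}.

End Processes.

Section LaplaceExponent.
Context {R : realType}.
Variable mu : {finite_measure set (measurableTypeR R) -> \bar R}.
Variable q : R.

(* [phi] is only used at real arguments [z >= 0], where the integral converges
   because [mu] is finite. *)
Definition phi (z : R) : R :=
  q + \int[mu]_(y in `]0, +oo[) (1 - expR (- (z * y))).

Definition phi_infty : R := lim (phi x @[x --> +oo]).

Definition phi_star (z : R) : R := z / phi z.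

(* The partial inverse is relevant only on the range of [phi_star], i.e. to the
   right of [phi_star(0+)]; elsewhere it takes the junk value 0. *)
Definition varphi_star : R -> R := 'pinv_(fun=> 0) `]0, +oo[ phi_star.

Definition T_phi_star : R :=
  2^-1 * \int[lebesgue_measure]_(u in `[1, +oo[)
    ((u - (Num.floor u)%:~R) * (1 - (u - (Num.floor u)%:~R)) *
     (1 / u ^+ 2 - (derive1 phi u / phi u) ^+ 2 + derive1n 2 phi u / phi u)).

End LaplaceExponent.

(* A compound Poisson subordinator with Levy measure [mu], identified by the
   Laplace transforms of its marginals at real arguments; [phi mu 0] is the
   Laplace exponent without killing. *)
Record compound_poisson_subordinator {d : measure_display}
    {T : measurableType d} {R : realType} (P : probability T R)
    (mu : {finite_measure set (measurableTypeR R) -> \bar R})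
    (X : R -> {RV P >-> R}) : Prop := CompoundPoissonSubordinator {
  subordinator_levy : levy_process X;
  subordinator_nondecreasing : forall (w : T) (s t : R),
    0 <= s -> s <= t -> X s w <= X t w;
  subordinator_laplace : forall t z : R, 0 <= t -> 0 <= z ->
    ('E_P[fun w => expR (- (z * X t w))] = (expR (- (t * phi mu 0 z)))%:E)%E
}.

Definition asymp_equiv {R : realType} (f g : R -> R) : Prop :=
  f x / g x @[x --> +oo] --> (1 : R).

Section ComplexAnalytic.
Context {R : realType}.
Notation C := (R[i] : numFieldType).

Definition analytic_on (D : set C) (F : C -> C) : Prop :=
  forall z0 : C, D z0 -> exists (r : R) (a : nat -> C), 0 < r /\
    forall z : C, `|z - z0| < (r%:C)%C ->
      series (fun k => a k * (z - z0) ^+ k) @ \oo --> F z.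

(* [t] is the argument of [z]. *)
Definition cone : set C :=
  [set z | 0 < complex.Re z /\
     exists2 t : R, `|t| < pi / 2 & z = `|z| * (cos t +i* sin t)%C].

End ComplexAnalytic.

(* Main.v *)
Require Import Defs.
From HB Require Import structures.
From mathcomp Require Import all_boot all_order all_algebra.
From mathcomp Require Import complex.
From mathcomp Require Import all_classical all_reals all_analysis.
From mathcomp Require Import measurable_realfun.
From mathcomp Require Import ring lra.

(** Write c for the limit of phi, psi(u) for the Laplace transform of mu, so that
    phi = c - psi on the positive half-line, and I for the exponential functional.

    Moments. The n-th power of an integral over [0, +oo[ is n! times the integral over
    ordered times. Integrating out the times one after the other, by independence and
    stationarity of the increments and by independence of the killing time, gives
    E[I^n] = n! p_n with p_n = 1 / (phi(1) ... phi(n)) (moment_density).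

    The equation. As p_n grows like c^-n, the law of I has exponential moments of every
    order below c, so it is determined by its moments. Comparing moments yields
    f(x) = c F(x) - int F(x e^v) mu(dv), where F is the tail of the law
    (density_equation). It can be differentiated any number of times, with good bounds
    on the derivatives (tail_derivative_equation, tail_derivative_bound).

    Decay. The differentiated equation shows that f(x) e^(c x) is nondecreasing, while
    F(x e^v) is negligible with respect to e^(- c x) for every v > 0. Hence the integral
    terms are negligible, the n-th derivative is equivalent to (-c)^n f
    (derivative_ratio), and ln f(x) is equivalent to - c x (ln_density_ratio). When the
    integral of 1/v diverges nothing more is asserted: the error term r is defined by
    the required equivalence and it is o(x) by the last statement.

    The constant. The number c^(n+1) p_n is the average of f(x) e^(c x) under a gamma
    distribution that escapes to infinity, so its limit is the limit of f(x) e^(c x)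
    (gamma_average_limit). It remains to find the asymptotics of
    ln p_n = - (ln phi(1) + ... + ln phi(n)), for which the trapezoid formula is used.
    Its error term is T_phi_star minus the same expression for the function ln, which
    encodes Stirling's constant (T0E, from the Wallis integrals); its main term contains
    the integral of phi' phi_star, which is convergent when 1/v is integrable at 0 and
    equals the double integral of the statement, up to elementary terms, after an
    exchange of integrations (integral_jump_kernel, moment_limit).

    Analyticity. The bounds show that the Taylor series of f at x converges for
    |z - x| < x. These disks exhaust the half-plane. The series at two centres agree on
    the smaller disk, because Taylor's formula towards the origin holds for f and all
    its derivatives (taylor_descent) and power series can be re-expanded
    (recentering). *)

Set Implicit Arguments.
Unset Strict Implicit.
Unset Printing Implicit Defensive.

Import Order.TTheory GRing.Theory Num.Theory.
Import numFieldNormedType.Exports.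

Local Open Scope classical_set_scope.
Local Open Scope ring_scope.

(** * Derivatives and antiderivatives *)

Section calculus.
Context {R : realType}.
Implicit Types (f g : R -> R) (x k a b : R).

(** Derivatives are kept relational, with the value as an index: the lemma that
    proves that a composite expression is derivable also computes its derivative. *)
Lemma isd_cst x k : is_derive x (1 : R) (fun=> k) 0.
Proof. exact: is_derive_cst. Qed.

Lemma isd_id x : is_derive x (1 : R) (fun y => y) 1.
Proof. exact: is_derive_id. Qed.

Lemma isd_add f g x a b : is_derive x (1 : R) f a -> is_derive x (1 : R) g b ->
  is_derive x (1 : R) (fun y => f y + g y) (a + b).
Proof. by move=> fa gb; exact: (is_deriveD fa gb). Qed.

Lemma isd_opp f x a : is_derive x (1 : R) f a ->
  is_derive x (1 : R) (fun y => - f y) (- a).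
Proof. by move=> fa; exact: (is_deriveN fa). Qed.

Lemma isd_sub f g x a b : is_derive x (1 : R) f a -> is_derive x (1 : R) g b ->
  is_derive x (1 : R) (fun y => f y - g y) (a - b).
Proof. by move=> fa gb; exact: isd_add fa (isd_opp gb). Qed.

Lemma isd_mul f g x a b : is_derive x (1 : R) f a -> is_derive x (1 : R) g b ->
  is_derive x (1 : R) (fun y => f y * g y) (f x * b + g x * a).
Proof. by move=> fa gb; exact: (is_deriveM fa gb). Qed.

Lemma isd_mull f x k a : is_derive x (1 : R) f a ->
  is_derive x (1 : R) (fun y => k * f y) (k * a).
Proof.
move=> fa; have := isd_mul (isd_cst x k) fa.
by rewrite mulr0 addr0.
Qed.

Lemma isd_comp f g x a b : is_derive (g x) (1 : R) f a -> is_derive x (1 : R) g b ->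
  is_derive x (1 : R) (fun y => f (g y)) (a * b).
Proof. exact: is_derive1_comp. Qed.

Lemma isd_expR f x a : is_derive x (1 : R) f a ->
  is_derive x (1 : R) (fun y => expR (f y)) (expR (f x) * a).
Proof. by move=> fa; exact: (isd_comp (is_derive_expR _)). Qed.

Lemma isd_ln f x a : 0 < f x -> is_derive x (1 : R) f a ->
  is_derive x (1 : R) (fun y => ln (f y)) (a / f x).
Proof.
by move=> f0 fa; have := isd_comp (is_derive1_ln f0) fa; rewrite mulrC.
Qed.

Lemma isd_inv f x a : f x != 0 -> is_derive x (1 : R) f a ->
  is_derive x (1 : R) (fun y => (f y)^-1) (- (a / f x ^+ 2)).
Proof.
move=> f0 fa; have := @is_deriveV _ f x a 1 f0 fa.
by rewrite -exprVn /GRing.scale/= mulNr mulrC.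
Qed.

Lemma isd_eq f g x a b : (forall y, f y = g y) -> a = b ->
  is_derive x (1 : R) f a -> is_derive x (1 : R) g b.
Proof. by move=> /funext -> ->. Qed.

Lemma isd_X f x a n : is_derive x (1 : R) f a ->
  is_derive x (1 : R) (fun y => f y ^+ n) (n%:R * f x ^+ n.-1 * a).
Proof.
move=> fa; elim: n => [|n IH].
  by apply: isd_eq (isd_cst x 1) => [y|]; rewrite ?expr0 ?mul0r.
apply: isd_eq (isd_mul fa IH) => [y|]; first by rewrite exprS.
case: n {IH} => [|n]/=; first by rewrite !mul0r mulr0 !expr0 add0r !mul1r.
by rewrite -[n.+2%:R]natr1 exprS; ring.
Qed.

Lemma isd_near f g x a : (\forall y \near x, f y = g y) ->
  is_derive x (1 : R) f a -> is_derive x (1 : R) g a.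
Proof. by move=> fg; exact: near_eq_is_derive. Qed.

Lemma isd_derivable f x a : is_derive x (1 : R) f a -> derivable f x 1.
Proof. by move=> fa; exact: ex_derive. Qed.

Lemma isd_derive1 f x a : is_derive x (1 : R) f a -> derive1 f x = a.
Proof. by move=> fa; rewrite derive1E; exact: derive_val. Qed.

Lemma isd_continuous f x a : is_derive x (1 : R) f a -> {for x, continuous f}.
Proof.
move=> fa; apply: (@differentiable_continuous _ R^o R^o).
by apply/derivable1_diffP; exact: isd_derivable fa.
Qed.

Lemma derivable_isd f x : derivable f x 1 -> is_derive x (1 : R) f (derive1 f x).
Proof. by move=> fx; rewrite derive1E; exact: DeriveDef. Qed.

Lemma isd_expRN (a x : R) :
  is_derive x (1 : R) (fun y => expR (- (a * y))) (- a * expR (- (a * x))).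
Proof.
apply: isd_eq (isd_expR (isd_opp (isd_mull a (isd_id x)))) => [//|].
by rewrite /= mulr1 mulrC.
Qed.

Lemma MVT_isd f (f' : R -> R) a b : a < b ->
  (forall x, a <= x <= b -> is_derive x (1 : R) f (f' x)) ->
  exists2 c, a < c < b & f b - f a = f' c * (b - a).
Proof.
move=> ab df.
have df' x : x \in `]a, b[%R -> is_derive x (1 : R) f (f' x).
  by rewrite in_itv/= => /andP[/ltW ax /ltW xb]; apply: df; rewrite ax.
have cf : {within `[a, b], continuous f}.
  apply: continuous_in_subspaceT => x; rewrite inE/= in_itv/= => xab.
  exact: isd_continuous (df x xab).
have [c cab E] := @MVT _ f f' a b ab df' cf.
by exists c => //; move: cab; rewrite in_itv.
Qed.

Lemma continuous_FTC2_isd f F a b : a < b ->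
  {within `[a, b], continuous f} ->
  (forall x, a <= x <= b -> is_derive x (1 : R) F (f x)) ->
  (\int[lebesgue_measure]_(x in `[a, b]) (f x)%:E = (F b - F a)%:E)%E.
Proof.
move=> ab cf dF; rewrite (continuous_FTC2 ab cf (F := F)) ?EFinB//.
- split.
  + move=> x; rewrite in_itv/= => /andP[/ltW ax /ltW xb].
    by apply: isd_derivable (dF x _); rewrite ax.
  + apply: cvg_at_right_filter; apply: isd_continuous (dF a _).
    by rewrite lexx ltW.
  + apply: cvg_at_left_filter; apply: isd_continuous (dF b _).
    by rewrite lexx ltW.
- move=> x; rewrite in_itv/= => /andP[/ltW ax /ltW xb].
  by apply: isd_derive1 (dF x _); rewrite ax.
Qed.

Lemma ge0_FTC2y_isd f F a l : (forall x, a <= x -> 0 <= f x) ->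
  (forall x, a <= x -> {for x, continuous f}) ->
  (forall x, a <= x -> is_derive x (1 : R) F (f x)) ->
  F x @[x --> +oo] --> l ->
  (\int[lebesgue_measure]_(x in `[a, +oo[) (f x)%:E = (l - F a)%:E)%E.
Proof.
move=> f0 cf dF Fl.
rewrite (@ge0_continuous_FTC2y _ f F a l) ?EFinB//.
- apply: continuous_in_subspaceT => x; rewrite inE/= in_itv/= andbT.
  exact: cf.
- by move=> x /ltW ax; exact: isd_derivable (dF x ax).
- by apply: cvg_at_right_filter; apply: isd_continuous (dF a _).
- by move=> x; rewrite in_itv/= andbT => /ltW ax; exact: isd_derive1 (dF x ax).
Qed.

Lemma isd_tail (h : R -> R) (a x : R) : a < x ->
  lebesgue_measure.-integrable (`]a, +oo[%classic : set R) (EFin \o h) -> {for x, continuous h} ->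
  is_derive x (1 : R) (fun y => \int[lebesgue_measure]_(t in `]y, +oo[) h t) (- h x).
Proof.
move=> ax ih ch.
pose F (y : R) := \int[lebesgue_measure]_(t in [set` Interval (BRight a) (BRight y)]) h t.
have ix : lebesgue_measure.-integrable [set` Interval (BRight a) (BRight (x + 1))] (EFin \o h).
  apply: integrableS ih => //.
  by move=> y /=; rewrite !in_itv/= andbT => /andP[].
have xx1 : x < x + 1 by rewrite ltrDl.
have bx : (BRight a < BRight x)%O by rewrite bnd_simp.
have [dF F'] := @continuous_FTC1 R h (BRight a) x (x + 1) xx1 ix bx ch.
have dFx : is_derive x (1 : R) F (h x) by rewrite -F'; exact: derivable_isd.
have := isd_sub (isd_cst x (\int[lebesgue_measure]_(t in `]a, +oo[) h t)) dFx; rewrite sub0r.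
apply: isd_near; near=> y.
have y0 : a < y by near: y; exact: lt_nbhsr.
by rewrite /F Rintegral_itvB// bnd_simp ltW.
Unshelve. all: by end_near. Qed.

End calculus.

(** * Expectations of products *)

Section independence.
Context {d : measure_display} {T : measurableType d} {R : realType}.
Variable P : probability T R.

(** Independence makes the law of the pair a product measure, to which Tonelli's
    theorem applies. Only preimages of Borel sets occur in the hypotheses, so that the
    sigma-algebras can be given as plain set systems. *)
Lemma indep_integralM (G H : set (set T)) (Y Z : T -> R) :
  measurable_fun [set: T] Y -> measurable_fun [set: T] Z ->
  (forall w, 0 <= Y w) -> (forall w, 0 <= Z w) ->
  (forall B : set R, measurable B -> G (Y @^-1` B)) ->
  (forall B : set R, measurable B -> H (Z @^-1` B)) ->
  indep_systems P G H ->
  (\int[P]_w (Y w * Z w)%:E = \int[P]_w (Y w)%:E * \int[P]_w (Z w)%:E)%E.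
Proof.
move=> mY mZ Y0 Z0 GY HZ GH.
have mYZ : measurable_fun [set: T] (fun w => (Y w, Z w)) by exact: measurable_fun_pair.
pose Y' : {mfun T >-> R} := mfun_Sub (mem_set mY).
pose Z' : {mfun T >-> R} := mfun_Sub (mem_set mZ).
pose YZ' : {mfun T >-> (R * R)%type} :=
  mfun_Sub (mem_set mYZ).
pose h (p : R * R) := (`|p.1 : R| * `|p.2 : R|)%:E.
have mh : measurable_fun setT h.
  apply/measurable_EFinP/measurable_funM.
    by apply: measurableT_comp; [exact: normr_measurable|exact: measurable_fst].
  by apply: measurableT_comp; [exact: normr_measurable|exact: measurable_snd].
have h0 p : (0 <= h p)%E by rewrite lee_fin mulr_ge0.
transitivity (\int[P]_w (h \o YZ') w)%E.
  by apply: eq_integral => w _; rewrite /h/= !ger0_norm.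
rewrite -ge0_integral_distribution//.
rewrite (@eq_measure_integral _ _ _ _ (distribution P Y' \x distribution P Z')%E); last first.
  move=> A mA _; symmetry; apply: product_measure_unique => // B C mB mC.
  rewrite /distribution/pushforward/=.
  transitivity (P ((Y @^-1` B) `&` (Z @^-1` C))); first by congr (P _).
  by rewrite GH//; [exact: GY|exact: HZ].
rewrite fubini_tonelli1//= /fubini_F.
have E1 (x : R) : (\int[distribution P Z']_y h (x, y) = (`|x|)%:E * \int[P]_w (Z w)%:E)%E.
  rewrite ge0_integral_distribution//=; last first.
    by apply: measurableT_comp => //; exact: measurable_pair1.
  under eq_integral do rewrite /h/= EFinM (ger0_norm (Z0 _)).
  rewrite ge0_integralZl//; first exact/measurable_EFinP.
  by move=> w _; rewrite lee_fin.
under eq_integral do rewrite E1.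
rewrite ge0_integralZr//; last 2 first.
- by apply/measurable_EFinP; exact: normr_measurable.
- by apply: integral_ge0 => w _; rewrite lee_fin.
rewrite ge0_integral_distribution//=; last first.
  by apply/measurable_EFinP; exact: normr_measurable.
by congr (_ * _)%E; apply: eq_integral => w _; rewrite /= ger0_norm.
Qed.

End independence.

(** * Powers of a tail integral *)

Section iterated_tail_integrals.
Context {R : realType}.
Local Notation leb := (@lebesgue_measure R).
Local Open Scope ereal_scope.

Definition ebool (b : bool) : \bar R := (b%:R)%:E.

Let bEt : ebool true = 1. Proof. by []. Qed.
Let bEf : ebool false = 0. Proof. by []. Qed.

Lemma ebool_ge0 b : 0 <= ebool b. Proof. by rewrite lee_fin. Qed.

Lemma measurable_ebool d (T : measurableType d) (b : T -> bool) :
  measurable_fun [set: T] b -> measurable_fun [set: T] (fun x => ebool (b x)).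
Proof.
move=> mb; apply/measurable_EFinP.
by apply: (measurableT_comp (f := fun c : bool => c%:R : R)).
Qed.

(** The integral of a(r_1) ... a(r_n) over s <= r_1 <= ... <= r_n. *)
Fixpoint iter_tail (a : R -> \bar R) n (s : R) : \bar R :=
  if n is n'.+1 then \int[leb]_r (ebool (s <= r)%R * (a r * iter_tail a n' r)) else 1.

Let iter_tailS a n s : iter_tail a n.+1 s =
  \int[leb]_r (ebool (s <= r)%R * (a r * iter_tail a n r)).
Proof. by []. Qed.

Lemma iter_tail_ge0 a n s : (forall r, 0 <= a r) -> 0 <= iter_tail a n s.
Proof.
move=> a0; elim: n s => [|n IH] s //=; apply: integral_ge0 => r _.
by rewrite !mule_ge0 ?ebool_ge0.
Qed.

Lemma measurable_iter_tail d (T : measurableType d) (a : R -> T -> \bar R) n :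
  (forall r w, 0 <= a r w) ->
  measurable_fun [set: R * T] (fun p => a p.1 p.2) ->
  measurable_fun [set: R * T] (fun p => iter_tail (a ^~ p.2) n p.1).
Proof.
move=> a0 ma; elim: n => [|n IH] /=; first exact: measurable_cst.
pose h (p : (R * T) * R) :=
  ebool (p.1.1 <= p.2)%R * (a p.2 p.1.2 * iter_tail (a ^~ p.1.2) n p.2).
have mh : measurable_fun setT h.
  have m21 : measurable_fun [set: (R * T) * R] (fun p => (p.2, p.1.2)).
    apply: measurable_fun_pair => //.
    exact: measurableT_comp measurable_snd measurable_fst.
  apply: emeasurable_funM.
    apply: measurable_ebool; apply: measurable_fun_ler => //.
    exact: measurableT_comp measurable_fst measurable_fst.
  by apply: emeasurable_funM; [exact: measurableT_comp ma m21|
    exact: measurableT_comp IH m21].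
have h0 p : 0 <= h p by rewrite !mule_ge0 ?ebool_ge0 ?iter_tail_ge0.
exact: (@measurable_fun_fubini_tonelli_F _ _ _ _ R leb h mh h0).
Qed.

Lemma measurable_iter_tail1 (a : R -> \bar R) n : (forall r, 0 <= a r) ->
  measurable_fun setT a -> measurable_fun setT (iter_tail a n).
Proof.
move=> a0 ma.
have := @measurable_iter_tail _ R (fun r _ => a r) n (fun r _ => a0 r).
move=> /(_ (measurableT_comp ma measurable_fst)) h.
have m1 : measurable_fun [set: R] (fun r : R => (r, r)) by exact: measurable_fun_pair.
exact: (measurableT_comp h m1).
Qed.

Lemma integral_ebool_lt (h : R -> \bar R) (u : R) : measurable_fun setT h ->
  \int[leb]_r (ebool (u < r)%R * h r) = \int[leb]_r (ebool (u <= r)%R * h r).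
Proof.
move=> mh.
have bI (b : R -> bool) (D : set R) : (forall r, D r <-> b r) ->
    \int[leb]_r (ebool (b r) * h r) = \int[leb]_(r in D) h r.
  move=> bD; rewrite [RHS]integral_mkcond; apply: eq_integral => r _.
  rewrite patchE; have [br|nbr] := boolP (b r).
    by rewrite mem_set ?bEt ?mul1e//; apply/bD.
  by rewrite memNset ?bEf ?mul0e// => /bD; apply/negP.
rewrite (bI (fun r => u < r)%R `]u, +oo[%classic); last first.
  by move=> r/=; rewrite in_itv/= andbT.
rewrite (bI (fun r => u <= r)%R `[u, +oo[%classic); last first.
  by move=> r/=; rewrite in_itv/= andbT.
by rewrite integral_itv_obnd_cbnd//; exact: measurable_funTS.
Qed.

Local Ltac measurability_ebool := repeat first [ assumption | match goal with h : _ |- _ => exact: h end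
  | apply: emeasurable_funM ].

(** Inserting one more variable into an ordered chain of n variables can be done in
    n + 1 places. In the induction the new variable is compared with the smallest one. *)
Lemma iter_tail_mul (a : R -> \bar R) n s : (forall r, 0 <= a r) ->
  measurable_fun setT a ->
  iter_tail a 1 s * iter_tail a n s = (n.+1)%:R%:E * iter_tail a n.+1 s.
Proof.
move=> a0 ma; elim: n s => [|n IH] s; first by rewrite mule1 mul1e.
have mK k := @measurable_iter_tail1 a k a0 ma.
have K0 k r : 0 <= iter_tail a k r by exact: iter_tail_ge0.
have mle1 (u : R) : measurable_fun [set: R] (fun r : R => ebool (u <= r)%R).
  by apply: measurable_ebool; exact: measurable_fun_ler.
have mlt1 (u : R) : measurable_fun [set: R] (fun r : R => ebool (u < r)%R).
  by apply: measurable_ebool; exact: measurable_fun_ltr.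
have mlt2 (u : R) : measurable_fun [set: R] (fun r : R => ebool (r < u)%R).
  by apply: measurable_ebool; exact: measurable_fun_ltr.
have mmule1 : measurable_fun [set: R] (fun r => a r * 1) by apply: emeasurable_funM.
have mKn : measurable_fun setT (fun r => iter_tail a n r) by exact: mK.
have mKn1 : measurable_fun setT (fun r => iter_tail a n.+1 r) by exact: mK.
pose mid r := \int[leb]_u (ebool (s <= u)%R * (ebool (u < r)%R * a u)).
(* the extra variable lies beyond r, or between s and r *)
have splitJ r : (s <= r)%R -> iter_tail a 1 s = iter_tail a 1 r + mid r.
  move=> sr; rewrite /= /mid -ge0_integralD//=; last 4 first.
  - by move=> x _; rewrite !mule_ge0 ?ebool_ge0.
  - by measurability_ebool.
  - by move=> x _; rewrite !mule_ge0 ?ebool_ge0.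
  - by measurability_ebool.
  apply: eq_integral => u _; rewrite mule1.
  have [ru|ur] := leP r u; first by rewrite (le_trans sr ru) bEt bEf !mul1e mul0e adde0.
  by rewrite bEt bEf mul0e add0e mul1e.
have mmid : measurable_fun setT mid.
  pose g (p : R * R) := ebool (s <= p.2)%R * (ebool (p.2 < p.1)%R * a p.2).
  have mg : measurable_fun setT g.
    apply: emeasurable_funM; first exact: measurableT_comp (mle1 s) measurable_snd.
    apply: emeasurable_funM; last exact: measurableT_comp ma measurable_snd.
    by apply: measurable_ebool; apply: measurable_fun_ltr.
  have g0 p : 0 <= g p by rewrite !mule_ge0 ?ebool_ge0.
  exact: (@measurable_fun_fubini_tonelli_F _ _ _ _ R leb g mg g0).
have mid0 r : 0 <= mid r.
  by apply: integral_ge0 => x _; rewrite !mule_ge0 ?ebool_ge0.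
have mI k : measurable_fun setT (fun r => ebool (s <= r)%R * (a r * iter_tail a k r)).
  by measurability_ebool.
rewrite [X in _ * X = _]iter_tailS -ge0_integralZl//; last 2 first.
- exact: mI.
- by move=> r _; rewrite !mule_ge0 ?ebool_ge0.
transitivity (\int[leb]_r ((n.+1)%:R%:E * (ebool (s <= r)%R * (a r * iter_tail a n.+1 r))
   + ebool (s <= r)%R * (a r * iter_tail a n r) * mid r)).
  apply: eq_integral => r _; rewrite muleC.
  have [sr|sr] := leP s r; last by rewrite bEf !mul0e mule0 adde0.
  rewrite (splitJ r sr) ge0_muleDr//; congr (_ + _).
  rewrite bEt !mul1e -muleA [iter_tail a n r * _]muleC IH.
  by rewrite muleCA.
rewrite ge0_integralD//; last 4 first.
- by move=> r _; rewrite !mule_ge0 ?ebool_ge0 ?lee_fin.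
- by measurability_ebool.
- by move=> r _; rewrite !mule_ge0 ?ebool_ge0.
- by measurability_ebool.
rewrite ge0_integralZl//; last 2 first.
- by measurability_ebool.
- by move=> r _; rewrite !mule_ge0 ?ebool_ge0.
have -> : \int[leb]_r (ebool (s <= r)%R * (a r * iter_tail a n r) * mid r) =
    iter_tail a n.+2 s.
  transitivity (\int[leb]_r \int[leb]_u (ebool (s <= u)%R * a u *
      (ebool (u < r)%R * (a r * iter_tail a n r)))).
    apply: eq_integral => r _; rewrite -ge0_integralZl//; last 3 first.
    - by measurability_ebool.
    - by move=> x _; rewrite !mule_ge0 ?ebool_ge0.
    - by rewrite !mule_ge0 ?ebool_ge0.
    apply: eq_integral => u _.
    have [ur|ur] := ltP u r; last by rewrite bEf !(mul0e, mule0).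
    have [su|su] := leP s u; last by rewrite bEf !(mul0e, mule0).
    by rewrite (le_trans su (ltW ur)) bEt !mul1e muleC.
  pose g (p : R * R) := ebool (s <= p.2)%R * a p.2 *
      (ebool (p.2 < p.1)%R * (a p.1 * iter_tail a n p.1)).
  have mg : measurable_fun setT g.
    apply: emeasurable_funM; apply: emeasurable_funM.
    - exact: measurableT_comp (mle1 s) measurable_snd.
    - exact: measurableT_comp ma measurable_snd.
    - by apply: measurable_ebool; apply: measurable_fun_ltr.
    - by apply: emeasurable_funM; [exact: measurableT_comp ma measurable_fst|
        exact: measurableT_comp (mK n) measurable_fst].
  have g0 p : 0 <= g p by rewrite !mule_ge0 ?ebool_ge0.
  rewrite (@fubini_tonelli _ _ _ _ R leb leb g mg g0) /g/=.
  apply: eq_integral => u _; rewrite ge0_integralZl//; last 3 first.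
  - by measurability_ebool.
  - by move=> x _; rewrite !mule_ge0 ?ebool_ge0.
  - by rewrite !mule_ge0 ?ebool_ge0.
  by rewrite integral_ebool_lt ?muleA//; by measurability_ebool.
rewrite -[X in _ + X]mul1e -ge0_muleDl ?lee_fin//.
by rewrite -EFinD natr1.
Qed.

End iterated_tail_integrals.

(** * Joint measurability of the process *)

Section joint_measurability.
Context {d : measure_display} {T : measurableType d} {R : realType}.

Lemma ratr_between (x y : R) : x < y -> exists r : rat, x < ratr r < y.
Proof.
by move=> /rat_in_itvoo[r]; rewrite in_itv/= => h; exists r.
Qed.

(** By monotonicity and right continuity, X_s < y holds iff X_r < y for some rational
    r > s, which makes the sublevel sets countable unions of rectangles. *)
Lemma measurable_right_continuous_process (X : R -> T -> R) :
  (forall s, measurable_fun [set: T] (X s)) ->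
  (forall w s t, 0 <= s -> s <= t -> X s w <= X t w) ->
  (forall w t, 0 <= t -> X s w @[s --> t^'+] --> X t w) ->
  measurable_fun [set p : R * T | 0 <= p.1] (fun p => X p.1 p.2).
Proof.
move=> mX ndX rcX mD.
apply: (measurability _ (RGenInftyO.measurableE R)) => //.
move=> _ [_ [y ->] <-].
pose F (r : rat) : set (R * T) :=
  `[0, ratr r[%classic `*` (X (ratr r) @^-1` `]-oo, y[%classic).
suff -> : [set p : R * T | 0 <= p.1] `&` (fun p => X p.1 p.2) @^-1` `]-oo, y[ =
    \bigcup_r F r.
  apply: bigcupT_measurable_rat => r; apply: measurableX => //.
  by rewrite -[X in measurable X]setTI; exact: mX.
apply/seteqP; split => [[s w]/= [s0]|[s w] [r _]]; last first.
  rewrite /F/= !in_itv/= => -[/andP[s0 sr]] Xy; split => //.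
  by rewrite (le_lt_trans _ Xy)// ndX// ltW.
rewrite in_itv/= => Xy.
have : \forall u \near s^'+, s < u /\ X u w < y.
  near=> u; split; first by near: u; exact: nbhs_right_gt.
  near: u; move: (rcX w s s0) => /cvgr_lt; exact.
move=> /filter_ex[u [/ratr_between[r /andP[sr ru]] Xu]].
exists r => //; rewrite /F/=; split; rewrite in_itv/= ?s0//.
by rewrite (le_lt_trans _ Xu)// ndX// ltW// (le_lt_trans s0).
Unshelve. all: by end_near. Qed.

End joint_measurability.

(** * Exponential killing times *)

Section exponential_tail.
Context {R : realType}.
Local Notation leb := (@lebesgue_measure R).

Lemma cvgy_expRN (a : R) : 0 < a -> expR (- (a * x)) @[x --> +oo] --> (0 : R).
Proof.
move=> a0; apply: (cvg_comp (fun x : R => a * x) (fun y => expR (- y))).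
  by apply: gt0_cvgMry => //; exact: cvg_id.
exact: cvgr_expR.
Qed.

Lemma measurable_expRN (a : R) :
  measurable_fun [set: R] (fun x : R => expR (- (a * x))).
Proof.
by apply: continuous_measurable_fun => x; exact: isd_continuous (isd_expRN a x).
Qed.

Lemma integral_expRN_tail (a s : R) : 0 < a ->
  (\int[leb]_(x in `[s, +oo[) (expR (- (a * x)))%:E = (expR (- (a * s)) / a)%:E)%E.
Proof.
move=> a0.
have dF x : is_derive x (1 : R) (fun y => - a^-1 * expR (- (a * y))) (expR (- (a * x))).
  apply: isd_eq (isd_mull (- a^-1) (isd_expRN a x)) => [//|].
  by rewrite mulrA mulrNN mulVf ?gt_eqF// mul1r.
rewrite (@ge0_FTC2y_isd _ _ (fun y => - a^-1 * expR (- (a * y))) s 0).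
- by rewrite sub0r mulNr opprK mulrC.
- by move=> x _; exact: expR_ge0.
- by move=> x _; exact: isd_continuous (isd_expRN a x).
- rewrite -[X in _ --> X](mulr0 (- a^-1)); apply: cvgM; first exact: cvg_cst.
  exact: cvgy_expRN.
Qed.

End exponential_tail.

Section killing_time.
Context {d : measure_display} {T : measurableType d} {R : realType}.
Variables (P : probability T R) (q : R) (e : {RV P >-> \bar R}).
Hypothesis e_exp : exponential_time q e.

(** The law of an exponential time is prescribed on Borel sets of reals only, so for
    q > 0 the value +oo has to be excluded by total mass. *)
Lemma exponential_time_tail (s : R) : 0 <= q -> 0 <= s ->
  P [set w | (s%:E < e w)%E] = (expR (- (q * s)))%:E.
Proof.
have [e_pos e_0] := e_exp.
have mlt : measurable [set w | (s%:E < e w)%E].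
  by rewrite -[X in measurable X]setTI; exact: measurable_lte.
rewrite le_eqVlt => /predU1P[q0|q0] s0.
  rewrite -q0 mul0r oppr0 expR0 -(@probability_setT _ _ _ P).
  have [N [mN PN0 eN]] := e_0 (esym q0).
  apply/eqP; rewrite eq_le; apply/andP; split; first by rewrite le_measure ?inE.
  rewrite -[leRHS]adde0 -PN0; apply: le_trans (measureU2 _ _ _) => //.
  apply: le_measure; rewrite ?inE//; first exact: measurableU.
  move=> w _; have [/eqP ew|ew] := boolP (e w == +oo%E).
    by left; rewrite /= ew ltry.
  by right; apply: eN => /= /eqP; apply/negP.
have Efin (B : set R) : measurable B -> measurable (e @^-1` (EFin @` B)).
  by move=> mB; rewrite -[X in measurable X]setTI; apply: measurable_funP => //;
     exact: measurable_image_EFin.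
(* the law restricted to the reals already has total mass one *)
have Pfin : P (~` (e @^-1` (EFin @` [set: R]))) = 0%E.
  rewrite probability_setC; last exact: Efin.
  rewrite [X in (_ - X)%E](e_pos q0 _ measurableT) probability_setT//; exact: subee.
transitivity (P (e @^-1` (EFin @` `]s, +oo[))).
  apply/eqP; rewrite eq_le; apply/andP; split; last first.
    apply: le_measure; rewrite ?inE//; first exact: Efin.
    by move=> w [x /=]; rewrite in_itv/= andbT => sx <-; rewrite lte_fin.
  rewrite -[leRHS]adde0 -Pfin; apply: le_trans (measureU2 _ _ _) => //.
  - apply: le_measure; rewrite ?inE//.
      by apply: measurableU; [exact: Efin|apply: measurableC; exact: Efin].
    move=> w /= sw; have [[x xe]|nex] := pselect (exists x : R, e w = x%:E).
      left; exists x; rewrite ?xe//= in_itv/= andbT.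
      by rewrite -lte_fin -xe.
    by right => -[x _ xe]; apply: nex; exists x.
  - exact: Efin.
  - by apply: measurableC; exact: Efin.
rewrite e_pos// /exponential_prob integral_itv_obnd_cbnd; last first.
  by apply/measurable_EFinP; apply: measurable_funTS; exact: measurable_exponential_pdf.
transitivity (\int[lebesgue_measure]_(x in `[s, +oo[) (q%:E * (expR (- (q * x)))%:E))%E.
  apply: eq_integral => x; rewrite inE/= in_itv/= andbT => sx.
  by rewrite exponential_pdfE ?mulNr// (le_trans s0).
rewrite ge0_integralZl//.
- by rewrite integral_expRN_tail// -EFinM mulrC divfK// gt_eqF.
- apply/measurable_EFinP; apply: measurable_funTS.
  exact: measurable_expRN.
- by rewrite lee_fin ltW.
Qed.

End killing_time.

(** * Iterated integrals along the subordinator *)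

Section moments.
Context {d : measure_display} {T : measurableType d} {R : realType}.
Variables (P : probability T R).
Variable mu : {finite_measure set (measurableTypeR R) -> \bar R}.
Variables (q : R) (X : R -> {RV P >-> R}) (e : {RV P >-> \bar R}).
Hypothesis q_ge0 : 0 <= q.
Hypothesis X_cpp : compound_poisson_subordinator mu X.
Hypothesis e_exp : exponential_time q e.
Hypothesis X_e_indep : indep_systems P (sigma_process `[0, +oo[ X) (sigma_rv e).
Hypothesis phi_gt0 : forall k : nat, 0 < phi mu q k.+1%:R.
Local Notation leb := (@lebesgue_measure R).

Lemma phiE (z : R) : phi mu q z = q + phi mu 0 z.
Proof. by rewrite /phi add0r. Qed.

(** The integrand of the exponential functional, cut off at negative times so that
    its integrals extend over the whole line. *)
Definition weight (s : R) (w : T) : \bar R :=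
  (if (0 <= s) && (s%:E < e w)%E then expR (- X s w) else 0)%:E.

Lemma weight_ge0 s w : (0 <= weight s w)%E.
Proof. by rewrite /weight lee_fin; case: ifP => // _; exact: expR_ge0. Qed.

Lemma measurable_weight : measurable_fun [set: R * T] (fun p => weight p.1 p.2).
Proof.
apply/measurable_EFinP.
have m1 : measurable [set p : R * T | (p.1%:E < e p.2)%E].
  rewrite -[X in measurable X]setTI; apply: measurable_lte => //.
    by apply/measurable_EFinP; exact: measurable_fst.
  by apply: measurableT_comp => //; exact: measurable_snd.
have m0 : measurable [set p : R * T | 0 <= p.1].
  rewrite -[X in measurable X]setTI.
  have : measurable_fun [set: R * T] (fun p : R * T => 0 <= p.1).
    by apply: measurable_fun_ler.
  by move=> /(_ measurableT [set true]); apply.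
have -> : (fun p : R * T => if (0 <= p.1) && (p.1%:E < e p.2)%E
     then expR (- X p.1 p.2) else 0) =
   (fun p => expR (- X p.1 p.2)) \_ ([set p : R * T | 0 <= p.1] `&`
     [set p : R * T | (p.1%:E < e p.2)%E]).
  apply/funext => p; rewrite patchE /=.
  case: ifPn => [/andP[a b]|]; first by rewrite mem_set.
  by rewrite negb_and => ab; rewrite memNset// => -[a b]; rewrite a b in ab.
apply/(measurable_restrictT _ (measurableI _ _ m0 m1)).
apply: (@measurable_funS _ _ _ _ [set p : R * T | 0 <= p.1]) => //.
apply: measurableT_comp; first exact: measurable_expR.
apply: measurable_funN.
have [lX ndX _] := X_cpp; apply: (@measurable_right_continuous_process _ _ _ (fun s w => X s w)) => //.
exact: levy_right_continuous lX.
Qed.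

Lemma sigma_processS (D D' : set R) : D `<=` D' ->
  sigma_process D X `<=` sigma_process D' X.
Proof.
by move=> DD'; apply: sub_sigma_algebra2 => A [u Du sA]; exists u => //; exact: DD'.
Qed.

Lemma sigma_process_measurable D : sigma_process D X `<=` measurable.
Proof.
apply: smallest_sub; first exact: sigma_algebra_measurable.
move=> A [u _] [B mB <-]; exact: measurable_funP.
Qed.

Definition adapted (s : R) (Y : T -> R) : Prop := measurable_fun
  [set: g_sigma_algebraType (\bigcup_(u in `[0, s]) sigma_rv (X u))] Y.

Lemma adapted_sigma s Y : adapted s Y ->
  forall B : set R, measurable B -> sigma_process `[0, s] X (Y @^-1` B).
Proof. by move=> aY B mB; have := aY measurableT B mB; rewrite setTI. Qed.

Lemma adapted_measurable s Y : adapted s Y -> measurable_fun [set: T] Y.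
Proof.
move=> aY _ B mB; rewrite setTI.
by apply: (@sigma_process_measurable `[0, s]%classic); exact: adapted_sigma aY _ mB.
Qed.

Lemma adaptedS s r Y : s <= r -> adapted s Y -> adapted r Y.
Proof.
move=> sr aY _ B mB; rewrite setTI.
apply: (@sigma_processS `[0, s] `[0, r]); last exact: adapted_sigma.
exact/subset_itvl.
Qed.

Lemma adapted_process s : 0 <= s -> adapted s (X s).
Proof.
move=> s0 _ B mB; rewrite setTI; apply: sub_sigma_algebra.
exists s; first by rewrite /= in_itv/= s0 lexx.
by exists B => //; rewrite setTI.
Qed.

Lemma adapted_mul_expR s Y z : 0 <= s -> adapted s Y ->
  adapted s (fun w => Y w * expR (- (z * X s w))).
Proof.
move=> s0 aY; apply: measurable_funM => //.
apply: (measurableT_comp (measurable_expRN z)).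
exact: adapted_process.
Qed.

Lemma laplace_process (t : R) (k : nat) : 0 <= t ->
  (\int[P]_w (expR (- (k%:R * X t w)))%:E = (expR (- (t * phi mu 0 k%:R)))%:E)%E.
Proof.
move=> t0; have := subordinator_laplace X_cpp t0 (ler0n R k).
by rewrite unlock.
Qed.

Lemma laplace_increment (s r : R) (k : nat) : 0 <= s -> s <= r ->
  (\int[P]_w (expR (- (k%:R * (X r w - X s w))))%:E =
   (expR (- ((r - s) * phi mu 0 k%:R)))%:E)%E.
Proof.
move=> s0 sr; rewrite -laplace_process ?subr_ge0//.
have mXX : measurable_fun [set: T] (fun w => X r w - X s w).
  by apply: measurable_funB.
pose Z : {mfun T >-> R} := mfun_Sub (mem_set mXX).
have mf : measurable_fun [set: R] (fun x : R => (expR (- (k%:R * x)))%:E).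
  by apply/measurable_EFinP; exact: measurable_expRN.
have f0 (x : R) : (0 <= (expR (- (k%:R * x)))%:E)%E by rewrite lee_fin expR_ge0.
transitivity (\int[distribution P Z]_x (expR (- (k%:R * x)))%:E)%E.
  by rewrite ge0_integral_distribution.
transitivity (\int[distribution P (X (r - s))]_x (expR (- (k%:R * x)))%:E)%E.
  apply: eq_measure_integral => A mA _.
  exact: (levy_stationary_increments (subordinator_levy X_cpp) s0 sr mA).
by rewrite ge0_integral_distribution.
Qed.

Lemma integral_adapted_laplace (s r : R) (k : nat) (Y : T -> R) : 0 <= s -> s <= r ->
  adapted s Y -> (forall w, 0 <= Y w) ->
  (\int[P]_w (Y w * expR (- (k%:R * (X r w - X s w))))%:E =
   \int[P]_w (Y w)%:E * (expR (- ((r - s) * phi mu 0 k%:R)))%:E)%E.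
Proof.
move=> s0 sr aY Y0.
rewrite (@indep_integralM _ _ _ P (sigma_process `[0, s] X)
  (sigma_rv (fun w => X r w - X s w)) Y (fun w => expR (- (k%:R * (X r w - X s w))))) //.
- by rewrite laplace_increment.
- exact: adapted_measurable aY.
- apply: (measurableT_comp (measurable_expRN k%:R)).
  by apply: measurable_funB.
- exact: adapted_sigma.
- move=> B mB; exists ((fun x => expR (- (k%:R * x))) @^-1` B) => //.
    by rewrite -[X in measurable X]setTI; exact: measurable_expRN.
  by rewrite setTI.
- exact: (levy_indep_increments (subordinator_levy X_cpp) s0 sr).
Qed.

(** The killing time is independent of the whole process, in particular of its past. *)
Lemma integral_adapted_killing (s : R) (Y : T -> R) : 0 <= s ->
  adapted s Y -> (forall w, 0 <= Y w) ->
  (\int[P]_w ((Y w)%:E * ebool (s%:E < e w)%E) =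
   \int[P]_w (Y w)%:E * (expR (- (q * s)))%:E)%E.
Proof.
move=> s0 aY Y0; rewrite -(exponential_time_tail e_exp q_ge0 s0).
have mlt : measurable [set w | (s%:E < e w)%E].
  by rewrite -[X in measurable X]setTI; exact: measurable_lte.
pose Z w : R := (s%:E < e w)%E%:R.
have ZE : Z = \1_[set w | (s%:E < e w)%E].
  apply/funext => w; rewrite /Z indicE.
  have [sw|sw] := boolP (s%:E < e w)%E; first by rewrite mem_set.
  by rewrite memNset//= => h; rewrite h in sw.
rewrite -[X in (_ * P X)%E]setIT -(@integral_indic _ _ _ P setT)//.
rewrite -ZE -(@indep_integralM _ _ _ P (sigma_process `[0, s] X) (sigma_rv e)) //.
- exact: adapted_measurable aY.
- by rewrite ZE; exact: measurable_indic.
- exact: adapted_sigma.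
- move=> B mB; exists ((fun x : \bar R => (s%:E < x)%E%:R : R) @^-1` B) => //; last first.
    by rewrite setTI.
  rewrite -[X in measurable X]setTI.
  have m : measurable_fun [set: \bar R] (fun x : \bar R => ((s%:E < x)%E%:R : R)).
    apply: (measurableT_comp (f := fun c : bool => c%:R : R)) => //.
    exact: measurable_fun_lte.
  exact: m.
- move=> A B sA sB; apply: X_e_indep => //.
  by apply: sigma_processS sA => u/=; rewrite !in_itv/= => /andP[->].
Qed.

(** The n-th moment of the exponential functional, divided by n!. *)
Definition moment_coef (n : nat) : R := \prod_(k < n) (phi mu q k.+1%:R)^-1.

Lemma moment_coef_ge0 n : 0 <= moment_coef n.
Proof. by apply: prodr_ge0 => k _; rewrite invr_ge0 ltW. Qed.

(** The weighted tail integral against a variable Y known at time s. Keeping Y and s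
    general lets the induction on n apply at the smallest of the remaining times. *)
Let tail_formula n := forall s Y, 0 <= s -> adapted s Y -> (forall w, 0 <= Y w) ->
  (\int[P]_w ((Y w)%:E * (weight s w * iter_tail (weight ^~ w) n s)) =
   (moment_coef n * expR (- (q * s)))%:E *
     \int[P]_w (Y w * expR (- (n.+1%:R * X s w)))%:E)%E.

(** Once the smallest time r is singled out, expR (- ((n + 1) X_r)) splits into a
    factor from the past of s and an independent increment, and what remains is an
    exponential integral over r >= s of rate phi(n + 1). *)
Lemma expectation_iter_tailS n : tail_formula n ->
  forall s Y, 0 <= s -> adapted s Y -> (forall w, 0 <= Y w) ->
  (\int[P]_w ((Y w)%:E * iter_tail (weight ^~ w) n.+1 s) =
   (moment_coef n.+1 * expR (- (q * s)))%:E *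
     \int[P]_w (Y w * expR (- (n.+1%:R * X s w)))%:E)%E.
Proof.
move=> IH s Y s0 aY Y0.
pose K r w := iter_tail (weight ^~ w) n r.
have K0 r w : (0 <= K r w)%E by apply: iter_tail_ge0 => u; exact: weight_ge0.
have mK : measurable_fun [set: R * T] (fun p => K p.1 p.2).
  by apply: measurable_iter_tail measurable_weight => u w; exact: weight_ge0.
pose h w r := (ebool (s <= r)%R * ((Y w)%:E * (weight r w * K r w)))%E.
have h0 w r : (0 <= h w r)%E by rewrite !mule_ge0 ?weight_ge0 ?K0// lee_fin.
have mY := adapted_measurable aY.
have mle : measurable_fun [set: R] (fun r : R => ebool (s <= r)%R : \bar R).
  by apply: measurable_ebool; exact: measurable_fun_ler.
have mh : measurable_fun [set: T * R] (fun p => h p.1 p.2).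
  have msw : measurable_fun [set: T * R] (fun p => (p.2, p.1)).
    by apply: measurable_fun_pair.
  apply: emeasurable_funM; first exact: (measurableT_comp mle measurable_snd).
  apply: emeasurable_funM.
    by apply/measurable_EFinP; exact: (measurableT_comp mY measurable_fst).
  apply: emeasurable_funM; first exact: (measurableT_comp measurable_weight msw).
  exact: (measurableT_comp mK msw).
transitivity (\int[P]_w \int[leb]_r h w r)%E.
  apply: eq_integral => w _.
  have mwr : measurable_fun [set: R] (fun r : R => (r, w)) by exact: measurable_fun_pair.
  rewrite [iter_tail _ _ _]/= -ge0_integralZl//; last 3 first.
  - apply: emeasurable_funM; first exact: mle.
    apply: emeasurable_funM; first exact: (measurableT_comp measurable_weight mwr).
    exact: (measurableT_comp mK mwr).
  - by move=> r _; rewrite mule_ge0 ?ebool_ge0// mule_ge0 ?weight_ge0//; exact: (K0 r w).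
  - by rewrite lee_fin.
  by apply: eq_integral => r _; rewrite /h muleCA.
rewrite (@fubini_tonelli _ _ _ _ R P leb (fun p => h p.1 p.2) mh (fun p => h0 _ _)) /=.
pose M := (\int[P]_w (Y w * expR (- (n.+1%:R * X s w)))%:E)%E.
have M0 : (0 <= M)%E.
  by apply: integral_ge0 => w _; rewrite lee_fin mulr_ge0// expR_ge0.
pose f1 := phi mu 0 n.+1%:R.
transitivity (\int[leb]_r (ebool (s <= r)%R * (((moment_coef n * expR (s * f1))%:E * M)
     * (expR (- (phi mu q n.+1%:R * r)))%:E)))%E.
  apply: eq_integral => r _; rewrite /h ge0_integralZl//; last 3 first.
  - apply: emeasurable_funM; first exact/measurable_EFinP.
    have mrw : measurable_fun [set: T] (fun w => (r, w)) by exact: measurable_fun_pair.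
    apply: emeasurable_funM; first exact: (measurableT_comp measurable_weight mrw).
    exact: (measurableT_comp mK mrw).
  - by move=> w _; rewrite !mule_ge0 ?weight_ge0 ?K0// lee_fin.
  - exact: ebool_ge0.
  have [sr|rs] := leP s r; last by rewrite !mul0e.
  congr (_ * _)%E.
  rewrite IH ?(le_trans s0 sr)//; last exact: adaptedS aY.
  under eq_integral => w _.
    have -> : Y w * expR (- (n.+1%:R * X r w)) = Y w * expR (- (n.+1%:R * X s w)) *
        expR (- (n.+1%:R * (X r w - X s w))).
      by rewrite -!mulrA -!expRD; congr (_ * expR _); ring.
    over.
  rewrite (integral_adapted_laplace n.+1 s0 sr); last 2 first.
  - exact: adapted_mul_expR.
  - by move=> w; rewrite mulr_ge0// expR_ge0.
  rewrite -/M [RHS]muleAC -EFinM [RHS]muleC [(M * _)%E]muleC muleA -EFinM.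
  rewrite [RHS]muleC; congr (_%:E * _)%E; rewrite -!mulrA -!expRD.
  by congr (_ * expR _); rewrite /f1 (phiE n.+1%:R); ring.
have -> : (\int[leb]_r (ebool (s <= r)%R * (((moment_coef n * expR (s * f1))%:E * M)
     * (expR (- (phi mu q n.+1%:R * r)))%:E)) =
  (moment_coef n * expR (s * f1))%:E * M *
   \int[leb]_(r in `[s, +oo[) (expR (- (phi mu q n.+1%:R * r)))%:E)%E.
  have k0 : (0 <= (moment_coef n * expR (s * f1))%:E * M)%E.
    by rewrite mule_ge0// lee_fin mulr_ge0 ?expR_ge0// moment_coef_ge0.
  move: (_ * M)%E k0 => k k0.
  rewrite -ge0_integralZl//; last first.
    by apply/measurable_EFinP; apply: measurable_funTS; exact: measurable_expRN.
  rewrite [RHS]integral_mkcond; apply: eq_integral => r _; rewrite patchE.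
  have [sr|rs] := leP s r; first by rewrite mul1e mem_set//= in_itv/= sr.
  by rewrite mul0e memNset//= in_itv/= leNgt rs.
rewrite integral_expRN_tail// muleAC -EFinM; congr (_%:E * _)%E.
rewrite /moment_coef big_ord_recr/= -!mulrA; congr (_ * _).
rewrite mulrA -expRD mulrC; congr (_ * expR _).
by rewrite /f1 (phiE n.+1%:R); ring.
Qed.

Lemma expectation_iter_tail n : tail_formula n.
Proof.
elim: n => [|n IH] s Y s0 aY Y0.
  rewrite /moment_coef big_ord0 mul1r muleC.
  rewrite -integral_adapted_killing//; first last.
  - by move=> w; rewrite mulr_ge0// expR_ge0.
  - exact: adapted_mul_expR.
  apply: eq_integral => w _; rewrite /= mule1 /weight s0/= mul1r.
  by case: ifP => _; rewrite /ebool -!EFinM ?mulr1// !mulr0.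
pose Y' w := Y w * expR (- (1 * X s w)).
have aY' : adapted s Y' by exact: adapted_mul_expR.
have Y'0 w : 0 <= Y' w by rewrite mulr_ge0// expR_ge0.
transitivity (\int[P]_w ((Y' w)%:E * iter_tail (weight ^~ w) n.+1 s))%E.
  apply: eq_integral => w _; rewrite [weight s w]/weight s0/=.
  case: ifPn => [se|]; first by rewrite /Y' mul1r EFinM muleA.
  (* past the killing time the tail integral vanishes by itself *)
  rewrite -leNgt => es; rewrite integral0_eq ?mule0// => r _.
  have [sr|rs] := leP s r; last by rewrite mul0e.
  have -> : weight r w = 0%E.
    by rewrite /weight (le_trans s0 sr)/= ltNge (le_trans es)// lee_fin.
  by rewrite !(mul0e, mule0).
rewrite (expectation_iter_tailS IH s0 aY' Y'0); congr (_ * _)%E.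
apply: eq_integral => w _; rewrite /Y' -mulrA -expRD.
by rewrite -[n.+2%:R]natr1; congr (_ * expR _)%:E; ring.
Qed.

Lemma expectation_iter_tail0 n :
  (\int[P]_w iter_tail (weight ^~ w) n 0 = (moment_coef n)%:E)%E.
Proof.
case: n => [|n].
  rewrite /moment_coef big_ord0 /= integral_cst // mul1e.
  exact: probability_setT.
transitivity (\int[P]_w ((cst 1 w)%:E * iter_tail (weight ^~ w) n.+1 0))%E.
  by apply: eq_integral => w _; rewrite mul1e.
rewrite (expectation_iter_tailS (@expectation_iter_tail n) (Y := cst 1))//.
  under eq_integral do rewrite mul1r.
  by rewrite laplace_process// mul0r mulr0 !oppr0 expR0 mulr1 mule1.
exact: measurable_cst.
Qed.

End moments.

(** * Moments of the density *)

Section density.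
Context {R : realType}.
Local Notation leb := (@lebesgue_measure R).
Local Open Scope ereal_scope.

Lemma integral_layers (h : R) : (0 <= h)%R ->
  \int[leb]_s (ebool (0 <= s)%R * ebool (s < h)%R) = h%:E.
Proof.
move=> h0; transitivity (\int[leb]_(s in `[0%R, h[) 1).
  rewrite [RHS]integral_mkcond; apply: eq_integral => s _; rewrite patchE.
  have [s0|s0] := leP 0%R s; last by rewrite mul0e memNset//= in_itv/= leNgt s0.
  have [sh|sh] := ltP s h; first by rewrite mul1e mem_set//= in_itv/= s0.
  by rewrite mule0 memNset//= in_itv/= s0 ltNge sh.
rewrite integral_cst//= mul1e lebesgue_measure_itv/= lte_fin.
have [hp|] := ltP; first by rewrite oppr0 adde0.
by move=> hle; congr EFin; apply/eqP; rewrite eq_le h0 hle.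
Qed.

(** A layer-cake argument reduces the identity to the sets where h exceeds a given
    level. *)
Lemma integral_density (nu : probability R R) (D : set R) (f h : R -> R) :
  measurable D -> measurable_fun D f -> (forall x, D x -> 0 <= f x)%R ->
  (forall B : set R, measurable B -> nu B = \int[leb]_(x in B `&` D) (f x)%:E) ->
  measurable_fun setT h -> (forall x, 0 <= h x)%R ->
  \int[nu]_x (h x)%:E = \int[leb]_(x in D) (h x * f x)%:E.
Proof.
move=> mD mf f0 nuE mh h0.
pose g (p : R * R) : \bar R := ebool (0 <= p.2)%R * ebool (p.2 < h p.1)%R.
have mg : measurable_fun setT g.
  apply: emeasurable_funM; apply: measurable_ebool.
    exact: measurable_fun_ler.
  by apply: measurable_fun_ltr => //; exact: measurableT_comp mh measurable_fst.
have g0 p : 0 <= g p by rewrite mule_ge0 ?ebool_ge0.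
transitivity (\int[nu]_x \int[leb]_s g (x, s)).
  by apply: eq_integral => x _; rewrite /g/= integral_layers.
rewrite (@fubini_tonelli _ _ _ _ R nu leb g mg g0).
pose fD : R -> \bar R := (EFin \o f) \_ D.
have mfD : measurable_fun setT fD.
  by apply/(measurable_restrictT _ mD); exact/measurable_EFinP.
have fD0 x : 0 <= fD x by apply: erestrict_ge0 => y Dy; rewrite lee_fin f0.
have mg2 : measurable_fun setT (fun p => fD p.1 * g p).
  by apply: emeasurable_funM => //; exact: measurableT_comp mfD measurable_fst.
have g20 p : 0 <= fD p.1 * g p by rewrite mule_ge0.
transitivity (\int[leb]_s \int[leb]_x (fD x * g (x, s))); last first.
  rewrite -(@fubini_tonelli _ _ _ _ R leb leb (fun p => fD p.1 * g p) mg2 g20).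
  rewrite [RHS]integral_mkcond; apply: eq_integral => x _ /=.
  have m1 : measurable_fun [set: R] (fun s : R => (x, s)) by exact: measurable_fun_pair.
  have mg1 : measurable_fun setT (fun s => g (x, s)) := measurableT_comp mg m1.
  rewrite ge0_integralZl//.
  rewrite /g/= integral_layers// /fD !patchE; case: ifP => _ /=.
    by rewrite -EFinM mulrC.
  by rewrite mul0e.
apply: eq_integral => s _; rewrite /g/=.
have mB : measurable [set x | (s < h x)%R].
  have : measurable_fun [set: R] (fun x => (s < h x)%R) by exact: measurable_fun_ltr.
  by move=> /(_ measurableT [set true] I); rewrite setTI.
have [s0|s0] := leP 0%R s; last first.
  by rewrite !integral0_eq// => x _; rewrite mul0e ?mule0.
transitivity (nu [set x | (s < h x)%R]).
  rewrite -[in RHS](setIT [set x | _]) -integral_indic//.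
  apply: eq_integral => x _; rewrite mul1e indicE.
  have [sh|sh] := ltP s (h x); first by rewrite mem_set.
  by rewrite memNset//=; apply/negP; rewrite -leNgt.
rewrite nuE// [LHS]integral_mkcond; apply: eq_integral => x _.
rewrite mul1e /fD !patchE in_setI.
have [sh|sh] := ltP s (h x); last by rewrite mule0 memNset//=; apply/negP; rewrite -leNgt.
by rewrite mule1 [x \in [set _ | _]]mem_set.
Qed.

End density.

Section exponential_functional_moments.
Context {d : measure_display} {T : measurableType d} {R : realType}.
Variables (P : probability T R).
Variable mu : {finite_measure set (measurableTypeR R) -> \bar R}.
Variables (q : R) (X : R -> {RV P >-> R}) (e : {RV P >-> \bar R}) (f : R -> R).
Hypothesis q_ge0 : 0 <= q.
Hypothesis X_cpp : compound_poisson_subordinator mu X.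
Hypothesis e_exp : exponential_time q e.
Hypothesis X_e_indep : indep_systems P (sigma_process `[0, +oo[ X) (sigma_rv e).
Hypothesis phi_gt0 : forall k : nat, 0 < phi mu q k.+1%:R.
Hypothesis f_density : smooth_density P (exponential_functional (killed X e)) f.
Local Notation leb := (@lebesgue_measure R).

Let I := exponential_functional (killed X e).

Lemma exponential_functionalE w : I w = iter_tail (weight X e ^~ w) 1 0.
Proof.
rewrite /I /exponential_functional integral_mkcond/=.
apply: eq_integral => s _; rewrite patchE mule1 /weight /killed.
have [s0|s0] := leP 0 s; last by rewrite memNset ?mul0e//= in_itv/= leNgt s0.
by rewrite mem_set/= ?in_itv/= ?s0// mul1e; case: ifP.
Qed.

Lemma iter_tail_expe (a : R -> \bar R) n s : (forall r, 0 <= a r)%E ->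
  measurable_fun setT a ->
  (iter_tail a 1 s ^+ n = (n`!)%:R%:E * iter_tail a n s)%E.
Proof.
move=> a0 ma; elim: n => [|n IH]; first by rewrite expe0 mule1.
rewrite expeS IH muleCA iter_tail_mul// muleA -EFinM -natrM.
by rewrite factS mulnC.
Qed.

Lemma measurable_weight1 w : measurable_fun [set: R] (weight X e ^~ w).
Proof.
have m1 : measurable_fun [set: R] (fun r : R => (r, w)) by exact: measurable_fun_pair.
exact: (measurableT_comp (measurable_weight e X_cpp) m1).
Qed.

Lemma measurable_iter_tail_weight n :
  measurable_fun [set: T] (fun w => iter_tail (weight X e ^~ w) n 0).
Proof.
have m0 : measurable_fun [set: T] (fun w : T => (0 : R, w)).
  by apply: measurable_fun_pair.
have mK : measurable_fun [set: R * T] (fun p => iter_tail (weight X e ^~ p.2) n p.1).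
  apply: measurable_iter_tail (measurable_weight e X_cpp) => r w; exact: weight_ge0.
exact: (measurableT_comp mK m0).
Qed.

Lemma expectation_functional_expe n :
  (\int[P]_w (I w ^+ n) = (n`!%:R * moment_coef mu q n)%:E)%E.
Proof.
have mK := measurable_iter_tail_weight n.
transitivity (\int[P]_w ((n`!%:R)%:E * iter_tail (weight X e ^~ w) n 0))%E.
  apply: eq_integral => w _; rewrite exponential_functionalE iter_tail_expe//.
    by move=> r; exact: weight_ge0.
  exact: measurable_weight1.
rewrite ge0_integralZl//; last first.
  by move=> w _; apply: iter_tail_ge0 => r; exact: weight_ge0.
by rewrite (expectation_iter_tail0 q_ge0 X_cpp e_exp X_e_indep phi_gt0).
Qed.

Lemma exponential_functional_ge0 w : (0 <= I w)%E.
Proof.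
by rewrite exponential_functionalE; apply: iter_tail_ge0 => r; exact: weight_ge0.
Qed.

Lemma measurable_exponential_functional : measurable_fun [set: T] I.
Proof.
have -> : I = fun w => iter_tail (weight X e ^~ w) 1 0.
  by apply/funext => w; exact: exponential_functionalE.
exact: measurable_iter_tail_weight.
Qed.

(** The functional has a finite mean, hence is almost surely finite, and its moments
    can be computed from its law on the real line. *)
Lemma moment_density n :
  (\int[leb]_(x in `]0%R, +oo[) (x ^+ n * f x)%:E =
   (n`!%:R * moment_coef mu q n)%:E)%E.
Proof.
rewrite -expectation_functional_expe.
have mI := measurable_exponential_functional.
have iI : P.-integrable setT I.
  apply/integrableP; split => //.
  have -> : (\int[P]_w `|I w| = \int[P]_w (I w ^+ 1))%E.
    by apply: eq_integral => w _; rewrite gee0_abs ?exponential_functional_ge0.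
  by rewrite expectation_functional_expe ltry.
have [N [mN PN0 NI]] := integrable_ae measurableT iI.
have finI w : ~ N w -> I w = (fine (I w))%:E.
  by move=> nNw; rewrite fineK//; apply: contrapT => nf; apply: nNw; apply: NI => /= /(_ Logic.I).
have mZ : measurable_fun [set: T] (fine \o I) by exact: measurableT_comp.
pose Z : {mfun T >-> R} := mfun_Sub (mem_set mZ).
have [f0 fs flaw] := f_density.
have law (B : set R) : measurable B ->
    distribution P Z B = (\int[leb]_(x in B `&` `]0%R, +oo[) (f x)%:E)%E.
  move=> mB; rewrite -flaw// /distribution /pushforward/=.
  have mIB : measurable (I @^-1` (EFin @` B)).
    by rewrite -[X in measurable X]setTI; apply: mI => //; exact: measurable_image_EFin.
  have mZB : measurable ((fine \o I) @^-1` B).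
    by rewrite -[X in measurable X]setTI; exact: (mZ measurableT _ mB).
  apply/eqP; rewrite eq_le; apply/andP; split; last first.
    by apply: le_measure; rewrite ?inE// => w [x Bx /= xI];
       rewrite (_ : fine (I w) = x)// -[x]/(fine x%:E) xI.
  rewrite -[leRHS]adde0 -PN0; apply: le_trans (measureU2 _ _ _) => //.
  apply: le_measure; rewrite ?inE//; first exact: measurableU.
  move=> w /= Bw; have [Nw|nNw] := pselect (N w); [by right|left].
  by exists (fine (I w)) => //; rewrite -finI.
pose h (x : R) := `|x| ^+ n.
have mh : measurable_fun [set: R] h.
  by apply: measurable_funX; exact: normr_measurable.
have h0 x : 0 <= h x by rewrite exprn_ge0.
have mf : measurable_fun (`]0, +oo[%classic : set R) f.
  apply: open_continuous_measurable_fun; first exact: interval_open.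
  move=> x; rewrite inE/= in_itv/= andbT => x0.
  exact: isd_continuous (derivable_isd (fs 0%N x x0)).
transitivity (\int[leb]_(x in `]0%R, +oo[) (h x * f x)%:E)%E.
  apply: eq_integral => x; rewrite inE/= in_itv/= andbT => x0.
  by rewrite /h ger0_norm// ltW.
rewrite -(@integral_density _ (distribution P Z) (`]0, +oo[%classic : set R) f h)//; last first.
  by move=> x; rewrite /= in_itv/= andbT => /f0.
rewrite ge0_integral_distribution//=; last exact/measurable_EFinP.
apply: ge0_ae_eq_integral => //.
- apply/measurable_EFinP; exact: measurableT_comp mh mZ.
- have -> : (fun w => I w ^+ n)%E = (fun w => (n`!%:R)%:E * iter_tail (weight X e ^~ w) n 0)%E.
    apply/funext => w; rewrite exponential_functionalE iter_tail_expe//.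
      by move=> r; exact: weight_ge0.
    exact: measurable_weight1.
  apply: emeasurable_funM => //.
  exact: measurable_iter_tail_weight.
- by move=> w _; rewrite lee_fin.
- by move=> w _; rewrite expe_ge0// exponential_functional_ge0.
- exists N; split => // w /= h1; apply: contrapT => nNw; apply: h1 => _.
  rewrite (finI w nNw)/= /h ger0_norm ?EFin_expe//.
  by rewrite fine_ge0// exponential_functional_ge0.
Qed.

End exponential_functional_moments.

(** * The jump measure and its Laplace transform *)

Section levy_measure.
Context {R : realType}.
Variable mu : {finite_measure set (measurableTypeR R) -> \bar R}.
Local Notation D := (`]0, +oo[%classic : set R).

Let mD : measurable (D : set (measurableTypeR R)). Proof. exact: measurable_itv. Qed.

Lemma levy_integrable (h : R -> R) (M : R) : measurable_fun D h ->
  (forall v, 0 < v -> `|h v| <= M) -> mu.-integrable D (EFin \o h).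
Proof.
move=> mh hM; apply: measurable_bounded_integrable => //.
- by rewrite ltey_eq fin_num_measure.
- exists M; split; first exact: num_real.
  move=> x Mx v; rewrite /= in_itv/= andbT => v0.
  by rewrite (le_trans (hM v v0))// ltW.
Qed.

Lemma levy_dominated_by (h : R -> R -> R) (G : R -> R) (A : R) :
  mu.-integrable D (EFin \o G) ->
  (forall x, A <= x -> measurable_fun D (h x)) ->
  (forall x v, A <= x -> 0 < v -> `|h x v| <= G v) ->
  (forall v, 0 < v -> h x v @[x --> +oo] --> (0 : R)) ->
  \int[mu]_(v in D) h x v @[x --> +oo] --> (0 : R).
Proof.
move=> iG mh hM h0; apply/cvg_pinftyP => u uoo.
pose g n v := h (Num.max A (u n)) v.
have gM n v : 0 < v -> `|g n v| <= G v by move=> v0; apply: hM => //; rewrite le_max lexx.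
have mg n : measurable_fun D (g n) by apply: mh; rewrite le_max lexx.
have uA : \forall n \near \oo, A <= u n by move/cvgryPge : uoo; exact.
have ug n : A <= u n -> \int[mu]_(v in D) h (u n) v = \int[mu]_(v in D) g n v.
  by move=> An; rewrite /g max_r.
have : (\int[mu]_(v in D) (g n v)%:E)%E @[n --> \oo] --> (\int[mu]_(v in D) 0%:E)%E.
  apply: (@dominated_cvg _ _ _ mu D mD _ _ (EFin \o G)) => //.
  - by move=> n; apply/measurable_EFinP; exact: mg.
  - move=> v; rewrite /= in_itv/= andbT => v0; apply: cvg_EFin; first exact: nearW.
    have hu : h (u n) v @[n --> \oo] --> (0 : R).
      by move/cvg_pinftyP : (h0 v v0); exact.
    apply: cvg_trans hu; apply: near_eq_cvg; near=> n.
    by rewrite /= /g max_r//; near: n.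
  - move=> n v; rewrite /= in_itv/= andbT => v0.
    by rewrite lee_fin gM.
rewrite integral0 => /fine_cvg gc.
apply: cvg_trans gc; apply: near_eq_cvg; near=> n.
by rewrite /= ug//; near: n.
Unshelve. all: by end_near. Qed.

Lemma levy_dominated (h : R -> R -> R) (A M : R) :
  (forall x, A <= x -> measurable_fun D (h x)) ->
  (forall x v, A <= x -> 0 < v -> `|h x v| <= M) ->
  (forall v, 0 < v -> h x v @[x --> +oo] --> (0 : R)) ->
  \int[mu]_(v in D) h x v @[x --> +oo] --> (0 : R).
Proof.
by apply: levy_dominated_by; apply: (@levy_integrable (fun=> M) `|M|).
Qed.

Definition psi (u : R) : R := \int[mu]_(v in D) expR (- (u * v)).
Definition levy_mass : R := fine (mu D).

Lemma measurable_expRNr (u : R) (E : set R) : measurable_fun E (fun v => expR (- (u * v))).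
Proof.
apply: measurable_funTS; apply: continuous_measurable_fun => x.
exact: isd_continuous (isd_expRN u x).
Qed.

Lemma expRN_le1 (u v : R) : 0 <= u -> 0 < v -> expR (- (u * v)) <= 1.
Proof. by move=> u0 v0; rewrite -expR0 ler_expR oppr_le0 mulr_ge0// ltW. Qed.

Lemma integrable_psi (u : R) : 0 <= u ->
  mu.-integrable D (EFin \o (fun v => expR (- (u * v)))).
Proof.
move=> u0; apply: (@levy_integrable _ 1); first exact: measurable_expRNr.
by move=> v v0; rewrite ger0_norm ?expR_ge0// expRN_le1.
Qed.

Lemma integrable_levy_cst (k : R) : mu.-integrable D (EFin \o (fun=> k)).
Proof. by apply: (@levy_integrable _ `|k|). Qed.

Lemma levy_mass_ge0 : 0 <= levy_mass. Proof. exact: fine_ge0. Qed.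

Lemma Rintegral_levy_cst (k : R) : \int[mu]_(v in D) k = k * levy_mass.
Proof. by rewrite Rintegral_cst. Qed.

Lemma le_levy_integral (h : R -> R) (M : R) : measurable_fun D h ->
  (forall v, 0 < v -> `|h v| <= M) -> `|\int[mu]_(v in D) h v| <= M * levy_mass.
Proof.
move=> mh hM; have ih := levy_integrable mh hM.
apply: le_trans (le_normr_Rintegral _ ih) _ => //; rewrite -Rintegral_levy_cst.
apply: le_Rintegral => //.
- exact: integrable_norm ih.
- exact: integrable_levy_cst.
- by move=> v; rewrite /= in_itv/= andbT; exact: hM.
Qed.

Lemma psi_ge0 u : 0 <= psi u.
Proof. by apply: Rintegral_ge0 => v _; exact: expR_ge0. Qed.

Lemma psi_le u w : 0 <= u -> u <= w -> psi w <= psi u.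
Proof.
move=> u0 uw; apply: le_Rintegral => //.
- exact: integrable_psi (le_trans u0 uw).
- exact: integrable_psi.
- move=> v; rewrite /= in_itv/= andbT => v0.
  by rewrite ler_expR lerN2 ler_pM2r.
Qed.

Lemma psi0 : psi 0 = levy_mass.
Proof.
rewrite /psi; under eq_Rintegral do rewrite mul0r oppr0 expR0.
by rewrite Rintegral_levy_cst mul1r.
Qed.

Lemma psi_cvg0 : psi x @[x --> +oo] --> (0 : R).
Proof.
apply: (@levy_dominated (fun x v => expR (- (x * v))) 0 1).
- by move=> x _; exact: measurable_expRNr.
- by move=> x v x0 v0; rewrite ger0_norm ?expR_ge0// expRN_le1.
- move=> v v0; under eq_fun do rewrite mulrC.
  apply: (cvg_comp (fun x : R => v * x) (fun y => expR (- y))).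
    by apply: gt0_cvgMry => //; exact: cvg_id.
  exact: cvgr_expR.
Qed.

Lemma levy_integral_gt0 (h : R -> R) (M : R) : measurable_fun D h ->
  (forall v, 0 < v -> `|h v| <= M) -> (forall v, 0 < v -> 0 < h v) -> 0 < levy_mass ->
  0 < \int[mu]_(v in D) h v.
Proof.
move=> mh hM h0 lam0; have ih := levy_integrable mh hM.
have I0 : 0 <= \int[mu]_(v in D) h v.
  by apply: Rintegral_ge0 => v; rewrite /= in_itv/= andbT => /h0/ltW.
rewrite lt_neqAle I0 andbT; apply/eqP => I00.
have abs0 : (\int[mu]_(v in D) `|(h v)%:E| = 0)%E.
  transitivity (\int[mu]_(v in D) (h v)%:E)%E.
    apply: eq_integral => v; rewrite inE/= in_itv/= andbT => v0.
    by rewrite ger0_norm// ltW// h0.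
  have ifin : (\int[mu]_(v in D) (h v)%:E)%E \is a fin_num by exact: integrable_fin_num.
  by rewrite -(fineK ifin) -/(Rintegral mu D h) -I00.
have [/(_ abs0) + _] := @ae_eq_integral_abs _ _ _ mu D mD (EFin \o h) (measurable_int _ ih).
move=> [A [mA A0 hA]].
have DA : D `<=` A.
  move=> v Dv; apply: hA => /= /(_ Dv)[hv].
  by move: Dv; rewrite /= in_itv/= andbT => /h0; rewrite hv ltxx.
have : (mu D <= mu A)%E by apply: le_measure; rewrite ?inE.
rewrite A0 => D0; move: lam0; rewrite /levy_mass.
have -> : mu D = 0%E by apply/eqP; rewrite eq_le D0 measure_ge0.
by rewrite ltxx.
Qed.

Variable q : R.
Hypothesis q_ge0 : 0 <= q.

Lemma phi_psi u : 0 <= u -> phi mu q u = q + levy_mass - psi u.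
Proof.
move=> u0; rewrite /phi RintegralB//; last exact: integrable_psi.
  by rewrite Rintegral_levy_cst mul1r addrA.
exact: integrable_levy_cst.
Qed.

Lemma cvg_phi : phi mu q x @[x --> +oo] --> q + levy_mass.
Proof.
have : q + levy_mass - psi x @[x --> +oo] --> q + levy_mass.
  rewrite -[X in _ --> X]subr0; apply: cvgB; first exact: cvg_cst.
  exact: psi_cvg0.
apply: cvg_trans; apply: near_eq_cvg; near=> x; rewrite phi_psi//.
Unshelve. all: by end_near. Qed.

Lemma phi_inftyE : phi_infty mu q = q + levy_mass.
Proof. exact: (cvg_lim _ cvg_phi). Qed.

Hypothesis phi_nontrivial : exists2 z : R, 0 <= z & phi mu q z != 0.

(** When q = 0 the measure must charge ]0, +oo[, since otherwise phi would vanish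
    identically on the nonnegative half-line. *)
Lemma phi_gt0 u : 0 < u -> 0 < phi mu q u.
Proof.
move=> u0; have f0 (z v : R) : 0 <= z -> 0 < v -> 0 <= 1 - expR (- (z * v)).
  by move=> z0 v0; rewrite subr_ge0; exact: expRN_le1.
have I0 z : 0 <= z -> 0 <= \int[mu]_(y in D) (1 - expR (- (z * y))).
  by move=> z0; apply: Rintegral_ge0 => v; rewrite /= in_itv/= andbT; exact: f0.
have [q0|q0] := eqVneq q 0; last first.
  by rewrite /phi ltr_wpDr ?I0 ?(ltW u0)// lt_neqAle eq_sym q0.
have lam0 : 0 < levy_mass.
  rewrite lt_neqAle levy_mass_ge0 andbT; apply/eqP => l0.
  have [z z0] := phi_nontrivial; rewrite phi_psi// q0 -l0 addr0 sub0r oppr_eq0.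
  by rewrite eq_le psi_ge0 andbT l0 -psi0 psi_le.
rewrite /phi q0 add0r; apply: (levy_integral_gt0 (M := 1)) lam0.
- by apply: measurable_funB => //; exact: measurable_expRNr.
- by move=> v v0; rewrite ger0_norm ?f0 ?(ltW u0)// lerBlDr lerDl expR_ge0.
- by move=> v v0; rewrite subr_gt0 -expR0 ltr_expR oppr_lt0 mulr_gt0.
Qed.

End levy_measure.

(** * Determinacy of the moment problem *)

Section exponential_series.
Context {R : realType}.

Lemma exp_partial_sum_le (x : R) n : 0 <= x -> series (exp_coeff x) n <= expR x.
Proof.
move=> x0; rewrite /expR; apply: nondecreasing_cvgn_le.
  apply/nondecreasing_seqP => k; rewrite /series/= big_nat_recr//= lerDl.
  by rewrite /exp_coeff/= mulr_ge0 ?exprn_ge0// invr_ge0 ler0n.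
exact: is_cvg_series_exp_coeff.
Qed.

Lemma exp_term_le (x : R) n : 0 <= x -> x ^+ n <= n`!%:R * expR x.
Proof.
move=> x0; rewrite mulrC -ler_pdivrMr ?ltr0n ?fact_gt0//.
apply: le_trans (exp_partial_sum_le n.+1 x0).
rewrite /series/= big_nat_recr//= lerDr; apply: sumr_ge0 => k _.
by rewrite /exp_coeff/= mulr_ge0 ?exprn_ge0// invr_ge0 ler0n.
Qed.

Lemma norm_exp_partial_sum (x : R) n : `|series (exp_coeff x) n| <= expR `|x|.
Proof.
apply: le_trans (exp_partial_sum_le n (normr_ge0 x)).
rewrite /series/=; apply: le_trans (ler_norm_sum _ _ _) _.
by apply: ler_sum => k _; rewrite /exp_coeff/= normrM normrX normfV normr_nat.
Qed.

End exponential_series.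

Section moment_problem.
Context {R : realType}.
Local Notation leb := (@lebesgue_measure R).
Local Notation D := (`]0, +oo[%classic : set R).

Let mD : measurable (D : set (measurableTypeR R)). Proof. exact: measurable_itv. Qed.

(** Vanishing moments together with an exponential weight that makes the moment
    problem determinate. *)
Definition null_moments (eps : R) (u : R -> R) : Prop :=
  [/\ measurable_fun D u,
      leb.-integrable D (fun x => (u x * expR (eps * x))%:E) &
      forall n, \int[leb]_(x in D) (x ^+ n * u x) = 0].

Lemma pow_le_exp (eps x : R) n : 0 < eps -> 0 < x ->
  x ^+ n <= n`!%:R / eps ^+ n * expR (eps * x).
Proof.
move=> e0 x0; have := @exp_term_le _ (eps * x) n (mulr_ge0 (ltW e0) (ltW x0)).
by rewrite exprMn mulrAC ler_pdivlMr ?exprn_gt0// mulrC.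
Qed.

Lemma integrable_exp_dom (eps : R) (u g : R -> R) (C : R) : 
  measurable_fun D g -> leb.-integrable D (fun x => (u x * expR (eps * x))%:E) ->
  (forall x, 0 < x -> `|g x| <= C * (`|u x| * expR (eps * x))) ->
  leb.-integrable D (EFin \o g).
Proof.
move=> mg iu gC.
have iC : leb.-integrable D (fun x => C%:E * (u x * expR (eps * x))%:E)%E.
  exact: integrableZl.
apply: (le_integrable _ _ _ iC) => //; first exact/measurable_EFinP.
move=> x; rewrite /= in_itv/= andbT => x0.
rewrite /= lee_fin (le_trans (gC x x0))//.
rewrite !normrM [`|expR _|]ger0_norm ?expR_ge0// ler_wpM2r//; last exact: ler_norm.
Qed.

Lemma measurable_mul_pow (u : R -> R) n : measurable_fun D u ->
  measurable_fun D (fun x => x ^+ n * u x).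
Proof.
by move=> mu; apply: measurable_funM => //; exact: measurable_funX.
Qed.

Lemma integrable_mul_pow (eps : R) (u : R -> R) n : 0 < eps ->
  measurable_fun D u ->
  leb.-integrable D (fun x => (u x * expR (eps * x))%:E) ->
  leb.-integrable D (EFin \o (fun x => x ^+ n * u x)).
Proof.
move=> e0 mu iu; apply: (@integrable_exp_dom eps u _ (n`!%:R / eps ^+ n)) => //.
  exact: measurable_mul_pow.
move=> x x0; rewrite normrM normrX (gtr0_norm x0) mulrA mulrAC.
rewrite ler_wpM2r//; exact: pow_le_exp.
Qed.

Lemma measurable_expRl (a : R) : measurable_fun D (fun x : R => expR (a * x)).
Proof.
apply: measurable_funTS; apply: continuous_measurable_fun => x.
exact: isd_continuous (isd_expR (isd_mull a (isd_id x))).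
Qed.

(** The power series of expR (- (d x)) is integrated term by term. Its partial sums are
    bounded by expR (d x); the bound on d leaves half of the exponential weight to
    absorb the polynomial factor. *)
Lemma null_moments_tilt (eps d : R) (u : R -> R) : 0 < eps -> 0 <= d <= eps / 2 ->
  null_moments eps u -> null_moments eps (fun x => u x * expR (- (d * x))).
Proof.
move=> e0 /andP[d0 de] [mu iu momu].
have e20 : 0 < eps / 2 by rewrite divr_gt0.
have measurability_ebool (a : R) : measurable_fun D (fun x : R => expR (- (a * x))).
  have -> : (fun x : R => expR (- (a * x))) = (fun x => expR (- a * x)).
    by apply/funext => x; rewrite mulNr.
  exact: measurable_expRl.
have m1 : measurable_fun D (fun x => u x * expR (- (d * x))).
  exact: measurable_funM.
split => //.
  apply: (@integrable_exp_dom eps u _ 1) => //.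
    by apply: measurable_funM => //; exact: measurable_expRl.
  move=> x x0; rewrite mul1r !normrM ![`|expR _|]ger0_norm ?expR_ge0//.
  rewrite ler_wpM2r ?expR_ge0// ler_piMr// -expR0 ler_expR oppr_le0.
  by rewrite mulr_ge0// ltW.
move=> n.
pose s N x := x ^+ n * (u x * series (exp_coeff (- (d * x))) N).
have sE N x : s N.+1 x = s N x + ((- d) ^+ N / N`!%:R) * (x ^+ (n + N) * u x).
  rewrite /s /series/= big_nat_recr//= mulrDr mulrDr; congr (_ + _).
  by rewrite /exp_coeff/= -mulNr exprMn exprD; ring.
have is_ N : leb.-integrable D (EFin \o s N) /\ \int[leb]_(x in D) s N x = 0.
  elim: N => [|N [iN IN]].
    have s0 : s 0%N = fun=> 0.
      by apply/funext => x; rewrite /s /series/= big_geq// !mulr0.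
    rewrite s0; split; first exact: integrable0.
    by rewrite Rintegral_cst// mul0r.
  have iT : leb.-integrable D (EFin \o (fun x => ((- d) ^+ N / N`!%:R) * (x ^+ (n + N) * u x))).
    have := integrableZl mD ((- d) ^+ N / N`!%:R) (@integrable_mul_pow eps u (n + N) e0 mu iu).
    by apply: eq_integrable.
  have -> : s N.+1 = fun x => s N x + ((- d) ^+ N / N`!%:R) * (x ^+ (n + N) * u x).
    exact/funext/sE.
  split.
    have := integrableD mD iN iT; exact: eq_integrable.
  rewrite RintegralD// IN add0r RintegralZl// ?momu ?mulr0//.
  exact: integrable_mul_pow iu.
have iG : leb.-integrable D (fun x => ((n`!%:R / (eps / 2) ^+ n)%:E * `|u x * expR (eps * x)|%:E)%E).
  by apply: integrableZl => //; have := integrable_norm iu.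
have : (\int[leb]_(x in D) (s N x)%:E)%E @[N --> \oo] -->
    (\int[leb]_(x in D) (x ^+ n * (u x * expR (- (d * x))))%:E)%E.
  apply: (@dominated_cvg _ _ _ leb D mD _ _ _ _ _ _ iG) => //.
  - by move=> N; exact: measurable_int (is_ N).1.
  - move=> x _; apply: cvg_EFin; first exact: nearW.
    apply: cvgM; first exact: cvg_cst.
    apply: cvgM; first exact: cvg_cst.
    exact: is_cvg_series_exp_coeff.
  - move=> N x; rewrite /= in_itv/= andbT => x0.
    rewrite lee_fin /s !normrM [`|expR _|]ger0_norm ?expR_ge0//.
    have Ee : expR (eps * x) = expR (eps / 2 * x) * expR (eps / 2 * x).
      by rewrite -expRD -mulrDl -splitr.
    rewrite normrX (gtr0_norm x0) Ee.
    have h1 := @pow_le_exp (eps / 2) x n e20 x0.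
    have h2 : `|series (exp_coeff (- (d * x))) N| <= expR (eps / 2 * x).
      rewrite (le_trans (norm_exp_partial_sum _ _))// normrN.
      rewrite ger0_norm; last by rewrite mulr_ge0// ltW.
      by rewrite ler_expR ler_pM2r.
    have -> : n`!%:R / (eps / 2) ^+ n * (`|u x| * (expR (eps / 2 * x) * expR (eps / 2 * x))) =
        (n`!%:R / (eps / 2) ^+ n * expR (eps / 2 * x)) * (`|u x| * expR (eps / 2 * x)).
      by ring.
    apply: ler_pM => //; [exact/exprn_ge0/ltW|].
    exact: ler_wpM2l.
rewrite (_ : (fun N => _) = fun=> 0%E); last first.
  apply/funext => N; have [iN IN] := is_ N.
  by rewrite -[LHS]fineK ?(integrable_fin_num mD iN)//; congr EFin.
by move=> /(cvg_unique _ (cvg_cst _)) => h; rewrite /Rintegral -h.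
Qed.

(** Only small tilts are allowed at a time, so the exponential factor is reached in
    n K equal steps, with K large. *)
Lemma null_moments_gamma (eps x0 : R) (u : R -> R) : 0 < eps -> 0 < x0 ->
  null_moments eps u ->
  forall n, \int[leb]_(x in D) (u x * (x * expR (- (x / x0))) ^+ n) = 0.
Proof.
move=> e0 x00 Nu n.
have [K K0 Ke] : exists2 K : nat, (0 < K)%N & (x0 * K%:R)^-1 <= eps / 2.
  pose M := (x0 * (eps / 2))^-1.
  have M0 : 0 < M by rewrite invr_gt0 mulr_gt0// divr_gt0.
  exists (Num.truncn M).+1 => //.
  have MK : M < (Num.truncn M).+1%:R by exact: truncnS_gt.
  rewrite -[leRHS]invrK lef_pV2 ?posrE ?invr_gt0 ?mulr_gt0 ?divr_gt0//.
  rewrite -ler_pdivrMl// -invfM; exact: ltW.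
have iter j : null_moments eps (fun x => u x * expR (- ((j%:R / (x0 * K%:R)) * x))).
  elim: j => [|j IH].
    by under eq_fun do rewrite mul0r mul0r oppr0 expR0 mulr1.
  have dd : 0 <= (x0 * K%:R)^-1 <= eps / 2.
    by rewrite Ke andbT invr_ge0 mulr_ge0// ltW.
  have := null_moments_tilt e0 dd IH; congr null_moments; apply/funext => x.
  by rewrite -mulrA -expRD -natr1; congr (_ * expR _); ring.
have [_ _ /(_ n) E] := iter (n * K)%N; rewrite -[RHS]E.
apply: eq_Rintegral => x _; rewrite exprMn -expRM_natl mulrCA; congr (_ * (_ * expR _)).
rewrite natrM; field.
by rewrite pnatr_eq0 -lt0n K0 gt_eqF.
Qed.

Lemma gamma_kernel_le (x0 x y : R) : 0 < x0 -> 0 < x -> 0 < y ->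
  (x <= y <= x0) || (x0 <= y <= x) -> 
  x * expR (- (x / x0)) <= y * expR (- (y / x0)).
Proof.
move=> x00 x0' y0 h.
suff : x / y <= expR ((x - y) / x0).
  rewrite ler_pdivrMr// => /(ler_wpM2r (expR_ge0 (- (x / x0)))) /le_trans; apply.
  rewrite mulrAC -expRD mulrC (_ : (x - y) / x0 + _ = - (y / x0))//.
  by rewrite mulrBl; ring.
apply: le_trans (expR_ge1Dx _).
have -> : x / y = 1 + (x - y) / y by rewrite mulrBl divff ?gt_eqF//; ring.
rewrite lerD2l; case/orP: h => /andP[h1 h2].
  rewrite -[x - y]opprB !mulNr lerN2 ler_wpM2l ?subr_ge0// lef_pV2//.
by rewrite ler_wpM2l ?subr_ge0// lef_pV2 ?posrE.
Qed.

Lemma gamma_kernel_lt (x0 y : R) : 0 < x0 -> 0 < y -> y != x0 ->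
  y * expR (- (y / x0)) < x0 * expR (- (x0 / x0)).
Proof.
move=> x00 y0 yx; have t0 : y / x0 - 1 != 0.
  rewrite subr_eq0; apply: contra yx => /eqP h; apply/eqP.
  by rewrite -[y](@divfK _ x0) ?gt_eqF// h mul1r.
have := expR_gt1Dx t0; rewrite addrC subrK divff ?gt_eqF// => h.
rewrite -ltr_pdivrMl// mulrA [_^-1 * y]mulrC -ltr_pdivlMr ?expR_gt0// -expRN opprK -expRD.
by rewrite addrC.
Qed.

(** The kernel x expR (- (x / x0)) has a strict maximum at x0. Its high powers
    concentrate there and would detect a positive value of u. *)
Lemma null_moments_pos (eps x0 : R) (u : R -> R) : 0 < eps -> 0 < x0 ->
  {for x0, continuous u} -> null_moments eps u -> u x0 <= 0.
Proof.
move=> e0 x00 cu Nu; rewrite leNgt; apply/negP => u0.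
have Ek := null_moments_gamma e0 x00 Nu.
have [mu iu _] := Nu.
pose k (x : R) := x * expR (- (x / x0)).
(* u is large on the d-neighbourhood, and k is above r1 on a smaller one, while k
   stays below r2 < r1 outside the former *)
have [d d0 dP] : exists2 d, 0 < d < x0 & forall x, `|x - x0| <= d -> u x0 / 2 <= u x.
  have : \forall x \near x0, u x0 / 2 < u x.
    by move/cvgr_gt : cu; apply; rewrite ltr_pdivrMr// mulr_natr mulr2n ltrDl.
  move=> /nbhs_ballP[r /= r0 rP].
  exists (Num.min (r / 2) (x0 / 2)).
    rewrite lt_min !divr_gt0//= gt_min; apply/orP; right.
    by rewrite ltr_pdivrMr// mulr_natr mulr2n ltrDl.
  move=> x; rewrite le_min => /andP[xr _]; apply/ltW/rP.
  rewrite /ball/= distrC (le_lt_trans xr)// ltr_pdivrMr// mulr_natr mulr2n ltrDl.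
  by [].
case/andP: d0 => d0 dx0.
pose r2 := Num.max (k (x0 - d)) (k (x0 + d)).
have r2k : r2 < k x0.
  rewrite gt_max !gamma_kernel_lt ?subr_gt0 ?addr_gt0//.
    by rewrite -subr_eq0 addrAC subrr add0r gt_eqF.
  by rewrite -subr_eq0 addrAC subrr add0r oppr_eq0 gt_eqF.
have r20 : 0 < r2.
  by rewrite lt_max mulr_gt0 ?expR_gt0 ?subr_gt0.
pose r1 := (k x0 + r2) / 2.
have r21 : r2 < r1 by rewrite /r1; lra.
have ck : {for x0, continuous k}.
  apply: isd_continuous (isd_mul (isd_id _) (isd_expR (isd_opp (isd_mul (isd_id x0) (isd_cst x0 x0^-1))))).
have [d1 d10 d1P] : exists2 d1, 0 < d1 <= d & forall x, `|x - x0| <= d1 -> r1 <= k x.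
  have : \forall x \near x0, r1 < k x.
    by move/cvgr_gt : ck; apply; rewrite /r1; lra.
  move=> /nbhs_ballP[r /= r0 rP].
  exists (Num.min (r / 2) d).
    by rewrite lt_min d0 divr_gt0//= ge_min lexx orbT.
  move=> x; rewrite le_min => /andP[xr _]; apply/ltW/rP.
  rewrite /ball/= distrC (le_lt_trans xr)// ltr_pdivrMr// mulr_natr mulr2n ltrDl.
  by [].
case/andP: d10 => d10 d1d.
have r10 : 0 < r1 by exact: lt_trans r21.
pose E : set R := `[x0 - d1, x0 + d1]%classic.
have ED : E `<=` D.
  move=> x; rewrite /E/= !in_itv/= andbT => /andP[h _]; rewrite (lt_le_trans _ h)// subr_gt0.
  exact: le_lt_trans dx0.
have measurability_ebool : measurable E by exact: measurable_itv.
have iabs : leb.-integrable D (EFin \o (fun x => `|u x|)).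
  apply: (@integrable_exp_dom eps u _ 1) => //; first exact: measurableT_comp.
  move=> x x0'; rewrite mul1r normr_id ler_peMr// -expR0 ler_expR mulr_ge0// ltW//.
pose U := \int[leb]_(x in D) `|u x|.
have U0 : 0 <= U by apply: Rintegral_ge0.
have mk : measurable_fun D k.
  apply: measurable_funTS; apply: continuous_measurable_fun => x.
  exact: isd_continuous (isd_mul (isd_id _) (isd_expR (isd_opp (isd_mul (isd_id x) (isd_cst x x0^-1))))).
have kx00 : 0 < k x0 by rewrite mulr_gt0 ?expR_gt0.
have kle x : 0 < x -> 0 <= k x <= k x0.
  move=> x0'; rewrite mulr_ge0 ?expR_ge0 ?(ltW x0')//=; apply: (@gamma_kernel_le x0 x x0) => //.
  by rewrite !lexx andbT /= le_total.
have iuk n : leb.-integrable D (EFin \o (fun x => u x * k x ^+ n)).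
  apply: (@integrable_exp_dom eps u _ (k x0 ^+ n)) => //.
    by apply: measurable_funM => //; exact: measurable_funX.
  move=> x x0'; have /andP[k0 kk] := kle x x0'.
  rewrite normrM normrX (ger0_norm k0) mulrC; apply: ler_pM => //; first exact: exprn_ge0.
    by rewrite lerXn2r ?nnegrE// ltW.
  rewrite ler_peMr// -expR0 ler_expR mulr_ge0// ltW//.
have i1 : leb.-integrable D (EFin \o \1_E).
  apply/integrableP; split.
    by apply/measurable_EFinP; apply: measurable_funTS; exact: measurable_indic.
  under eq_integral do rewrite /= ger0_norm//.
  rewrite integral_indic//= (setIidl ED) lebesgue_measure_itv/= lte_fin.
  by case: ifP => _; rewrite ?ltry.
have main n : u x0 / 2 * r1 ^+ n * (d1 *+ 2) <= r2 ^+ n * U.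
  have iE : leb.-integrable D (EFin \o (fun x => u x0 / 2 * r1 ^+ n * \1_E x)).
    by have := integrableZl mD (u x0 / 2 * r1 ^+ n) i1; apply: eq_integrable.
  have iU : leb.-integrable D (EFin \o (fun x => r2 ^+ n * `|u x|)).
    by have := integrableZl mD (r2 ^+ n) iabs; apply: eq_integrable.
  have h : \int[leb]_(x in D) (u x0 / 2 * r1 ^+ n * \1_E x - r2 ^+ n * `|u x|) <=
      \int[leb]_(x in D) (u x * k x ^+ n).
    apply: le_Rintegral => //.
      by have := integrableB mD iE iU; apply: eq_integrable.
    move=> x; rewrite /= in_itv/= andbT => x0'.
    have /andP[kx0 kxk] := kle x x0'.
    have [xd1|xd1] := leP `|x - x0| d1.
      rewrite indicE mem_set ?mulr1; last first.
        by rewrite /E/= in_itv/=; move: xd1; rewrite ler_norml; lra.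
      rewrite lerBlDr (@le_trans _ _ (u x * k x ^+ n))//; last first.
        by rewrite lerDl mulr_ge0 ?exprn_ge0// ltW.
      apply: ler_pM => //; first by rewrite divr_ge0// ltW.
      - by rewrite exprn_ge0// ltW.
      - exact: dP (le_trans xd1 d1d).
      - by rewrite lerXn2r ?nnegrE ?d1P// ltW.
    rewrite indicE memNset ?mulr0 ?sub0r; last first.
      by rewrite /E/= in_itv/=; move: xd1; rewrite ltNge ler_norml; lra.
    have [xd|xd] := leP `|x - x0| d.
      rewrite (@le_trans _ _ 0)// ?oppr_le0 ?mulr_ge0 ?exprn_ge0 ?(ltW r20)//.
      by rewrite (le_trans _ (dP x xd))// divr_ge0// ltW.
    have kr : k x <= r2.
      rewrite le_max; move: xd; rewrite lter_normr => /orP[] xd.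
        by apply/orP; right; apply: gamma_kernel_le; rewrite ?addr_gt0//; apply/orP; right; lra.
      by apply/orP; left; apply: gamma_kernel_le; rewrite ?subr_gt0//; apply/orP; left; lra.
    rewrite lerNl (le_trans (ler_norm _))// normrN normrM normrX (ger0_norm kx0) mulrC.
    by rewrite ler_wpM2r// lerXn2r ?nnegrE// ltW.
  move: h; rewrite Ek RintegralB// subr_le0 => h.
  rewrite -(RintegralZl _ _ iabs)//; apply: le_trans h.
  rewrite RintegralZl//.
  rewrite ler_wpM2l// ?mulr_ge0 ?divr_ge0 ?exprn_ge0 ?(ltW u0) ?(ltW r10)//.
  rewrite /Rintegral integral_indic//= (setIidl ED) lebesgue_measure_itv/= lte_fin.
  by rewrite ifT/= ?mulr2n; lra.
have Ud : 0 < u x0 / 2 * (d1 *+ 2) by rewrite mulr_gt0 ?divr_gt0// pmulrn_lgt0.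
have : (fun n => (r2 / r1) ^+ n * U) @ \oo --> (0 : R).
  rewrite -[X in _ --> X](mul0r U); apply: cvgM; last exact: cvg_cst.
  apply: cvg_expr; have h0 : 0 < r2 / r1 by rewrite divr_gt0.
  by rewrite (gtr0_norm h0) ltr_pdivrMr// mul1r.
move/cvgr_lt => /(_ _ Ud)[N _ /(_ N (leqnn N))] /=.
rewrite ltNge => /negP; apply.
have := main N; rewrite mulrAC -ler_pdivlMr ?exprn_gt0// mulrAC.
move=> h; apply: le_trans h _.
by rewrite [(r2 / r1) ^+ N]expr_div_n mulrAC.
Qed.

Theorem null_moments_eq0 (eps x0 : R) (u : R -> R) : 0 < eps -> 0 < x0 ->
  {for x0, continuous u} -> null_moments eps u -> u x0 = 0.
Proof.
move=> e0 x00 cu Nu; apply/eqP; rewrite eq_le (null_moments_pos e0 x00 cu Nu)/=.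
rewrite -oppr_le0; have [mu iu mom] := Nu.
apply: (@null_moments_pos eps x0 (fun x => - u x)) => //; first exact: continuousN.
split.
- exact: measurable_funN.
- have := integrableN iu; apply: eq_integrable => // x _.
  by rewrite /= mulNr EFinN.
- move=> n; under eq_Rintegral do rewrite mulrN -mulN1r.
  rewrite RintegralZl ?mom ?mulr0//; exact: integrable_mul_pow iu.
Qed.

End moment_problem.

(** * Averages over multiplicative dilations *)

Section dilation_operator.
Context {R : realType}.
Variable mu : {finite_measure set (measurableTypeR R) -> \bar R}.
Local Notation D := (`]0, +oo[%classic : set R).

Let mD : measurable (D : set (measurableTypeR R)). Proof. exact: measurable_itv. Qed.

(** The jumps act on the law of the functional by x |-> x * expR v; the exponent k
    counts the derivatives taken, each of which brings out one more factor expR v. *)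
Definition dilate (k : nat) (h : R -> R) (x : R) : R :=
  \int[mu]_(v in D) (h (x * expR v) * expR (k%:R * v)).

Lemma continuous_dilated (k : nat) (h : R -> R) (x : R) : 0 < x ->
  (forall y : R, 0 < y -> {for y, continuous h}) ->
  continuous (fun v => h (x * expR v) * expR (k%:R * v)).
Proof.
move=> x0 ch v; apply: cvgM.
  apply: (@continuous_comp _ _ _ (fun v => x * expR v) h).
    exact: isd_continuous (isd_mull x (isd_expR (isd_id v))).
  by apply: ch; rewrite mulr_gt0 ?expR_gt0.
exact: isd_continuous (isd_expR (isd_mull k%:R (isd_id v))).
Qed.

Lemma measurable_dilated (k : nat) (h : R -> R) (x : R) (E : set R) : 0 < x ->
  (forall y : R, 0 < y -> {for y, continuous h}) ->
  measurable_fun E (fun v => h (x * expR v) * expR (k%:R * v)).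
Proof.
move=> x0 ch; apply: measurable_funTS; apply: continuous_measurable_fun.
exact: continuous_dilated.
Qed.

Lemma dilated_le (k m : nat) (h : R -> R) (x v K : R) : 0 < x -> 0 < v -> (k <= m)%N ->
  (forall y : R, 0 < y -> `|h y| * y ^+ m <= K) ->
  `|h (x * expR v) * expR (k%:R * v)| * x ^+ m <= K * expR (- ((m - k)%:R * v)).
Proof.
move=> x0 v0 km hK; have y0 : 0 < x * expR v by rewrite mulr_gt0 ?expR_gt0.
have := hK _ y0; rewrite exprMn mulrA.
rewrite -expRM_natl normrM [`|expR _|]ger0_norm ?expR_ge0//.
move=> /(ler_wpM2r (expR_ge0 (- ((m - k)%:R * v)))); apply: le_trans.
have -> : expR (k%:R * v) = expR (m%:R * v) * expR (- ((m - k)%:R * v)).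
  by rewrite -expRD natrB//; congr expR; ring.
by rewrite le_eqVlt; apply/orP; left; apply/eqP; ring.
Qed.

Lemma dilated_bound (k m : nat) (h : R -> R) (x v K : R) : 0 < x -> 0 < v -> (k <= m)%N ->
  (forall y : R, 0 < y -> `|h y| * y ^+ m <= K) ->
  `|h (x * expR v) * expR (k%:R * v)| <= K / x ^+ m.
Proof.
move=> x0 v0 km hK; rewrite ler_pdivlMr ?exprn_gt0//.
rewrite (le_trans (dilated_le x0 v0 km hK))// ler_piMr//.
  by rewrite (le_trans _ (hK x x0))// mulr_ge0// exprn_ge0// ltW.
exact: expRN_le1.
Qed.

Lemma integrable_dilated (k : nat) (h : R -> R) (x K : R) : 0 < x ->
  (forall y : R, 0 < y -> {for y, continuous h}) ->
  (forall y : R, 0 < y -> `|h y| * y ^+ k <= K) ->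
  mu.-integrable D (EFin \o (fun v => h (x * expR v) * expR (k%:R * v))).
Proof.
move=> x0 ch hK; apply: (@levy_integrable _ _ _ (K / x ^+ k)).
  exact: measurable_dilated.
by move=> v v0; exact: dilated_bound.
Qed.

(** Substituting the power bound of h inside the integral produces the Laplace
    transform of mu at the number of spare powers. *)
Lemma dilate_le (k m : nat) (h : R -> R) (x K : R) : 0 < x -> (k <= m)%N ->
  (forall y : R, 0 < y -> {for y, continuous h}) ->
  (forall y : R, 0 < y -> `|h y| * y ^+ m <= K) ->
  `|dilate k h x| * x ^+ m <= K * psi mu (m - k)%:R.
Proof.
move=> x0 km ch hK; rewrite -ler_pdivlMr ?exprn_gt0// mulrAC.
have ih : mu.-integrable D (EFin \o (fun v => h (x * expR v) * expR (k%:R * v))).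
  apply: (@levy_integrable _ _ _ (K / x ^+ m)); first exact: measurable_dilated.
  by move=> v v0; exact: dilated_bound.
have ip : mu.-integrable D (EFin \o (fun v => expR (- ((m - k)%:R * v)))).
  exact: integrable_psi.
apply: le_trans (le_normr_Rintegral _ ih) _ => //.
rewrite /psi -RintegralZl//; apply: le_Rintegral => //.
- exact: integrable_norm ih.
- by have := integrableZl mD (K / x ^+ m) ip; apply: eq_integrable.
- move=> v; rewrite /= in_itv/= andbT => v0.
  by rewrite mulrAC ler_pdivlMr ?exprn_gt0//; exact: dilated_le.
Qed.

(** The bound on h' makes the differentiated integrand bounded in v, uniformly for
    y near x. *)
Lemma isd_dilate (k : nat) (h h' : R -> R) (x K K' : R) : 0 < x ->
  (forall y : R, 0 < y -> is_derive y (1 : R) h (h' y)) ->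
  (forall y : R, 0 < y -> {for y, continuous h'}) ->
  (forall y : R, 0 < y -> `|h y| * y ^+ k <= K) ->
  (forall y : R, 0 < y -> `|h' y| * y ^+ k.+1 <= K') ->
  is_derive x (1 : R) (dilate k h) (dilate k.+1 h' x).
Proof.
move=> x0 dh ch' hK hK'.
have ch (y : R) : 0 < y -> {for y, continuous h} by move=> y0; exact: isd_continuous (dh y y0).
have K'0 : 0 <= K'.
  by rewrite (le_trans _ (hK' x x0))// mulr_ge0// exprn_ge0// ltW.
pose g (y v : R) := h (y * expR v) * expR (k%:R * v).
have dg (y v : R) : 0 < y -> is_derive y (1 : R) (g^~ v) (h' (y * expR v) * expR (k.+1%:R * v)).
  move=> y0; have yv : 0 < y * expR v by rewrite mulr_gt0 ?expR_gt0.
  have d1 : is_derive y (1 : R) (fun y => y * expR v) (expR v).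
    apply: isd_eq (isd_mul (isd_id y) (isd_cst y (expR v))) => //=.
    by rewrite mulr0 add0r mulr1.
  have e1 := @isd_comp R h (fun y => y * expR v) y _ _ (dh _ yv) d1.
  have e2 := isd_mul e1 (isd_cst y (expR (k%:R * v))).
  apply: (isd_eq _ _ e2) => //=.
  rewrite mulr0 add0r mulrC -mulrA -expRD; congr (_ * expR _).
  by rewrite -natr1; ring.
have x20 : 0 < x / 2 by rewrite divr_gt0.
have I0 y : `]x / 2, 2 * x[%classic y -> 0 < y.
  by rewrite /= in_itv/= => /andP[xy _]; exact: lt_trans xy.
have Ia : `]x / 2, 2 * x[%classic x.
  by rewrite /= in_itv/= ltr_pdivrMr// ltr_pMr// mulrC ltr_pMr// ltr1n.
have intg y : `]x / 2, 2 * x[%classic y -> mu.-integrable D (EFin \o g y).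
  by move=> /I0 y0; exact: integrable_dilated hK.
have derg y v : `]x / 2, 2 * x[%classic y -> D v -> derivable (g^~ v) y 1.
  by move=> /I0 y0 _; exact: isd_derivable (dg y v y0).
pose G (v : R) := K' / (x / 2) ^+ k.+1.
have G0 v : 0 <= G v by rewrite divr_ge0// exprn_ge0// ltW.
have iG : mu.-integrable D (EFin \o G) by exact: integrable_levy_cst.
have Gub y v : `]x / 2, 2 * x[%classic y -> D v -> `|partial1of2 g y v| <= G v.
  move=> Iy; have y0 := I0 y Iy; rewrite /= in_itv/= andbT => v0.
  rewrite /partial1of2 (isd_derive1 (dg y v y0)).
  apply: le_trans (dilated_bound y0 v0 (leqnn _) hK') _.
  rewrite /G ler_wpM2l// lef_pV2 ?posrE ?exprn_gt0//.
  have xy : x / 2 <= y by move: Iy; rewrite /= in_itv/= => /andP[/ltW].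
  by rewrite lerXn2r ?nnegrE// ltW.
have h1 := derivable_under_integral mD Ia intg derg G0 iG Gub.
have h2 := differentiation_under_integral mD Ia intg derg G0 iG Gub.
apply: isd_eq (derivable_isd h1) => //.
rewrite [LHS]h2; apply: eq_Rintegral => v _.
by rewrite /partial1of2 (isd_derive1 (dg x v x0)).
Qed.

End dilation_operator.

(** * Exponential moments and the tail of the law *)

Section ratio_test.
Context {R : realType}.

(** A ratio test in the form of a uniform bound on the partial sums. *)
Lemma ratio_bound (t : nat -> R) (r : R) (N0 : nat) : (forall n, 0 <= t n) ->
  0 <= r < 1 -> (forall n, (N0 <= n)%N -> t n.+1 <= r * t n) ->
  exists2 B, 0 <= B & forall N, \sum_(n < N) t n <= B.
Proof.
move=> t0 /andP[r0 r1] tr; have r10 : 0 < 1 - r by rewrite subr_gt0.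
pose B := \sum_(n < N0) t n + t N0 / (1 - r).
have inv m : \sum_(n < N0 + m) t n + t (N0 + m)%N / (1 - r) <= B.
  elim: m => [|m IH]; first by rewrite addn0.
  rewrite addnS big_ord_recr/= (le_trans _ IH)// -addrA lerD2l.
  rewrite -lerBrDl -[X in _ <= _ - X]mulr1 -[X in _ - _ * X](divff (lt0r_neq0 r10)).
  rewrite mulrA -mulrBl ler_pM2r ?invr_gt0//.
  by rewrite (le_trans (tr _ (leq_addr m N0)))//; lra.
have mono N M : (N <= M)%N -> \sum_(n < N) t n <= \sum_(n < M) t n.
  move=> NM; rewrite -(subnKC NM); elim: (M - N)%N => [|k IH]; first by rewrite addn0.
  by rewrite addnS big_ord_recr/= (le_trans IH)// lerDl.
exists B.
  by rewrite addr_ge0 ?sumr_ge0// divr_ge0// ltW.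
move=> N; rewrite (le_trans (mono N (N0 + N)%N (leq_addl _ _)))//.
by rewrite (le_trans _ (inv N))// lerDl divr_ge0// ltW.
Qed.

End ratio_test.

Section tonelli_on.
Context {R : realType}.
Local Open Scope ereal_scope.

Lemma tonelli_on (m1 m2 : {sigma_finite_measure set (measurableTypeR R) -> \bar R})
    (D1 D2 : set R) (g : R -> R -> \bar R) : measurable D1 -> measurable D2 ->
  measurable_fun (D1 `*` D2) (fun p : R * R => g p.1 p.2) ->
  (forall x y, D1 x -> D2 y -> 0 <= g x y) ->
  \int[m1]_(x in D1) \int[m2]_(y in D2) g x y =
  \int[m2]_(y in D2) \int[m1]_(x in D1) g x y.
Proof.
move=> mD1 mD2 mg g0.
pose G : R * R -> \bar R := (fun p => g p.1 p.2) \_ (D1 `*` D2).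
have mDD : measurable (D1 `*` D2) by exact: measurableX.
have mG : measurable_fun setT G by apply/(measurable_restrictT _ mDD).
have G0 p : 0 <= G p by apply: erestrict_ge0 => -[x y] [/=]; exact: g0.
have := @fubini_tonelli _ _ _ _ R m1 m2 G mG G0.
have -> : (fun x => \int[m2]_y G (x, y)) = (fun x => \int[m2]_(y in D2) g x y) \_ D1.
  apply/funext => x; rewrite patchE; case: ifPn => [xD|xD].
    rewrite [RHS]integral_mkcond; apply: eq_integral => y _.
    by rewrite /G !patchE in_setX/= xD.
  by apply: integral0_eq => y _; rewrite /G patchE in_setX/= (negbTE xD).
have -> : (fun y => \int[m1]_x G (x, y)) = (fun y => \int[m1]_(x in D1) g x y) \_ D2.
  apply/funext => y; rewrite patchE; case: ifPn => [yD|yD].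
    rewrite [RHS]integral_mkcond; apply: eq_integral => x _.
    by rewrite /G !patchE in_setX/= yD andbT.
  by apply: integral0_eq => x _; rewrite /G patchE in_setX/= (negbTE yD) andbF.
by rewrite -!integral_mkcond.
Qed.

End tonelli_on.

Section moments_to_equation.
Context {R : realType}.
Local Notation leb := (@lebesgue_measure R).
Variable mu : {finite_measure set (measurableTypeR R) -> \bar R}.
Variables (q : R) (f : R -> R).
Hypothesis phi_pos : forall u : R, 0 < u -> 0 < phi mu q u.
Hypothesis f_ge0 : forall x : R, 0 < x -> 0 <= f x.
Hypothesis density_cont : forall x : R, 0 < x -> {for x, continuous f}.
Local Notation D := (`]0, +oo[%classic : set R).
Local Notation c := (q + levy_mass mu).
Local Notation p := (moment_coef mu q).
Hypothesis f_moments : forall n,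
  (\int[leb]_(x in `]0%R, +oo[) (x ^+ n * f x)%:E = (n`!%:R * p n)%:E)%E.

Let mD : measurable (D : set (measurableTypeR R)). Proof. exact: measurable_itv. Qed.

Lemma half_lineE (x : R) : D x = (0 < x) :> Prop.
Proof. by rewrite /= in_itv/= andbT. Qed.

Lemma measurable_density : measurable_fun D f.
Proof.
apply: open_continuous_measurable_fun; first exact: interval_open.
by move=> x; rewrite inE half_lineE; exact: density_cont.
Qed.

Lemma moment_coefS n : p n = phi mu q n.+1%:R * p n.+1.
Proof.
by rewrite /moment_coef big_ord_recr/= mulrC -mulrA mulVf ?mulr1// gt_eqF// phi_pos.
Qed.

Lemma moment_coef_gt0 n : 0 < p n.
Proof. by apply: prodr_gt0 => k _; rewrite invr_gt0 phi_pos. Qed.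

Lemma phi_limit_gt0 : 0 < c.
Proof.
rewrite (@lt_le_trans _ _ (phi mu q 1))// ?phi_pos// phi_psi ?ler01//.
by rewrite lerBlDr lerDl psi_ge0.
Qed.

Lemma phi_le_c u : 0 <= u -> phi mu q u <= c.
Proof. by move=> u0; rewrite phi_psi// lerBlDr lerDl psi_ge0. Qed.

Lemma phi_eventually_gt (th : R) : th < c ->
  exists N : nat, forall n, (N <= n)%N -> th < phi mu q n%:R.
Proof.
move=> thc; have /cvgr_gt /(_ _ thc)[A [_ AP]] := @cvg_phi R mu q.
exists (Num.truncn `|A|).+1 => n Nn; apply: AP.
rewrite (le_lt_trans (ler_norm A))// (lt_le_trans (truncnS_gt _))// ler_nat.
exact: Nn.
Qed.

(** The ratio of consecutive terms is th / phi(n + 1), which tends to th / c < 1. *)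
Lemma exp_moment_series_bound (th : R) : 0 < th < c ->
  exists2 B, 0 <= B & forall N, \sum_(n < N) th ^+ n * p n <= B.
Proof.
move=> /andP[th0 thc]; pose th' := (th + c) / 2.
have th'c : th' < c by rewrite /th'; lra.
have thth' : th < th' by rewrite /th'; lra.
have th'0 : 0 < th' by exact: lt_trans thth'.
have [N0 NP] := phi_eventually_gt th'c.
apply: (@ratio_bound _ (fun n => th ^+ n * p n) (th / th') N0).
- by move=> n; rewrite mulr_ge0 ?exprn_ge0 ?(ltW th0)// ltW// moment_coef_gt0.
- by rewrite divr_ge0 ?(ltW th0) ?(ltW th'0)//= ltr_pdivrMr// mul1r.
- move=> n Nn; have ph := NP n.+1 (leqW Nn).
  rewrite exprS -mulrA [leRHS]mulrA [_ / _ * _]mulrAC -!mulrA ler_wpM2l ?(ltW th0)//.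
  rewrite ler_wpM2l ?exprn_ge0 ?(ltW th0)//.
  rewrite ler_pdivlMl// (moment_coefS n) ler_wpM2r ?(ltW (moment_coef_gt0 _))//.
  exact: ltW.
Qed.

Lemma integrable_pow_density n : leb.-integrable D (EFin \o (fun x => x ^+ n * f x)).
Proof.
apply/integrableP; split.
  by apply/measurable_EFinP; apply: measurable_mul_pow; exact: measurable_density.
rewrite (_ : integral _ _ _ = (n`!%:R * p n)%:E) ?ltry// -f_moments.
apply: eq_integral => x; rewrite inE half_lineE => x0.
by rewrite /= ger0_norm// mulr_ge0 ?f_ge0// exprn_ge0// ltW.
Qed.

Lemma integrable_density : leb.-integrable D (EFin \o f).
Proof.
have := integrable_pow_density 0; apply: eq_integrable => // x _.
by rewrite /= expr0 mul1r.
Qed.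

Lemma integrable_exp_density (th : R) : 0 < th < c ->
  leb.-integrable D (EFin \o (fun x => f x * expR (th * x))).
Proof.
move=> thc; have [B B0 BP] := exp_moment_series_bound thc.
have th0 : 0 < th by case/andP: thc.
have mfe : measurable_fun D (fun x => f x * expR (th * x)).
  by apply: measurable_funM; [exact: measurable_density|exact: measurable_expRl].
apply/integrableP; split; first exact/measurable_EFinP.
apply: le_lt_trans (ltry B).
pose g N x := (f x * series (exp_coeff (th * x)) N)%:E.
have mg N : measurable_fun D (g N).
  apply/measurable_EFinP; apply: measurable_funM; first exact: measurable_density.
  apply: measurable_funTS; rewrite /series/=; apply: measurable_sum => k.
  apply: measurable_funM => //; apply: measurable_funX; exact: measurable_funM.
have g0 N x : D x -> (0 <= g N x)%E.
  rewrite half_lineE => x0; rewrite lee_fin mulr_ge0 ?f_ge0// sumr_ge0// => k _.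
  by rewrite /exp_coeff/= mulr_ge0 ?exprn_ge0 ?mulr_ge0 ?(ltW th0) ?(ltW x0)// invr_ge0 ler0n.
have gn x : D x -> {homo g^~ x : n m / (n <= m)%N >-> (n <= m)%E}.
  rewrite half_lineE => x0 n m nm; rewrite lee_fin ler_wpM2l ?f_ge0//.
  apply: (@nondecreasing_series _ (exp_coeff (th * x)) xpredT) => // k _ _.
  by rewrite /exp_coeff/= mulr_ge0 ?exprn_ge0 ?mulr_ge0 ?(ltW th0) ?(ltW x0)// invr_ge0 ler0n.
have glim x : D x -> limn (g^~ x) = (f x * expR (th * x))%:E.
  move=> _; apply/cvg_lim => //; apply: cvg_EFin; first exact: nearW.
  by apply: cvgM; [exact: cvg_cst|exact: is_cvg_series_exp_coeff].
rewrite (_ : integral _ _ _ = (\int[leb]_(x in D) limn (g^~ x))%E); last first.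
  apply: eq_integral => x; rewrite inE => Dx; rewrite glim//= ger0_norm//.
  by rewrite mulr_ge0 ?expR_ge0// f_ge0// -half_lineE.
rewrite (monotone_convergence _ mD mg g0 gn).
apply: lime_le.
  apply: ereal_nondecreasing_is_cvgn => n m nm.
  apply: ge0_le_integral; [by []|exact: g0|exact: mg|exact: mg|].
    by move=> x Dx; exact: gn.
apply: nearW => N.
suff -> : (\int[leb]_(x in D) g N x = (\sum_(n < N) th ^+ n * p n)%:E)%E by rewrite lee_fin.
elim: N {mg g0 gn glim} => [|N IH].
  rewrite big_ord0 integral0_eq// => x _.
  by rewrite /g /series/= big_geq// mulr0.
rewrite big_ord_recr/= EFinD -IH.
have gS x : g N.+1 x = (g N x + (th ^+ N / N`!%:R)%:E * (x ^+ N * f x)%:E)%E.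
  rewrite /g -EFinM -EFinD /series/= big_nat_recr//= mulrDr; congr (_ + _)%:E.
  by rewrite /exp_coeff/= exprMn; ring.
under eq_integral do rewrite gS.
have mpf : measurable_fun D (fun x => (x ^+ N * f x)%:E).
  by apply/measurable_EFinP; apply: measurable_mul_pow; exact: measurable_density.
have pf0 x : D x -> (0 <= (x ^+ N * f x)%:E)%E.
  by rewrite half_lineE => x0; rewrite lee_fin mulr_ge0 ?f_ge0// exprn_ge0// ltW.
have cN : 0 <= th ^+ N / N`!%:R by rewrite divr_ge0 ?exprn_ge0 ?ler0n// ltW.
rewrite ge0_integralD//; last 4 first.
- move=> x; rewrite half_lineE => x0; rewrite /g lee_fin mulr_ge0 ?f_ge0// sumr_ge0// => k _.
  by rewrite /exp_coeff/= mulr_ge0 ?exprn_ge0 ?mulr_ge0 ?(ltW th0) ?(ltW x0)// invr_ge0 ler0n.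
- apply/measurable_EFinP; apply: measurable_funM; first exact: measurable_density.
  apply: measurable_funTS; rewrite /series/=; apply: measurable_sum => k.
  apply: measurable_funM => //; apply: measurable_funX; exact: measurable_funM.
- by move=> x Dx; apply: mule_ge0; [rewrite lee_fin|exact: pf0].
- exact: emeasurable_funM.
rewrite ge0_integralZl_EFin//; congr (_ + _)%E.
rewrite [X in (_ * X)%E]f_moments -EFinM; congr EFin.
by rewrite mulrA divfK// pnatr_eq0 -lt0n fact_gt0.
Qed.

(** The tail of the law. The maximum makes it nonincreasing on the whole line, which
    gives its measurability. *)
Definition Fbar (x : R) : R := \int[leb]_(y in `]Num.max x 0, +oo[) f y.

Lemma integrable_tail (x : R) : 0 <= x ->
  leb.-integrable (`]x, +oo[%classic : set R) (EFin \o f).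
Proof.
move=> x0; apply: integrableS integrable_density => //.
by move=> y /=; rewrite !in_itv/= !andbT; exact: le_lt_trans.
Qed.

Lemma FbarE (x : R) : 0 < x -> Fbar x = \int[leb]_(y in `]x, +oo[) f y.
Proof. by move=> x0; rewrite /Fbar max_l// ltW. Qed.

Lemma Fbar_fin (x : R) : 0 <= x -> (Fbar x)%:E = (\int[leb]_(y in `]x, +oo[) (f y)%:E)%E.
Proof.
move=> x0; rewrite /Fbar max_l// fineK//; apply: integrable_fin_num => //.
exact: integrable_tail.
Qed.

Lemma Fbar_ge0 x : 0 <= Fbar x.
Proof.
apply: Rintegral_ge0 => y; rewrite /= in_itv/= andbT gt_max => /andP[_].
exact: f_ge0.
Qed.

Lemma Fbar_nincr : nonincreasing_fun Fbar.
Proof.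
move=> x y xy; rewrite -lee_fin !fineK; last 2 first.
- by apply: integrable_fin_num => //; apply: integrable_tail; rewrite le_max lexx orbT.
- by apply: integrable_fin_num => //; apply: integrable_tail; rewrite le_max lexx orbT.
apply: ge0_subset_integral => //.
- apply: measurable_int; apply: integrable_tail; rewrite le_max lexx orbT//.
- by move=> z; rewrite /= in_itv/= andbT gt_max => /andP[_ z0]; rewrite lee_fin f_ge0.
- move=> z; rewrite /= !in_itv/= !andbT; apply: le_lt_trans.
  by rewrite ge_max !le_max xy lexx !orbT.
Qed.

Lemma measurable_Fbar : measurable_fun setT Fbar.
Proof. exact: nonincreasing_measurable Fbar_nincr. Qed.

Lemma isd_Fbar (x : R) : 0 < x -> is_derive x (1 : R) Fbar (- f x).
Proof.
move=> x0; apply: isd_near (isd_tail x0 integrable_density (density_cont x0)); near=> y.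
by rewrite FbarE//; near: y; exact: lt_nbhsr.
Unshelve. all: by end_near. Qed.

Lemma Fbar_cont (x : R) : 0 < x -> {for x, continuous Fbar}.
Proof. by move=> x0; exact: isd_continuous (isd_Fbar x0). Qed.

Lemma Fbar_exp_le (th : R) : 0 < th < c ->
  exists2 K, 0 <= K & forall x, 0 < x -> Fbar x <= K * expR (- (th * x)).
Proof.
move=> thc; have ife := integrable_exp_density thc.
exists (\int[leb]_(x in D) (f x * expR (th * x))).
  by apply: Rintegral_ge0 => x; rewrite half_lineE => x0; rewrite mulr_ge0 ?f_ge0 ?expR_ge0.
move=> x x0; rewrite -(RintegralZr _ _ ife)// -lee_fin Fbar_fin ?(ltW x0)// fineK; last first.
  apply: integrable_fin_num => //.
  have := integrableZl mD (expR (- (th * x))) ife; apply: eq_integrable => // y _.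
  by rewrite /= -EFinM mulrC.
have ifx := integrable_tail (ltW x0).
apply: (@le_trans _ _ (\int[leb]_(y in `]x, +oo[) (f y * expR (th * y) * expR (- (th * x)))%:E)%E).
  apply: ge0_le_integral => //.
  - by move=> y; rewrite /= in_itv/= andbT => xy; rewrite lee_fin f_ge0// (lt_trans x0).
  - exact: measurable_int ifx.
  - apply/measurable_EFinP; apply: measurable_funM => //; apply: measurable_funM.
      by have /measurable_EFinP := measurable_int _ ifx.
    apply: (@measurable_funS _ _ _ _ D) => //; last exact: measurable_expRl.
    by move=> y /=; rewrite !in_itv/= !andbT; exact: lt_trans.
  - move=> y; rewrite /= in_itv/= andbT => xy; rewrite lee_fin -mulrA -expRD.
    rewrite ler_peMr ?f_ge0 ?(lt_trans x0)// -expR0 ler_expR -mulrN -mulrDr mulr_ge0//.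
      by case/andP: thc => /ltW.
    by rewrite subr_ge0 ltW.
apply: ge0_subset_integral => //.
- apply/measurable_EFinP; apply: measurable_funM => //.
  by have /measurable_EFinP := measurable_int _ ife.
- by move=> y; rewrite half_lineE => y0; rewrite lee_fin !mulr_ge0 ?expR_ge0// f_ge0.
- by move=> y /=; rewrite !in_itv/= !andbT; exact: lt_trans.
Qed.

(** Turns a boolean factor, as produced by Tonelli's theorem, into a domain of
    integration. *)
Lemma integral_bool (E E' : set R) (b : R -> bool) (h : R -> R) :
  (forall x, (E x /\ b x) <-> E' x) ->
  (\int[leb]_(x in E) (h x * (b x)%:R)%:E = \int[leb]_(x in E') (h x)%:E)%E.
Proof.
move=> EE'; rewrite integral_mkcond [RHS]integral_mkcond; apply: eq_integral => x _.
rewrite !patchE; have [xE'|xE'] := boolP (x \in E').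
  move: xE'; rewrite inE => /EE'[Ex bx].
  by rewrite mem_set// bx mulr1.
case: ifPn => // xE; case bx : (b x); last by rewrite mulr0.
by exfalso; move/negP: xE'; apply; rewrite inE; apply/EE'; split => //; rewrite inE in xE.
Qed.

Lemma integral_pow (b : R) n : 0 < b ->
  (\int[leb]_(x in `]0%R, b[) (x ^+ n)%:E = (b ^+ n.+1 / n.+1%:R)%:E)%E.
Proof.
move=> b0.
have dp (x : R) : is_derive x (1 : R) (fun y => n.+1%:R^-1 * y ^+ n.+1) (x ^+ n).
  apply: isd_eq (isd_mull n.+1%:R^-1 (isd_X n.+1 (isd_id x))) => //=.
  by rewrite mulr1 mulrA mulVf ?mul1r// pnatr_eq0.
have mp (E : set R) : measurable_fun E (fun x : R => (x ^+ n)%:E).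
  by apply/measurable_EFinP; apply: measurable_funTS; exact: measurable_funX.
rewrite integral_itv_obnd_cbnd// integral_itv_bndo_bndc//.
rewrite (@continuous_FTC2_isd _ _ (fun y => n.+1%:R^-1 * y ^+ n.+1) 0 b)//.
- by rewrite expr0n/= mulr0 subr0 mulrC.
- apply: continuous_subspaceT => x.
  exact: isd_continuous (isd_X n (isd_id x)).
Qed.

Lemma integral_pow_Fbar (a : R) n : 0 < a ->
  (\int[leb]_(x in `]0%R, +oo[) (x ^+ n * Fbar (a * x))%:E =
   (n`!%:R * p n.+1 / a ^+ n.+1)%:E)%E.
Proof.
move=> a0; pose fD := f \_ D.
have n1 : 1 + n%:R != 0 :> R by rewrite addrC natr1 pnatr_eq0.
have an : a ^+ n.+1 != 0 by rewrite expf_neq0// gt_eqF.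
have mfD : measurable_fun setT fD.
  by apply/(measurable_restrictT _ mD); exact: measurable_density.
have fDE (y : R) : 0 < y -> fD y = f y by move=> y0; rewrite /fD patchE mem_set ?half_lineE.
pose g (x y : R) := (x ^+ n * fD y * (a * x < y)%R%:R)%:E.
have mg : measurable_fun (D `*` D) (fun z : R * R => g z.1 z.2).
  apply: measurable_funTS; apply/measurable_EFinP; apply: measurable_funM.
    apply: measurable_funM; first exact: measurable_funX.
    exact: (measurableT_comp mfD measurable_snd).
  apply: (measurableT_comp (f := fun b : bool => b%:R : R)) => //.
  apply: measurable_fun_ltr => //; exact: measurable_funM.
have g0 x y : D x -> D y -> (0 <= g x y)%E.
  by rewrite !half_lineE => x0 y0; rewrite lee_fin !mulr_ge0 ?exprn_ge0 ?(ltW x0)// fDE// f_ge0.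
transitivity (\int[leb]_(x in D) \int[leb]_(y in D) g x y)%E.
  apply: eq_integral => x; rewrite inE half_lineE => x0; have ax0 : 0 < a * x by exact: mulr_gt0.
  rewrite (@integral_bool D `]a * x, +oo[%classic (fun y => a * x < y) (fun y => x ^+ n * fD y)); last first.
    move=> y; rewrite half_lineE /= in_itv/= andbT; split => [[]//|axy]; split => //.
    exact: lt_trans axy.
  transitivity (\int[leb]_(y in `](a * x)%R, +oo[) ((x ^+ n)%:E * (f y)%:E))%E; last first.
    apply: eq_integral => y; rewrite inE/= in_itv/= andbT => axy.
    by rewrite fDE ?EFinM// (lt_trans ax0).
  rewrite ge0_integralZl//.
  - by rewrite -Fbar_fin ?(ltW ax0).
  - exact: measurable_int (integrable_tail (ltW ax0)).
  - by move=> y; rewrite /= in_itv/= andbT => axy; rewrite lee_fin f_ge0// (lt_trans ax0).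
  - by rewrite lee_fin exprn_ge0// ltW.
rewrite (@tonelli_on _ leb leb D D g mD mD mg g0).
transitivity (\int[leb]_(y in D) ((n.+1%:R * a ^+ n.+1)^-1%:E * (y ^+ n.+1 * f y)%:E))%E.
  apply: eq_integral => y; rewrite inE half_lineE => y0; have ya0 : 0 < y / a by exact: divr_gt0.
  transitivity (\int[leb]_(x in D) ((x ^+ n * f y) * (a * x < y)%R%:R)%:E)%E.
    by apply: eq_integral => x _; rewrite /g fDE.
  rewrite (@integral_bool D `]0, y / a[%classic (fun x => a * x < y) (fun x => x ^+ n * f y)); last first.
    move=> x; rewrite half_lineE /= in_itv/= ltr_pdivlMr// mulrC.
    by split => [[-> ->]//|/andP[-> ->]].
  under eq_integral do rewrite EFinM.
  rewrite ge0_integralZr//; last 3 first.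
  - by apply/measurable_EFinP; apply: measurable_funTS; exact: measurable_funX.
  - by move=> x; rewrite /= in_itv/= => /andP[x0 _]; rewrite lee_fin exprn_ge0// ltW.
  - by rewrite lee_fin f_ge0.
  rewrite integral_pow// -!EFinM; congr EFin; rewrite expr_div_n; field.
  by rewrite ?an ?n1.
have k0 : 0 <= (n.+1%:R * a ^+ n.+1)^-1 by rewrite invr_ge0 mulr_ge0 ?ler0n// exprn_ge0// ltW.
have mpf : measurable_fun D (fun x => (x ^+ n.+1 * f x)%:E).
  by apply/measurable_EFinP; apply: measurable_mul_pow; exact: measurable_density.
have pf0 x : D x -> (0 <= (x ^+ n.+1 * f x)%:E)%E.
  by rewrite half_lineE => x0; rewrite lee_fin mulr_ge0 ?f_ge0// exprn_ge0// ltW.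
rewrite ge0_integralZl_EFin//.
rewrite [X in (_ * X)%E]f_moments -EFinM factS natrM; congr EFin; field.
by rewrite ?an ?n1.
Qed.

End moments_to_equation.

(** * The integral equation for the density *)

Section functional_equation.
Context {R : realType}.
Local Notation leb := (@lebesgue_measure R).
Variable mu : {finite_measure set (measurableTypeR R) -> \bar R}.
Variables (q : R) (f : R -> R).
Hypothesis phi_pos : forall u : R, 0 < u -> 0 < phi mu q u.
Hypothesis f_ge0 : forall x : R, 0 < x -> 0 <= f x.
Hypothesis f_smooth : forall n (x : R), 0 < x -> derivable (derive1n n f) x 1.
Local Notation D := (`]0, +oo[%classic : set R).
Local Notation c := (q + levy_mass mu).
Local Notation p := (moment_coef mu q).
Hypothesis f_moments : forall n,
  (\int[leb]_(x in `]0%R, +oo[) (x ^+ n * f x)%:E = (n`!%:R * p n)%:E)%E.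
Local Notation Fb := (Fbar f).

Let mD : measurable (D : set (measurableTypeR R)). Proof. exact: measurable_itv. Qed.

Lemma density_cont (x : R) : 0 < x -> {for x, continuous f}.
Proof.
move=> x0; have h : derivable f x 1 := @f_smooth 0%N x x0.
exact: isd_continuous (derivable_isd h).
Qed.

Let c0 : 0 < c. Proof. exact: phi_limit_gt0. Qed.
Let Fb0 x : 0 <= Fb x. Proof. exact: Fbar_ge0. Qed.
Let Fb_cont (x : R) : 0 < x -> {for x, continuous Fb}.
Proof. by move=> x0; apply: (Fbar_cont f_ge0 density_cont f_moments). Qed.
Let Fb_nincr : nonincreasing_fun Fb.
Proof. exact: (Fbar_nincr f_ge0 density_cont f_moments). Qed.

Lemma Fbar_dilated_le (x v : R) : 0 < x -> 0 < v -> Fb (x * expR v) <= Fb x.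
Proof.
move=> x0 v0; apply: Fb_nincr; rewrite ler_peMr ?(ltW x0)//.
by rewrite -expR0 ler_expR ltW.
Qed.

Lemma dilate0_Fbar_bound (x : R) : 0 < x -> `|dilate mu 0 Fb x| <= Fb x * levy_mass mu.
Proof.
move=> x0; apply: le_levy_integral; first exact: measurable_dilated.
move=> v v0; rewrite mul0r expR0 mulr1 ger0_norm//; exact: Fbar_dilated_le.
Qed.

Lemma dilate0_Fbar_cont (x : R) : 0 < x -> {for x, continuous (dilate mu 0 Fb)}.
Proof.
move=> x0; pose g (y v : R) := Fb (y * expR v) * expR (0%:R * v).
have I0 y : `]x / 2, 2 * x[%classic y -> 0 < y.
  by rewrite /= in_itv/= => /andP[xy _]; apply: lt_trans xy; rewrite divr_gt0.
have gle y v : `]x / 2, 2 * x[%classic y -> D v -> `|g y v| <= Fb (x / 2).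
  move=> Iy; rewrite half_lineE => v0; rewrite /g mul0r expR0 mulr1 ger0_norm//.
  apply: le_trans (Fbar_dilated_le (I0 _ Iy) v0) _; apply: Fb_nincr.
  by move: Iy; rewrite /= in_itv/= => /andP[/ltW].
have intg y : `]x / 2, 2 * x[%classic y -> mu.-integrable D (EFin \o g y).
  move=> Iy; apply: (@levy_integrable _ _ _ (Fb (x / 2))).
    apply: measurable_dilated => //; exact: I0.
  by move=> v v0; apply: gle => //; rewrite half_lineE.
have := @continuity_under_integral R _ _ mu g D mD (x / 2) (2 * x) intg _
   (fun=> Fb (x / 2)) (integrable_levy_cst _ _) _ x _; apply.
- apply: aeW => v Dv y Iy.
  have cc : {for y, continuous (fun y : R => Fb (y * expR v))}.
    have y0 : 0 < y by apply: I0; rewrite inE in Iy.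
    have dF : is_derive (y * expR v) (1 : R) Fb (- f (y * expR v)).
      by apply: (isd_Fbar f_ge0 density_cont f_moments); rewrite mulr_gt0 ?expR_gt0.
    have e1 := @isd_comp R Fb (fun y => y * expR v) y _ _ dF
      (isd_mul (isd_id y) (isd_cst y (expR v))).
    exact: isd_continuous e1.
  by apply: cvgM; [exact: cc|exact: cvg_cst].
- by move=> y Iy; apply: aeW => v Dv; exact: gle.
- by rewrite inE/= in_itv/= ltr_pdivrMr// ltr_pMr// mulrC ltr_pMr// ltr1n.
Qed.

Lemma ge0_integral_fin (h : R -> R) (r : R) : measurable_fun D h ->
  (forall x : R, 0 < x -> 0 <= h x) ->
  (\int[leb]_(x in D) (h x)%:E = r%:E)%E ->
  leb.-integrable D (EFin \o h) /\ \int[leb]_(x in D) h x = r.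
Proof.
move=> mh h0 hr; split; last by rewrite /Rintegral hr.
apply/integrableP; split; first exact/measurable_EFinP.
rewrite (_ : integral _ _ _ = r%:E) ?ltry// -hr; apply: eq_integral => x.
by rewrite inE half_lineE => x0; rewrite /= ger0_norm// h0.
Qed.

Lemma cont_measurable (h : R -> R) : (forall x : R, 0 < x -> {for x, continuous h}) ->
  measurable_fun D h.
Proof.
move=> ch; apply: open_continuous_measurable_fun; first exact: interval_open.
by move=> x; rewrite inE half_lineE; exact: ch.
Qed.

Lemma integral_pow_dilate0_Fbar n :
  (\int[leb]_(x in D) (x ^+ n * dilate mu 0 Fb x)%:E =
   (n`!%:R * p n.+1 * psi mu n.+1%:R)%:E)%E.
Proof.
pose g (x v : R) := (x ^+ n * Fb (x * expR v))%:E.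
have mF := measurable_Fbar f_ge0 density_cont f_moments.
have mg : measurable_fun (D `*` D) (fun z : R * R => g z.1 z.2).
  apply: measurable_funTS; apply/measurable_EFinP; apply: measurable_funM.
    exact: measurable_funX.
  apply: (measurableT_comp mF); apply: measurable_funM => //.
  by apply: measurableT_comp; [exact: measurable_expR|exact: measurable_snd].
have g0 x y : D x -> D y -> (0 <= g x y)%E.
  by rewrite !half_lineE => x0 _; rewrite lee_fin mulr_ge0// exprn_ge0// ltW.
transitivity (\int[leb]_(x in D) \int[mu]_(v in D) g x v)%E.
  apply: eq_integral => x; rewrite inE half_lineE => x0.
  have ib : mu.-integrable D (EFin \o (fun v => Fb (x * expR v) * expR (0%:R * v))).
    apply: (@levy_integrable _ _ _ (Fb x)); first exact: measurable_dilated.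
    by move=> v v0; rewrite mul0r expR0 mulr1 ger0_norm//; exact: Fbar_dilated_le.
  rewrite /dilate -RintegralZl// /Rintegral fineK.
    by apply: eq_integral => v _; rewrite /g mul0r expR0 mulr1.
  apply: integrable_fin_num => //.
  by have := integrableZl mD (x ^+ n) ib; apply: eq_integrable.
rewrite (@tonelli_on _ leb mu D D g mD mD mg g0).
transitivity (\int[mu]_(v in D) ((n`!%:R * p n.+1)%:E * (expR (- (n.+1%:R * v)))%:E))%E.
  apply: eq_integral => v; rewrite inE half_lineE => v0.
  transitivity (\int[leb]_(x in D) (x ^+ n * Fb (expR v * x))%:E)%E.
    by apply: eq_integral => x _; rewrite /g mulrC [x * expR v]mulrC mulrC.
  rewrite (integral_pow_Fbar f_ge0 density_cont f_moments)//; last exact: expR_gt0.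
  by rewrite -EFinM expRN expRM_natl.
rewrite ge0_integralZl_EFin//.
- rewrite [RHS]EFinM; congr (_ * _)%E; rewrite /psi fineK//.
  apply: integrable_fin_num => //; exact: integrable_psi.
- by apply/measurable_EFinP; exact: measurable_expRNr.
- by rewrite mulr_ge0 ?ler0n// (ltW (moment_coef_gt0 _ _)).
Qed.

(** Both sides are continuous with exponential moments, and their moments agree
    because p_n = phi(n + 1) p_(n+1); so the moment problem identifies them. *)
Lemma density_equation (x : R) : 0 < x -> f x = c * Fb x - dilate mu 0 Fb x.
Proof.
move=> x0; pose u (y : R) := f y - c * Fb y + dilate mu 0 Fb y.
have mf := cont_measurable density_cont.
have mFb := cont_measurable Fb_cont.
have mdF := cont_measurable dilate0_Fbar_cont.
have dF0 y : 0 <= dilate mu 0 Fb y.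
  by apply: Rintegral_ge0 => v _; rewrite mulr_ge0// expR_ge0.
have cu : {for x, continuous u}.
  apply: cvgD; last exact: dilate0_Fbar_cont.
  apply: cvgB; first exact: density_cont.
  by apply: cvgM; [exact: cvg_cst|exact: Fb_cont].
have mcF : measurable_fun D (fun y => c * Fb y) by exact: measurable_funM.
have mu' : measurable_fun D u.
  by apply: measurable_funD => //; apply: measurable_funB.
suff : u x = 0 by rewrite /u => /eqP; rewrite -addrA addr_eq0 => /eqP ->; rewrite opprD opprK.
apply: (@null_moments_eq0 _ (c / 4)) => //; first by rewrite divr_gt0.
split => //.
  have t2 : 0 < c / 2 < c by rewrite divr_gt0//= ltr_pdivrMr// ltr_pMr// ltr1n.
  have t4 : 0 < c / 4 < c by rewrite divr_gt0//= ltr_pdivrMr// ltr_pMr// ltr1n.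
  have [K K0 KP] := Fbar_exp_le phi_pos f_ge0 density_cont f_moments t2.
  have i1 := integrable_exp_density phi_pos f_ge0 density_cont f_moments t4.
  pose g2 (y : R) := (c + levy_mass mu) * K * expR (- (c / 4 * y)).
  have [i2 _] : leb.-integrable D (EFin \o (fun y => expR (- (c / 4 * y)))) /\
      \int[leb]_(y in D) expR (- (c / 4 * y)) = 1 / (c / 4).
    apply: ge0_integral_fin; first exact: measurable_expRNr.
      by move=> y _; exact: expR_ge0.
    rewrite integral_itv_obnd_cbnd.
      by rewrite integral_expRN_tail ?divr_gt0// mulr0 oppr0 expR0.
    by apply/measurable_EFinP; exact: measurable_expRNr.
  have i3 : leb.-integrable D (EFin \o g2).
    by have := integrableZl mD ((c + levy_mass mu) * K) i2; apply: eq_integrable.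
  have i4 := integrableD mD i1 i3.
  apply: (le_integrable _ _ _ i4) => //.
    by apply/measurable_EFinP; apply: measurable_funM => //; exact: measurable_expRl.
  move=> y; rewrite half_lineE => y0; rewrite /= lee_fin.
  have l0 := levy_mass_ge0 mu.
  have h1 : `|u y| <= f y + (c + levy_mass mu) * Fb y.
    have -> : f y + (c + levy_mass mu) * Fb y = (f y + c * Fb y) + levy_mass mu * Fb y by ring.
    rewrite /u (le_trans (ler_normD _ _))// lerD//.
      rewrite (le_trans (ler_normB _ _))// lerD// ger0_norm//; first exact: f_ge0.
      by rewrite mulr_ge0// ltW.
    by rewrite mulrC; exact: dilate0_Fbar_bound.
  rewrite normrM [`|expR _|]ger0_norm ?expR_ge0//.
  apply: le_trans (ler_norm _).
  apply: (@le_trans _ _ ((f y + (c + levy_mass mu) * Fb y) * expR (c / 4 * y))).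
    by rewrite ler_wpM2r ?expR_ge0.
  rewrite mulrDl lerD2l /g2 -[leLHS]mulrA -[leRHS]mulrA ler_wpM2l//; first by rewrite addr_ge0// ltW.
  apply: (@le_trans _ _ (K * expR (- (c / 2 * y)) * expR (c / 4 * y))).
    by rewrite ler_wpM2r ?expR_ge0// KP.
  by rewrite -mulrA -expRD ler_wpM2l// ler_expR; lra.
move=> n.
have [i1 E1] : leb.-integrable D (EFin \o (fun y => y ^+ n * f y)) /\
    \int[leb]_(y in D) (y ^+ n * f y) = n`!%:R * p n.
  apply: ge0_integral_fin => //; first exact: measurable_mul_pow.
  by move=> y y0; rewrite mulr_ge0 ?f_ge0// exprn_ge0// ltW.
have [i2 E2] : leb.-integrable D (EFin \o (fun y => y ^+ n * Fb y)) /\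
    \int[leb]_(y in D) (y ^+ n * Fb y) = n`!%:R * p n.+1.
  apply: ge0_integral_fin => //; first exact: measurable_mul_pow.
  - by move=> y y0; rewrite mulr_ge0// exprn_ge0// ltW.
  - have := integral_pow_Fbar f_ge0 density_cont f_moments n ltr01.
    rewrite expr1n divr1 => <-; apply: eq_integral => y _; by rewrite mul1r.
have [i3 E3] : leb.-integrable D (EFin \o (fun y => y ^+ n * dilate mu 0 Fb y)) /\
    \int[leb]_(y in D) (y ^+ n * dilate mu 0 Fb y) = n`!%:R * p n.+1 * psi mu n.+1%:R.
  apply: ge0_integral_fin => //; first exact: measurable_mul_pow.
  - by move=> y y0; rewrite mulr_ge0// exprn_ge0// ltW.
  - exact: integral_pow_dilate0_Fbar.
have i2c : leb.-integrable D (EFin \o (fun y => c * (y ^+ n * Fb y))).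
  by have := integrableZl mD c i2; apply: eq_integrable.
have i12 : leb.-integrable D (EFin \o (fun y => y ^+ n * f y - c * (y ^+ n * Fb y))).
  by have := integrableB mD i1 i2c; apply: eq_integrable.
transitivity (\int[leb]_(y in D) (y ^+ n * f y - c * (y ^+ n * Fb y) + y ^+ n * dilate mu 0 Fb y)).
  by apply: eq_Rintegral => y _; rewrite /u; ring.
rewrite RintegralD// RintegralB// RintegralZl// E1 E2 E3.
rewrite (moment_coefS phi_pos n) phi_psi//; ring.
Qed.

End functional_equation.

(** * Equations and bounds for the derivatives *)

Section derivative_equations.
Context {R : realType}.
Local Notation leb := (@lebesgue_measure R).
Variable mu : {finite_measure set (measurableTypeR R) -> \bar R}.
Variables (q : R) (f : R -> R).
Hypothesis phi_pos : forall u : R, 0 < u -> 0 < phi mu q u.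
Hypothesis f_ge0 : forall x : R, 0 < x -> 0 <= f x.
Hypothesis f_smooth : forall n (x : R), 0 < x -> derivable (derive1n n f) x 1.
Local Notation D := (`]0, +oo[%classic : set R).
Local Notation c := (q + levy_mass mu).
Local Notation p := (moment_coef mu q).
Hypothesis f_moments : forall n,
  (\int[leb]_(x in `]0%R, +oo[) (x ^+ n * f x)%:E = (n`!%:R * p n)%:E)%E.
Local Notation Fb := (Fbar f).

Let mD : measurable (D : set (measurableTypeR R)). Proof. exact: measurable_itv. Qed.
Let fc := density_cont f_smooth.
Let c0 : 0 < c. Proof. exact: phi_limit_gt0. Qed.
Let Fb0 x : 0 <= Fb x. Proof. exact: Fbar_ge0. Qed.

(** The tail is put in front of the derivatives of f, with a minus sign, so that each
    term of the sequence is the derivative of the previous one. *)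
Definition tail_derivative (n : nat) : R -> R :=
  if n is n'.+1 then derive1n n' f else fun x => - Fb x.

Lemma isd_tail_derivative n (x : R) : 0 < x -> is_derive x (1 : R) (tail_derivative n) (tail_derivative n.+1 x).
Proof.
move=> x0; case: n => [|n] /=.
  by apply: isd_eq (isd_opp (isd_Fbar f_ge0 fc f_moments x0)) => //; rewrite opprK.
have := derivable_isd (@f_smooth n x x0); by rewrite -derive1nS.
Qed.

Lemma tail_derivative_cont n (x : R) : 0 < x -> {for x, continuous (tail_derivative n)}.
Proof. by move=> x0; exact: isd_continuous (isd_tail_derivative n x0). Qed.

Lemma dilateN k h (x : R) : 0 < x -> (forall y : R, 0 < y -> {for y, continuous h}) ->
  forall K, (forall y : R, 0 < y -> `|h y| * y ^+ k <= K) ->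
  dilate mu k (fun y => - h y) x = - dilate mu k h x.
Proof.
move=> x0 ch K hK; rewrite -[RHS]mulN1r /dilate -RintegralZl//.
  by apply: eq_Rintegral => v _; rewrite mulN1r mulNr.
exact: integrable_dilated hK.
Qed.

Lemma Fbar_pow_bound (th : R) : 0 < th < c ->
  exists2 K, 0 <= K & forall m (y : R), 0 < y -> Fb y * y ^+ m <= K * (m`!%:R / th ^+ m).
Proof.
move=> thc; have [K K0 KP] := Fbar_exp_le phi_pos f_ge0 fc f_moments thc.
exists K => // m y y0; have th0 : 0 < th by case/andP: thc.
apply: (@le_trans _ _ (K * expR (- (th * y)) * y ^+ m)).
  by rewrite ler_wpM2r ?KP// exprn_ge0// ltW.
rewrite -mulrA ler_wpM2l// expRN mulrC ler_pdivrMr ?expR_gt0//.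
exact: pow_le_exp.
Qed.

(** The price of n derivatives in the bound with m powers: each equation contributes
    c from its first term and psi from its dilation term. *)
Definition deriv_factor (m n : nat) : R := \prod_(j < n) (c + psi mu (m - j)%:R).

Lemma deriv_factor_ge0 m n : 0 <= deriv_factor m n.
Proof. by apply: prodr_ge0 => j _; rewrite addr_ge0 ?psi_ge0// ltW. Qed.

(** Equation and bound are proved together: the bound allows the equation to be
    differentiated under the integral, and the equation bounds the next derivative. *)
Lemma tail_derivative_equation_bound (th K : R) : 0 < th < c -> 0 <= K ->
  (forall m (y : R), 0 < y -> Fb y * y ^+ m <= K * (m`!%:R / th ^+ m)) ->
  forall n,
  (forall x : R, 0 < x -> tail_derivative n.+1 x = - c * tail_derivative n x + dilate mu n (tail_derivative n) x) /\
  (forall m (y : R), (n <= m)%N -> 0 < y ->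
     `|tail_derivative n y| * y ^+ m <= K * (m`!%:R / th ^+ m) * deriv_factor m n).
Proof.
move=> thc K0 KP; have th0 : 0 < th by case/andP: thc.
pose B m n := K * (m`!%:R / th ^+ m) * deriv_factor m n.
have B0 m n : 0 <= B m n.
  by rewrite mulr_ge0 ?deriv_factor_ge0// mulr_ge0// divr_ge0 ?ler0n// exprn_ge0// ltW.
have bound n : (forall x : R, 0 < x -> tail_derivative n.+1 x = - c * tail_derivative n x + dilate mu n (tail_derivative n) x) ->
    (forall m (y : R), (n <= m)%N -> 0 < y -> `|tail_derivative n y| * y ^+ m <= B m n) ->
    forall m (y : R), (n <= m)%N -> 0 < y -> `|tail_derivative n.+1 y| * y ^+ m <= B m n.+1.
  move=> eqn bn m y nm y0; rewrite eqn//.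
  apply: (@le_trans _ _ (c * (`|tail_derivative n y| * y ^+ m) + `|dilate mu n (tail_derivative n) y| * y ^+ m)).
    rewrite mulrA -mulrDl ler_wpM2r ?exprn_ge0 ?(ltW y0)//.
    by rewrite (le_trans (ler_normD _ _))// lerD2r normrM normrN (gtr0_norm c0).
  rewrite /B /deriv_factor big_ord_recr/= mulrA mulrDr mulrC -/(deriv_factor m n) -/(B m n).
  apply: lerD; first by rewrite ler_wpM2r ?(ltW c0)// bn.
  apply: dilate_le => //; first exact: tail_derivative_cont.
  by move=> z z0; exact: bn.
elim=> [|n [eqn bn]]; split.
- move=> x x0 /=; rewrite (density_equation phi_pos f_ge0 f_smooth f_moments x0).
  rewrite (@dilateN 0 Fb x x0 _ (B 0%N 0%N)) ?mulrNN//.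
    by move=> y y0; exact: (Fbar_cont f_ge0 fc f_moments).
  move=> y y0; rewrite ger0_norm// /B /deriv_factor big_ord0 mulr1; exact: KP.
- move=> m y _ y0 /=; rewrite normrN ger0_norm// /deriv_factor big_ord0 mulr1; exact: KP.
- move=> x x0.
  have bn1 := bound n eqn bn.
  have dR : is_derive x (1 : R) (fun y => - c * tail_derivative n y + dilate mu n (tail_derivative n) y)
      (- c * tail_derivative n.+1 x + dilate mu n.+1 (tail_derivative n.+1) x).
    apply: isd_add; first exact: isd_mull (isd_tail_derivative n x0).
    apply: (@isd_dilate _ _ n (tail_derivative n) (tail_derivative n.+1) x (B n n) (B n.+1 n.+1)) => //.
    + by move=> y y0; exact: isd_tail_derivative.
    + by move=> y y0; exact: tail_derivative_cont.
    + by move=> y y0; exact: bn.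
    + by move=> y y0; exact: bn1.
  have dL := isd_tail_derivative n.+1 x0.
  have dL' : is_derive x (1 : R) (tail_derivative n.+1) (- c * tail_derivative n.+1 x + dilate mu n.+1 (tail_derivative n.+1) x).
    apply: isd_near dR; near=> y; apply/esym/eqn.
    by near: y; exact: lt_nbhsr.
  by rewrite -(isd_derive1 dL) (isd_derive1 dL').
- by move=> m y nm y0; apply: bound => //; exact: ltnW.
Unshelve. all: by end_near. Qed.

Lemma half_c : 0 < c / 2 < c.
Proof. by rewrite divr_gt0//= ltr_pdivrMr// ltr_pMr// ltr1n. Qed.

Lemma tail_derivative_equation n (x : R) : 0 < x ->
  tail_derivative n.+1 x = - c * tail_derivative n x + dilate mu n (tail_derivative n) x.
Proof.
have [K K0 KP] := Fbar_pow_bound half_c.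
by have [h _] := tail_derivative_equation_bound half_c K0 KP n; exact: h.
Qed.

Lemma tail_derivative_bound (th : R) : 0 < th < c -> exists2 K, 0 <= K &
  forall n m (y : R), (n <= m)%N -> 0 < y ->
     `|tail_derivative n y| * y ^+ m <= K * (m`!%:R / th ^+ m) * deriv_factor m n.
Proof.
move=> thc; have [K K0 KP] := Fbar_pow_bound thc.
by exists K => // n; have [_ h] := tail_derivative_equation_bound thc K0 KP n; exact: h.
Qed.

Lemma tail_derivative_finite_bound n m : (n <= m)%N ->
  exists K, forall y : R, 0 < y -> `|tail_derivative n y| * y ^+ m <= K.
Proof.
move=> nm; have [K K0 KP] := tail_derivative_bound half_c.
by exists (K * (m`!%:R / (c / 2) ^+ m) * deriv_factor m n) => y y0; exact: KP.
Qed.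

Lemma density_le_Fbar (x : R) : 0 < x -> f x <= c * Fb x.
Proof.
move=> x0; rewrite (density_equation phi_pos f_ge0 f_smooth f_moments x0).
rewrite gerBl; apply: Rintegral_ge0 => v _; by rewrite mulr_ge0// expR_ge0.
Qed.

(** By the equation, the derivative of f x * expR (c * x) is expR (c * x) times a
    dilation of f, hence nonnegative. *)
Lemma density_exp_ndecr (x y : R) : 0 < x -> x <= y ->
  f x * expR (c * x) <= f y * expR (c * y).
Proof.
move=> x0; rewrite le_eqVlt => /predU1P[->//|xy].
pose g' (z : R) := dilate mu 1 f z * expR (c * z).
have dg z : x <= z <= y -> is_derive z (1 : R) (fun z => f z * expR (c * z)) (g' z).
  move=> /andP[xz _]; have z0 : 0 < z by exact: lt_le_trans xz.
  apply: isd_eq (isd_mul (isd_tail_derivative 1 z0) (isd_expR (isd_mull c (isd_id z)))) => //=.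
  have := tail_derivative_equation 1 z0 => /= ->; rewrite /g'; ring.
have [z /andP[xz zy] E] := MVT_isd xy dg.
rewrite -subr_ge0 E mulr_ge0 ?subr_ge0 ?(ltW xy)// mulr_ge0 ?expR_ge0//.
apply: Rintegral_ge0 => v _; rewrite mulr_ge0 ?expR_ge0// f_ge0// mulr_gt0 ?expR_gt0//.
exact: lt_trans xz.
Qed.

Lemma density_pos : exists2 x1 : R, 0 < x1 & 0 < f x1.
Proof.
apply: contrapT => h; have := f_moments 0%N.
rewrite /= integral0_eq.
  move=> E0; have /eqP : 0`!%:R * p 0 = 0 :> R by apply: EFin_inj; rewrite -E0.
  rewrite fact0 mul1r gt_eqF//; exact: moment_coef_gt0.
move=> x; rewrite half_lineE => x0; rewrite expr0 mul1r; congr EFin; apply/eqP.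
by rewrite eq_le f_ge0// andbT leNgt; apply/negP => fx; apply: h; exists x.
Qed.

Lemma density_lower : exists a x1 : R,
  [/\ 0 < a, 0 < x1 & forall x : R, x1 <= x -> a * expR (- (c * x)) <= f x].
Proof.
have [x1 x10 fx1] := density_pos.
exists (f x1 * expR (c * x1)), x1; split => //; first by rewrite mulr_gt0 ?expR_gt0.
move=> x x1x; rewrite expRN ler_pdivrMr ?expR_gt0//.
exact: density_exp_ndecr.
Qed.

Lemma Fbar_lower : exists a x1 : R,
  [/\ 0 < a, 0 < x1 & forall x : R, x1 <= x -> a * expR (- (c * x)) <= Fb x].
Proof.
have [a [x1 [a0 x10 fP]]] := density_lower.
exists (a / c), x1; split => //; first by rewrite divr_gt0.
move=> x x1x; rewrite mulrAC ler_pdivrMr//.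
rewrite (le_trans (fP x x1x))// mulrC; apply: density_le_Fbar.
exact: lt_le_trans x1x.
Qed.

End derivative_equations.

(** * Asymptotics up to the constant *)

Section asymptotics.
Context {R : realType}.
Local Notation leb := (@lebesgue_measure R).
Variable mu : {finite_measure set (measurableTypeR R) -> \bar R}.
Variables (q : R) (f : R -> R).
Hypothesis phi_pos : forall u : R, 0 < u -> 0 < phi mu q u.
Hypothesis f_ge0 : forall x : R, 0 < x -> 0 <= f x.
Hypothesis f_smooth : forall n (x : R), 0 < x -> derivable (derive1n n f) x 1.
Local Notation D := (`]0, +oo[%classic : set R).
Local Notation c := (q + levy_mass mu).
Local Notation p := (moment_coef mu q).
Hypothesis f_moments : forall n,
  (\int[leb]_(x in `]0%R, +oo[) (x ^+ n * f x)%:E = (n`!%:R * p n)%:E)%E.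
Local Notation Fb := (Fbar f).

Let mD : measurable (D : set (measurableTypeR R)). Proof. exact: measurable_itv. Qed.
Let fc := density_cont f_smooth.
Let c0 : 0 < c. Proof. exact: phi_limit_gt0. Qed.
Let Fb0 x : 0 <= Fb x. Proof. exact: Fbar_ge0. Qed.
Let Fb_cont (x : R) : 0 < x -> {for x, continuous Fb}.
Proof. by move=> x0; apply: (Fbar_cont f_ge0 fc f_moments). Qed.

(** The tail of the law decays at every rate th below c; it suffices to take th so
    close to c that th * expR v exceeds c. *)
Lemma cvg_exp_dilated (v : R) : 0 < v ->
  exists2 th : R, 0 < th < c &
   expR (c * x - th * (x * expR v)) @[x --> +oo] --> (0 : R).
Proof.
move=> v0; have ev : 0 < expR (- v) < 1 by rewrite expR_gt0 -expR0 ltr_expR oppr_lt0.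
case/andP: ev => ev0 ev1.
exists (c * ((1 + expR (- v)) / 2)).
  by apply/andP; split; [rewrite mulr_gt0//; lra|rewrite gtr_pMr//; lra].
pose d := c * (expR v - 1) / 2.
have d0 : 0 < d by rewrite /d divr_gt0// mulr_gt0// subr_gt0 -expR0 ltr_expR.
apply: cvg_trans (cvgy_expRN d0); apply: near_eq_cvg; near=> x.
congr expR; rewrite /d; have e1 : expR (- v) * expR v = 1 by rewrite -expRD addNr expR0.
have -> : c * ((1 + expR (- v)) / 2) * (x * expR v) =
  c * x * (expR v + expR (- v) * expR v) / 2 by ring.
by rewrite e1; lra.
Unshelve. all: by end_near. Qed.

Lemma cvg_Fbar_dilated (v a x1 : R) (g : R -> R) : 0 < v -> 0 < a -> 0 < x1 ->
  (forall x : R, x1 <= x -> a * expR (- (c * x)) <= g x) ->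
  Fb (x * expR v) / g x @[x --> +oo] --> (0 : R).
Proof.
move=> v0 a0 x10 gP.
have [th thc cv] := cvg_exp_dilated v0.
have [K K0 KP] := Fbar_exp_le phi_pos f_ge0 fc f_moments thc.
have cK : K / a * expR (c * x - th * (x * expR v)) @[x --> +oo] --> (0 : R).
  by rewrite -[X in _ --> X](mulr0 (K / a)); apply: cvgM; [exact: cvg_cst|exact: cv].
apply: (squeeze_cvgr _ (cvg_cst 0) cK); near=> x.
have xx1 : x1 <= x by near: x; apply: nbhs_pinfty_ge; exact: num_real.
have x0 : 0 < x by exact: lt_le_trans xx1.
have g0 : 0 < g x by rewrite (lt_le_trans _ (gP x xx1))// mulr_gt0// expR_gt0.
rewrite divr_ge0 ?(ltW g0)//= ler_pdivrMr//.
apply: (@le_trans _ _ (K * expR (- (th * (x * expR v))))).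
  by rewrite KP// mulr_gt0// expR_gt0.
apply: (@le_trans _ _ (K / a * expR (c * x - th * (x * expR v)) * (a * expR (- (c * x))))).
  rewrite expRD le_eqVlt; apply/orP; left; apply/eqP.
  have e1 : expR (c * x) * expR (- (c * x)) = 1 by rewrite -expRD addrN expR0.
  transitivity (K * expR (- (th * (x * expR v))) * (a^-1 * a) *
     (expR (c * x) * expR (- (c * x)))); last by ring.
  by rewrite e1 mulVf ?gt_eqF// !mulr1.
by rewrite ler_wpM2l ?gP// mulr_ge0 ?expR_ge0// divr_ge0// ltW.
Unshelve. all: by end_near. Qed.

Lemma dilate_div k (h : R -> R) (x K r : R) : 0 < x ->
  (forall y : R, 0 < y -> {for y, continuous h}) ->
  (forall y : R, 0 < y -> `|h y| * y ^+ k <= K) ->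
  \int[mu]_(v in D) (h (x * expR v) * expR (k%:R * v) / r) = dilate mu k h x / r.
Proof.
by move=> x0 ch hK; rewrite /dilate -RintegralZr//; exact: integrable_dilated hK.
Qed.

Lemma Fbar_le_bound : exists K, forall y : R, 0 < y -> `|Fb y| * y ^+ 0 <= K.
Proof.
have [K KP] := tail_derivative_finite_bound phi_pos f_ge0 f_smooth f_moments (leqnn 0).
by exists K => y y0; have := KP y y0; rewrite /= normrN.
Qed.

Lemma cvg_dilate0_Fbar : dilate mu 0 Fb x / Fb x @[x --> +oo] --> (0 : R).
Proof.
have [a [x1 [a0 x10 FP]]] := Fbar_lower phi_pos f_ge0 f_smooth f_moments.
have Fp (x : R) : x1 <= x -> 0 < Fb x.
  by move=> xx1; rewrite (lt_le_trans _ (FP x xx1))// mulr_gt0// expR_gt0.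
have [K KP] := Fbar_le_bound.
have : \int[mu]_(v in D) (Fb (x * expR v) * expR (0%:R * v) / Fb x) @[x --> +oo] --> (0 : R).
  apply: (@levy_dominated _ _ (fun x v => Fb (x * expR v) * expR (0%:R * v) / Fb x) x1 1).
  - move=> x xx1; apply: measurable_funM => //; apply: measurable_dilated => //.
    exact: lt_le_trans xx1.
  - move=> x v xx1 v0; rewrite mul0r expR0 mulr1 ger0_norm ?divr_ge0//.
    rewrite ler_pdivrMr ?Fp// mul1r.
    apply: (Fbar_dilated_le f_ge0 f_smooth f_moments) => //; exact: lt_le_trans xx1.
  - move=> v v0; under eq_fun do rewrite mul0r expR0 mulr1.
    exact: cvg_Fbar_dilated FP.
apply: cvg_trans; apply: near_eq_cvg; near=> x.
apply: (dilate_div _ _ _ KP) => //; near: x; apply: nbhs_pinfty_gt; exact: num_real.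
Unshelve. all: by end_near. Qed.

(** In the equation f = c Fbar - dilate 0 Fbar the last term is negligible. *)
Lemma density_vs_Fbar : exists2 x2 : R, 0 < x2 &
  forall x : R, x2 <= x -> 0 < f x /\ c * Fb x <= 2 * f x.
Proof.
have [a [x1 [a0 x10 FP]]] := Fbar_lower phi_pos f_ge0 f_smooth f_moments.
have Fp (x : R) : x1 <= x -> 0 < Fb x.
  by move=> xx1; rewrite (lt_le_trans _ (FP x xx1))// mulr_gt0// expR_gt0.
have c20 : 0 < c / 2 by rewrite divr_gt0.
have /cvgr_lt /(_ _ c20)[A [_ AP]] := cvg_dilate0_Fbar.
exists (Num.max x1 (`|A| + 1)); first by rewrite lt_max x10.
move=> x; rewrite ge_max => /andP[xx1 Ax].
have x0 : 0 < x by exact: lt_le_trans xx1.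
have := AP x _; rewrite (lt_le_trans _ Ax); last by rewrite (le_lt_trans (ler_norm _))// ltrDl.
move=> /(_ isT); rewrite ltr_pdivrMr ?Fp// => h.
have E := density_equation phi_pos f_ge0 f_smooth f_moments x0.
have cF : 0 < c * Fb x by rewrite mulr_gt0 ?Fp.
have h2 : dilate mu 0 Fb x < (c * Fb x) / 2 by rewrite mulrAC.
by split; rewrite E; lra.
Qed.

Lemma density_bound1 k : exists K, forall y : R, 0 < y -> `|f y| * y ^+ k.+1 <= K.
Proof. exact: (tail_derivative_finite_bound phi_pos f_ge0 f_smooth f_moments (ltn0Sn k)). Qed.

Lemma cvg_dilate_density k : dilate mu k.+1 f x / f x @[x --> +oo] --> (0 : R).
Proof.
have [a [x1 [a0 x10 fP]]] := density_lower phi_pos f_ge0 f_smooth f_moments.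
have [x2 x20 x2P] := density_vs_Fbar.
have thc : 0 < c * (3 / 4) < c.
  by apply/andP; split; [rewrite mulr_gt0//; lra|rewrite gtr_pMr//; lra].
have [K K0 KP] := Fbar_exp_le phi_pos f_ge0 fc f_moments thc.
have [K' K'P] := density_bound1 k.
have fF (y : R) : 0 < y -> f y <= c * Fb y.
  exact: (density_le_Fbar phi_pos f_ge0 f_smooth f_moments).
pose A : R := Num.max 1 (Num.max x1 x2).
have c40 : 0 < c / 4 by rewrite divr_gt0.
pose M1 : R := 2 * expR (k.+1%:R : R).
pose M2 := c * K / a * (k.+1`!%:R / (c / 4) ^+ k.+1).
have : \int[mu]_(v in D) (f (x * expR v) * expR (k.+1%:R * v) / f x) @[x --> +oo] --> (0 : R).
  refine (@levy_dominated R mu (fun x v => f (x * expR v) * expR (k.+1%:R * v) / f x) A (M1 + M2) _ _ _).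
  - move=> x Ax; apply: measurable_funM => //; apply: measurable_dilated => //.
    by rewrite (lt_le_trans _ Ax)// lt_max ltr01.
  - move=> x v; rewrite !ge_max => /and3P[x1' xx1 xx2] v0.
    have [fx cF] := x2P x xx2.
    have x0 : 0 < x by exact: lt_le_trans x1'.
    have xv0 : 0 < x * expR v by rewrite mulr_gt0 ?expR_gt0.
    have M10 : 0 <= M1 by rewrite mulr_ge0 ?expR_ge0.
    have M20 : 0 <= M2.
      by rewrite !mulr_ge0 ?invr_ge0 ?ler0n ?exprn_ge0 ?(ltW c0) ?(ltW a0) ?(ltW c40).
    rewrite ger0_norm; last by rewrite divr_ge0 ?(ltW fx)// mulr_ge0 ?expR_ge0// f_ge0.
    (* for v <= 1 the two tails are compared; for v > 1 the decay of the tail at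
       x * expR v beats both the factor expR (k.+1 * v) and 1 / f x *)
    have [v1|v1] := leP v 1.
      apply: (@le_trans _ _ M1); last by rewrite lerDl.
      rewrite ler_pdivrMr// /M1 mulrAC; apply: ler_pM; rewrite ?expR_ge0 ?f_ge0//.
        rewrite (le_trans (fF _ xv0))// (le_trans _ cF)// ler_wpM2l ?(ltW c0)//.
        exact: (Fbar_dilated_le f_ge0 f_smooth f_moments).
      by rewrite ler_expR ler_piMr.
    apply: (@le_trans _ _ M2); last by rewrite lerDr.
    rewrite ler_pdivrMr//; apply: (@le_trans _ _ (M2 * (a * expR (- (c * x))))); last first.
      by rewrite ler_wpM2l// fP.
    apply: (@le_trans _ _ (c * (K * expR (- (c * (3 / 4) * (x * expR v)))) * expR (k.+1%:R * v))).
      rewrite ler_wpM2r ?expR_ge0// (le_trans (fF _ xv0))// ler_wpM2l ?(ltW c0)//.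
      exact: KP.
    have -> : M2 * (a * expR (- (c * x))) =
        c * K * (a / a) * ((k.+1`!%:R / (c / 4) ^+ k.+1) * expR (- (c * x))) by rewrite /M2; ring.
    rewrite divff ?gt_eqF// mulr1.
    set E1 := expR (- (c * (3 / 4) * (x * expR v))).
    set Q := k.+1`!%:R / (c / 4) ^+ k.+1.
    have Q0 : 0 <= Q by rewrite divr_ge0 ?ler0n// exprn_ge0// ltW.
    have -> : c * (K * E1) * expR (k.+1%:R * v) = c * K * (E1 * expR (k.+1%:R * v)) by ring.
    apply: ler_wpM2l; first by rewrite mulr_ge0// ltW.
    rewrite expRM_natl; have := pow_le_exp k.+1 c40 (expR_gt0 v).
    move=> /(ler_wpM2l (expR_ge0 (- (c * (3 / 4) * (x * expR v))))) /le_trans; apply.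
    rewrite -/E1 -/Q mulrCA; apply: ler_wpM2l => //; rewrite /E1 -expRD.
    rewrite ler_expR.
    have e2 : 2 <= expR v by rewrite (le_trans _ (expR_ge1Dx v))//; lra.
    have h1 : c * 1 * 2 <= c * x * expR v.
      by apply: ler_pM => //; rewrite ?mulr_ge0 ?ler_wpM2l ?(ltW c0).
    have h2 : c * x * 2 <= c * x * expR v by rewrite ler_wpM2l// mulr_ge0// ltW.
    have h3 : c * expR v <= c * x * expR v.
      by rewrite ler_wpM2r ?expR_ge0// ler_peMr// ltW.
    have -> : c * (3 / 4) * (x * expR v) = 3 / 4 * (c * x * expR v) by ring.
    have -> : c / 4 * expR v = (c * expR v) / 4 by ring.
    move: h2; have -> : c * x * 2 = 2 * (c * x) by ring.
    by move=> h2; lra.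
  - move=> v v0.
    have cF : Fb (x * expR v) / f x @[x --> +oo] --> (0 : R) by exact: cvg_Fbar_dilated fP.
    have cc : c * expR (k.+1%:R * v) * (Fb (x * expR v) / f x) @[x --> +oo] --> (0 : R).
      by rewrite -[X in _ --> X](mulr0 (c * expR (k.+1%:R * v))); apply: cvgM; [exact: cvg_cst|exact: cF].
    apply: (squeeze_cvgr _ (cvg_cst 0) cc); near=> x.
    have xx2 : x2 <= x by near: x; apply: nbhs_pinfty_ge; exact: num_real.
    have [fx _] := x2P x xx2.
    have xv0 : 0 < x * expR v by rewrite mulr_gt0 ?expR_gt0// (lt_le_trans x20).
    rewrite divr_ge0 ?mulr_ge0 ?expR_ge0 ?f_ge0 ?(ltW fx)//=.
    rewrite mulrA ler_wpM2r ?invr_ge0 ?(ltW fx)// [leRHS]mulrAC ler_wpM2r ?expR_ge0//.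
    exact: fF.
apply: cvg_trans; apply: near_eq_cvg; near=> x.
apply: (dilate_div _ _ _ K'P) => //; near: x; apply: nbhs_pinfty_gt; exact: num_real.
Unshelve. all: by end_near. Qed.

(** By the previous step the n-th derivative is bounded by a multiple of f, so the
    dilation term of its equation is negligible and the ratio gains a factor - c. *)
Lemma derivative_ratio n : derive1n n f x / f x @[x --> +oo] --> (- c) ^+ n.
Proof.
have [x2 x20 x2P] := density_vs_Fbar.
elim: n => [|n IH].
  rewrite expr0; have : (fun _ : R => 1 : R) x @[x --> +oo] --> (1 : R) by exact: cvg_cst.
  apply: cvg_trans; apply: near_eq_cvg; near=> x.
  have xx2 : x2 <= x by near: x; apply: nbhs_pinfty_ge; exact: num_real.
  by have [fx _] := x2P x xx2; rewrite /= divff// gt_eqF.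
have [C [A [A0 AP]]] : exists C A : R, 0 < A /\
    forall x : R, A <= x -> `|derive1n n f x| <= C * f x.
  have : \forall x \near +oo, `|derive1n n f x / f x - (- c) ^+ n| < 1.
    by move/cvgrPdist_lt : IH => /(_ 1 ltr01); apply: filterS => x; rewrite distrC.
  move=> [A [_ AP]]; exists (1 + `|(- c) ^+ n|), (Num.max x2 (`|A| + 1)).
  split; first by rewrite lt_max x20.
  move=> x; rewrite ge_max => /andP[xx2 Ax]; have [fx _] := x2P x xx2.
  have Ax' : A < x by rewrite (lt_le_trans _ Ax)// (le_lt_trans (ler_norm _))// ltrDl.
  have h := AP x Ax'.
  rewrite -ler_pdivrMr// -[f x in leLHS](gtr0_norm fx) -normf_div.
  rewrite -[X in `|X|](subrK ((- c) ^+ n)) (le_trans (ler_normD _ _))// lerD2r.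
  exact: ltW.
have [K KP] := tail_derivative_finite_bound phi_pos f_ge0 f_smooth f_moments (leqnn n.+1).
have [K' K'P] := density_bound1 n.
have hc (y : R) : 0 < y -> {for y, continuous (derive1n n f)}.
  exact: (tail_derivative_cont f_ge0 f_smooth f_moments (n := n.+1)).
have cd : dilate mu n.+1 (derive1n n f) x / f x @[x --> +oo] --> (0 : R).
  have cC : C * (dilate mu n.+1 f x / f x) @[x --> +oo] --> (0 : R).
    by rewrite -[X in _ --> X](mulr0 C); apply: cvgM; [exact: cvg_cst|exact: cvg_dilate_density].
  have cCN : - (C * (dilate mu n.+1 f x / f x)) @[x --> +oo] --> (0 : R).
    by rewrite -[X in _ --> X]oppr0; exact: cvgN.
  apply: (squeeze_cvgr _ cCN cC); near=> x; rewrite -ler_norml.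
  have xx2 : x2 <= x by near: x; apply: nbhs_pinfty_ge; exact: num_real.
  have xA : A <= x by near: x; apply: nbhs_pinfty_ge; exact: num_real.
  have [fx _] := x2P x xx2; have x0 : 0 < x by exact: lt_le_trans xx2.
  rewrite normf_div (gtr0_norm fx) mulrA ler_wpM2r ?invr_ge0 ?(ltW fx)//.
  have i1 := integrable_dilated mu x0 hc KP.
  have i2 := integrable_dilated mu x0 fc K'P.
  apply: le_trans (le_normr_Rintegral _ i1) _ => //.
  rewrite /dilate -RintegralZl//; apply: le_Rintegral => //.
  - exact: integrable_norm i1.
  - by have := integrableZl mD C i2; apply: eq_integrable.
  - move=> v; rewrite half_lineE => v0; rewrite normrM [`|expR _|]ger0_norm ?expR_ge0// mulrA.
    rewrite ler_wpM2r ?expR_ge0// AP// (le_trans xA)// ler_peMr ?(ltW x0)//.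
    by rewrite -expR0 ler_expR ltW.
have : - c * (derive1n n f x / f x) + dilate mu n.+1 (derive1n n f) x / f x @[x --> +oo]
    --> - c * (- c) ^+ n + 0.
  by apply: cvgD => //; apply: cvgM; [exact: cvg_cst|exact: IH].
rewrite addr0 -exprS; apply: cvg_trans; apply: near_eq_cvg; near=> x.
have x0 : 0 < x by near: x; apply: nbhs_pinfty_gt; exact: num_real.
have E : derive1n n.+1 f x = - c * derive1n n f x + dilate mu n.+1 (derive1n n f) x.
  exact: (tail_derivative_equation phi_pos f_ge0 f_smooth f_moments n.+1 x0).
by rewrite E mulrDl mulrA.
Unshelve. all: by end_near. Qed.

Lemma density_eventually_pos : exists2 x2 : R, 0 < x2 & forall x : R, x2 <= x -> 0 < f x.
Proof. by have [x2 x20 h] := density_vs_Fbar; exists x2 => // x /h[]. Qed.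

Lemma cvgy_inv : x^-1 @[x --> +oo] --> (0 : R).
Proof.
apply/gtr0_cvgV0; last exact: cvg_id.
by near=> x; near: x; apply: nbhs_pinfty_gt; exact: num_real.
Unshelve. all: by end_near. Qed.

(** From below f is comparable to expR (- (c x)) by monotonicity; from above it is
    bounded by exponentials of all rates below c. *)
Lemma ln_density_ratio : (ln (f x)) / x @[x --> +oo] --> - c.
Proof.
have [a [x1 [a0 x10 fP]]] := density_lower phi_pos f_ge0 f_smooth f_moments.
have low : ln a / x - c @[x --> +oo] --> - c.
  rewrite -[X in _ --> X]add0r; apply: cvgB; last exact: cvg_cst.
  rewrite -[X in _ --> X](mulr0 (ln a)); apply: cvgM; first exact: cvg_cst.
  exact: cvgy_inv.
apply/cvgrPdist_lt => eps eps0.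
pose th := Num.max (c / 2) (c - eps / 2).
have thc : 0 < th < c.
  rewrite lt_max divr_gt0//= gt_max gtrBl divr_gt0// andbT.
  by rewrite ltr_pdivrMr// ltr_pMr// ltr1n.
have [K K0 KP] := Fbar_exp_le phi_pos f_ge0 fc f_moments thc.
have fF (y : R) : 0 < y -> f y <= c * Fb y.
  exact: (density_le_Fbar phi_pos f_ge0 f_smooth f_moments).
pose K1 := c * K + 1.
have K10 : 0 < K1 by rewrite ltr_wpDl// mulr_ge0// ltW.
have up : ln K1 / x - th @[x --> +oo] --> - th.
  rewrite -[X in _ --> X]add0r; apply: cvgB; last exact: cvg_cst.
  rewrite -[X in _ --> X](mulr0 (ln K1)); apply: cvgM; first exact: cvg_cst.
  exact: cvgy_inv.
near=> x.
have xx1 : x1 <= x by near: x; apply: nbhs_pinfty_ge; exact: num_real.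
have x0 : 0 < x by exact: lt_le_trans xx1.
have h1 : - c - eps < ln a / x - c by near: x; move/cvgr_gt : low; apply; lra.
have h2 : ln K1 / x - th < - c + eps.
  near: x; move/cvgr_lt : up; apply; rewrite /th ltrNl opprD opprK lt_max; apply/orP; right; lra.
have fx : 0 < f x by rewrite (lt_le_trans _ (fP x xx1))// mulr_gt0 ?expR_gt0.
have l1 : ln a / x - c <= ln (f x) / x.
  rewrite ler_pdivlMr// mulrBl divfK ?gt_eqF//.
  have -> : ln a - c * x = ln (a * expR (- (c * x))) by rewrite lnM ?posrE ?expR_gt0// expRK.
  by rewrite ler_ln ?posrE ?fP// mulr_gt0 ?expR_gt0.
have l2 : ln (f x) / x <= ln K1 / x - th.
  rewrite ler_pdivrMr// mulrBl divfK ?gt_eqF//.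
  have -> : ln K1 - th * x = ln (K1 * expR (- (th * x))) by rewrite lnM ?posrE ?expR_gt0// expRK.
  rewrite ler_ln ?posrE//; last by rewrite mulr_gt0 ?expR_gt0.
  rewrite (le_trans (fF x x0))// (le_trans (ler_wpM2l (ltW c0) (KP x x0)))// mulrA.
  by rewrite ler_wpM2r ?expR_ge0// /K1 lerDl.
by rewrite ltr_norml; apply/andP; split; lra.
Unshelve. all: by end_near. Qed.

End asymptotics.

(** * The constant as a limit of gamma averages *)

Section gamma_integral.
Context {R : realType}.
Local Notation leb := (@lebesgue_measure R).
Local Notation D := (`]0, +oo[%classic : set R).

Fixpoint gamma_prim (a : R) (n : nat) (x : R) : R :=
  if n is n'.+1
  then a^-1 * (n%:R * gamma_prim a n' x - x ^+ n * expR (- (a * x)))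
  else - a^-1 * expR (- (a * x)).

Lemma isd_gamma_prim (a : R) n (x : R) : 0 < a ->
  is_derive x (1 : R) (gamma_prim a n) (x ^+ n * expR (- (a * x))).
Proof.
move=> a0; elim: n => [|n IH] /=.
  apply: isd_eq (isd_mull (- a^-1) (isd_expRN a x)) => //=.
  by rewrite mulrA mulrNN mulVf ?gt_eqF// expr0.
apply: isd_eq (isd_mull a^-1 (isd_sub (isd_mull n.+1%:R IH)
  (isd_mul (isd_X n.+1 (isd_id x)) (isd_expRN a x)))) => //=.
apply: (mulfI (lt0r_neq0 a0)); rewrite mulVKf ?gt_eqF//; ring.
Qed.

Lemma cvg_pow_expRN (a : R) n : 0 < a -> x ^+ n * expR (- (a * x)) @[x --> +oo] --> (0 : R).
Proof.
move=> a0; have a20 : 0 < a / 2 by rewrite divr_gt0.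
pose K : R := n`!%:R / (a / 2) ^+ n.
have cK : K * expR (- (a / 2 * x)) @[x --> +oo] --> (0 : R).
  by rewrite -[X in _ --> X](mulr0 K); apply: cvgM; [exact: cvg_cst|exact: cvgy_expRN].
apply: (squeeze_cvgr _ (cvg_cst 0) cK); near=> x.
have x0 : 0 < x by near: x; apply: nbhs_pinfty_gt; exact: num_real.
rewrite mulr_ge0 ?expR_ge0 ?exprn_ge0 ?(ltW x0)//=.
have := ler_wpM2r (expR_ge0 (- (a * x))) (pow_le_exp n a20 x0).
move=> /le_trans; apply; rewrite -[X in X <= _]mulrA -expRD.
by rewrite (_ : a / 2 * x + - (a * x) = - (a / 2 * x))//; lra.
Unshelve. all: by end_near. Qed.

Lemma gamma_prim_cvg0 (a : R) n : 0 < a -> gamma_prim a n x @[x --> +oo] --> (0 : R).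
Proof.
move=> a0; elim: n => [|n IH] /=.
  by rewrite -[X in _ --> X](mulr0 (- a^-1)); apply: cvgM; [exact: cvg_cst|exact: cvgy_expRN].
rewrite -[X in _ --> X](mulr0 a^-1); apply: cvgM; first exact: cvg_cst.
rewrite -[X in _ --> X]subr0; apply: cvgB; last exact: cvg_pow_expRN.
by rewrite -[X in _ --> X](mulr0 n.+1%:R); apply: cvgM; [exact: cvg_cst|exact: IH].
Qed.

Lemma gamma_prim0 (a : R) n : 0 < a -> gamma_prim a n 0 = - (n`!%:R / a ^+ n.+1).
Proof.
move=> a0; elim: n => [|n IH] /=.
  by rewrite mulr0 oppr0 expR0 mulr1 fact0 expr1 mul1r.
rewrite IH expr0n/= mul0r subr0 factS natrM [a ^+ n.+2]exprS.
by field; rewrite expf_neq0 gt_eqF.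
Qed.

Lemma integral_gamma (a : R) n : 0 < a ->
  (\int[leb]_(x in D) (x ^+ n * expR (- (a * x)))%:E = (n`!%:R / a ^+ n.+1)%:E)%E.
Proof.
move=> a0; have mg : measurable_fun setT (fun x : R => x ^+ n * expR (- (a * x))).
  by apply: measurable_funM; [exact: measurable_funX|exact: measurable_expRN].
rewrite integral_itv_obnd_cbnd; last by apply/measurable_EFinP; exact: measurable_funTS.
have dG (x : R) : is_derive x (1 : R) (gamma_prim a n) (x ^+ n * expR (- (a * x))).
  exact: isd_gamma_prim.
rewrite (@ge0_FTC2y_isd _ _ (gamma_prim a n) 0 0).
- by rewrite sub0r gamma_prim0// opprK.
- by move=> x x0; rewrite mulr_ge0 ?expR_ge0// exprn_ge0.
- move=> x _; exact: isd_continuous (isd_mul (isd_X n (isd_id x)) (isd_expRN a x)).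
- exact: gamma_prim_cvg0.
Qed.

Lemma integral_gamma_head (a A : R) n : 0 < a -> 0 < A ->
  (\int[leb]_(x in `]0%R, A[) (x ^+ n * expR (- (a * x)))%:E <= (A ^+ n.+1 / n.+1%:R)%:E)%E.
Proof.
move=> a0 A0; rewrite -integral_pow//; apply: ge0_le_integral => //.
- move=> x; rewrite /= in_itv/= => /andP[x0 _].
  by rewrite lee_fin mulr_ge0 ?expR_ge0// exprn_ge0// ltW.
- apply/measurable_EFinP; apply: measurable_funTS.
  by apply: measurable_funM; [exact: measurable_funX|exact: measurable_expRN].
- by apply/measurable_EFinP; apply: measurable_funTS; exact: measurable_funX.
- move=> x; rewrite /= in_itv/= => /andP[x0 _]; rewrite lee_fin ler_piMr//.
    by rewrite exprn_ge0// ltW.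
  by rewrite expRN_le1// ltW.
Qed.

End gamma_integral.

Section gamma_average.
Context {R : realType}.
Local Notation leb := (@lebesgue_measure R).
Variable mu : {finite_measure set (measurableTypeR R) -> \bar R}.
Variables (q : R) (f : R -> R).
Hypothesis phi_pos : forall u : R, 0 < u -> 0 < phi mu q u.
Hypothesis f_ge0 : forall x : R, 0 < x -> 0 <= f x.
Hypothesis f_smooth : forall n (x : R), 0 < x -> derivable (derive1n n f) x 1.
Local Notation D := (`]0, +oo[%classic : set R).
Local Notation c := (q + levy_mass mu).
Local Notation p := (moment_coef mu q).
Hypothesis f_moments : forall n,
  (\int[leb]_(x in `]0%R, +oo[) (x ^+ n * f x)%:E = (n`!%:R * p n)%:E)%E.

Let mD : measurable (D : set (measurableTypeR R)). Proof. exact: measurable_itv. Qed.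
Let fc := density_cont f_smooth.
Let c0 : 0 < c. Proof. exact: phi_limit_gt0. Qed.
Let mf : measurable_fun D f. Proof. exact: measurable_density. Qed.
Let g x := f x * expR (c * x).

Lemma gamma_upper (S : R) n : (forall x : R, 0 < x -> g x <= S) -> c ^+ n.+1 * p n <= S.
Proof.
move=> gS.
have S0 : 0 <= S by rewrite (le_trans _ (gS 1 ltr01))// mulr_ge0 ?expR_ge0// f_ge0.
have : ((n`!%:R * p n)%:E <= (S * (n`!%:R / c ^+ n.+1))%:E)%E.
  rewrite -f_moments EFinM -integral_gamma// -ge0_integralZl//; last 2 first.
  - apply/measurable_EFinP; apply: measurable_funTS.
    by apply: measurable_funM; [exact: measurable_funX|exact: measurable_expRN].
  - by move=> x; rewrite half_lineE => x0; rewrite lee_fin mulr_ge0 ?expR_ge0// exprn_ge0// ltW.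
  apply: ge0_le_integral => //.
  - by move=> x; rewrite half_lineE => x0; rewrite lee_fin mulr_ge0 ?f_ge0// exprn_ge0// ltW.
  - by apply/measurable_EFinP; exact: measurable_mul_pow.
  - apply: emeasurable_funM => //; apply/measurable_EFinP; apply: measurable_funTS.
    by apply: measurable_funM; [exact: measurable_funX|exact: measurable_expRN].
  - move=> x; rewrite half_lineE => x0; rewrite -EFinM lee_fin mulrCA ler_wpM2l ?exprn_ge0 ?(ltW x0)//.
    by rewrite expRN ler_pdivlMr ?expR_gt0//; exact: gS.
rewrite lee_fin mulrCA ler_pM2l ?ltr0n ?fact_gt0// ler_pdivlMr ?exprn_gt0//.
by rewrite mulrC.
Qed.

Lemma gamma_lower (A : R) n : 0 < A ->
  g A * (1 - (c * A) ^+ n.+1 / n.+1`!%:R) <= c ^+ n.+1 * p n.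
Proof.
move=> A0; have gA0 : 0 <= g A by rewrite mulr_ge0 ?expR_ge0// f_ge0.
pose k x : R := x ^+ n * expR (- (c * x)).
have mk (E : set R) : measurable_fun E (fun x => (k x)%:E).
  apply/measurable_EFinP; apply: measurable_funTS.
  by apply: measurable_funM; [exact: measurable_funX|exact: measurable_expRN].
have k0 (x : R) : 0 < x -> (0 <= (k x)%:E)%E.
  by move=> x0; rewrite lee_fin mulr_ge0 ?expR_ge0// exprn_ge0// ltW.
(* the gamma density gives ]0, A[ at most the mass of its polynomial factor *)
have ADA : D = `]0, A[%classic `|` `[A, +oo[%classic.
  rewrite -itv_bndbnd_setU// bnd_simp; exact: ltW.
have split_gamma : ((n`!%:R / c ^+ n.+1 - A ^+ n.+1 / n.+1%:R)%:E <=
    \int[leb]_(x in `[A, +oo[) (k x)%:E)%E.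
  have : (\int[leb]_(x in D) (k x)%:E = \int[leb]_(x in `]0%R, A[) (k x)%:E +
      \int[leb]_(x in `[A, +oo[) (k x)%:E)%E.
    rewrite ADA ge0_integral_setU//.
    + exact: mk.
    + by move=> x; rewrite -ADA half_lineE => /k0.
    + by apply/disj_setPS => x /= []; rewrite !in_itv/= andbT => /andP[_ xA]; rewrite leNgt xA.
  rewrite integral_gamma// => E.
  rewrite EFinB leeBlDr// E addeC leeD2l//; exact: integral_gamma_head.
have : ((g A)%:E * (n`!%:R / c ^+ n.+1 - A ^+ n.+1 / n.+1%:R)%:E <= (n`!%:R * p n)%:E)%E.
  rewrite (@le_trans _ _ ((g A)%:E * \int[leb]_(x in `[A, +oo[) (k x)%:E)%E)//.
    by rewrite lee_wpmul2l// lee_fin.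
  rewrite -f_moments -ge0_integralZl//; last 2 first.
  - exact: mk.
  - by move=> x; rewrite /= in_itv/= andbT => Ax; apply: k0; exact: lt_le_trans Ax.
  apply: (@le_trans _ _ (\int[leb]_(x in `[A, +oo[) (x ^+ n * f x)%:E)%E).
    apply: ge0_le_integral => //.
    - move=> x; rewrite /= in_itv/= andbT => Ax; apply: mule_ge0; first by rewrite lee_fin.
      by apply: k0; exact: lt_le_trans Ax.
    - by apply: emeasurable_funM => //; exact: mk.
    - apply: (@measurable_funS _ _ _ _ D) => //.
        by move=> x; rewrite half_lineE /= in_itv/= andbT => Ax; exact: lt_le_trans Ax.
      by apply/measurable_EFinP; exact: measurable_mul_pow.
    - move=> x; rewrite /= in_itv/= andbT => Ax; have x0 : 0 < x by exact: lt_le_trans Ax.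
      rewrite -EFinM lee_fin /k mulrCA ler_wpM2l ?exprn_ge0 ?(ltW x0)//.
      rewrite expRN ler_pdivrMr ?expR_gt0//.
      exact: (density_exp_ndecr phi_pos f_ge0 f_smooth f_moments).
  apply: ge0_subset_integral => //.
  - by apply/measurable_EFinP; exact: measurable_mul_pow.
  - by move=> x; rewrite half_lineE => x0; rewrite lee_fin mulr_ge0 ?f_ge0// exprn_ge0// ltW.
  - by move=> x; rewrite half_lineE /= in_itv/= andbT => Ax; exact: lt_le_trans Ax.
rewrite -EFinM lee_fin => h.
have n0 : 0 < n`!%:R :> R by rewrite ltr0n fact_gt0.
have cn0 : 0 < c ^+ n.+1 by rewrite exprn_gt0.
have fac : 0 <= c ^+ n.+1 / n`!%:R by rewrite divr_ge0 ?ltW.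
have -> : c ^+ n.+1 * p n = c ^+ n.+1 / n`!%:R * (n`!%:R * p n).
  by rewrite mulrA divfK ?gt_eqF.
apply: le_trans (ler_wpM2l fac h); rewrite le_eqVlt; apply/orP; left; apply/eqP.
rewrite factS natrM exprMn; field.
by rewrite !gt_eqF// addrC natr1 ltr0n.
Qed.

(** The number c ^ n.+1 * p n is the average of f x * expR (c * x) for the gamma
    distribution of shape n.+1 and rate c. The mass of bounded sets tends to 0, so
    these averages of a nondecreasing function have the same limit as the function. *)
Lemma gamma_average_limit (L : R) :
  c ^+ n.+1 * p n @[n --> \oo] --> L -> g x @[x --> +oo] --> L.
Proof.
move=> AL.
have gL (A : R) : 0 < A -> g A <= L.
  move=> A0.
  have e1 : (c * A) ^+ n.+1 / n.+1`!%:R @[n --> \oo] --> (0 : R).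
    have := cvg_exp_coeff (c * A); rewrite -(cvg_shiftS (exp_coeff (c * A))); exact.
  have : g A * (1 - (c * A) ^+ n.+1 / n.+1`!%:R) @[n --> \oo] --> g A * (1 - 0).
    by apply: cvgM; [exact: cvg_cst|apply: cvgB; [exact: cvg_cst|exact: e1]].
  rewrite subr0 mulr1 => h; apply: (ler_cvg_to h AL).
  by apply: nearW => n; exact: gamma_lower.
apply/cvgrPdist_lt => eps eps0.
have [x0 x00 gx0] : exists2 x0 : R, 0 < x0 & L - eps < g x0.
  apply: contrapT => h; have gle (x : R) : 0 < x -> g x <= L - eps.
    by move=> x0; rewrite leNgt; apply/negP => gx; apply: h; exists x.
  have : L <= L - eps.
    by apply: (ler_cvg_to AL (cvg_cst _)); apply: nearW => n; exact: gamma_upper.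
  by rewrite lerBrDr -lerBrDl subrr leNgt eps0.
near=> x.
have xx0 : x0 <= x by near: x; apply: nbhs_pinfty_ge; exact: num_real.
have xp : 0 < x by exact: lt_le_trans xx0.
have h1 := gL x xp.
have h2 : g x0 <= g x by exact: (density_exp_ndecr phi_pos f_ge0 f_smooth f_moments).
by rewrite ltr_norml; apply/andP; split; lra.
Unshelve. all: by end_near. Qed.

End gamma_average.

(** * The trapezoid formula *)

Section trapezoid.
Context {R : realType}.
Local Notation leb := (@lebesgue_measure R).

Definition saw (u : R) : R :=
  (u - (Num.floor u)%:~R) * (1 - (u - (Num.floor u)%:~R)).

Lemma saw_bound (u : R) : 0 <= saw u <= 1.
Proof.
have /andP[h1 h2] := floor_itv u; rewrite intrD in h2.
by rewrite /saw; apply/andP; split; [apply: mulr_ge0; lra|nra].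
Qed.

Lemma sawE (k : nat) (u : R) : k%:R <= u <= k.+1%:R ->
  saw u = (u - k%:R) * (k.+1%:R - u).
Proof.
move=> /andP[ku]; rewrite le_eqVlt => /predU1P[->|uk].
  rewrite /saw subrr mulr0 (_ : Num.floor _ = k.+1%:Z); last first.
    by apply: floor_def; rewrite intrD -!pmulrn lexx/= ltrDl.
  by rewrite -pmulrn subrr mul0r.
rewrite /saw (_ : Num.floor u = k%:Z); last first.
  by apply: floor_def; rewrite intrD -!pmulrn ku/= natr1.
rewrite -pmulrn -natr1; ring.
Qed.

Lemma measurable_saw : measurable_fun setT saw.
Proof.
have mfl : measurable_fun [set: R] (fun u : R => ((Num.floor u)%:~R : R)).
  apply: nondecreasing_measurable => // u v uv.
  by rewrite ler_int; exact: le_floor.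
by apply: measurable_funM; apply: measurable_funB => //; apply: measurable_funB.
Qed.

(** Two integrations by parts: the weight vanishes at both ends of the interval, where
    its slopes are 1 and -1, and has second derivative -2. *)
Lemma trapezoid_interval (h h' h'' H : R -> R) (k : nat) :
  (forall u : R, k%:R <= u <= k.+1%:R -> is_derive u (1 : R) H (h u)) ->
  (forall u : R, k%:R <= u <= k.+1%:R -> is_derive u (1 : R) h (h' u)) ->
  (forall u : R, k%:R <= u <= k.+1%:R -> is_derive u (1 : R) h' (h'' u)) ->
  (forall u : R, k%:R <= u <= k.+1%:R -> {for u, continuous h''}) ->
  (\int[leb]_(u in `[k%:R, k.+1%:R]) (saw u * h'' u)%:E =
   (h k%:R + h k.+1%:R - 2 * (H k.+1%:R - H k%:R))%:E)%E.
Proof.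
move=> dH dh dh' ch.
pose w (u : R) := (u - k%:R) * (k.+1%:R - u).
pose F (u : R) := w u * h' u - (k%:R + k.+1%:R - 2 * u) * h u - 2 * H u.
have dw (u : R) : is_derive u (1 : R) w (k%:R + k.+1%:R - 2 * u).
  apply: isd_eq (isd_mul (isd_sub (isd_id u) (isd_cst u k%:R))
    (isd_sub (isd_cst u k.+1%:R) (isd_id u))) => //=.
  by rewrite sub0r subr0; ring.
have dl (u : R) : is_derive u (1 : R) (fun u => k%:R + k.+1%:R - 2 * u) (- 2).
  apply: isd_eq (isd_sub (isd_cst u (k%:R + k.+1%:R)) (isd_mull 2 (isd_id u))) => //=.
  by rewrite mulr1 sub0r.
have dF (u : R) : k%:R <= u <= k.+1%:R -> is_derive u (1 : R) F (w u * h'' u).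
  move=> uk; apply: isd_eq (isd_sub (isd_sub (isd_mul (dw u) (dh' u uk)) (isd_mul (dl u) (dh u uk)))
    (isd_mull 2 (dH u uk))) => //=.
  ring.
transitivity (\int[leb]_(u in `[k%:R, k.+1%:R]) (w u * h'' u)%:E)%E.
  by apply: eq_integral => u; rewrite inE/= in_itv/= => uk; rewrite (sawE uk).
rewrite (@continuous_FTC2_isd _ _ F).
- rewrite /F /w !subrr !(mul0r, mulr0) -natr1; congr EFin; ring.
- by rewrite ltr_nat.
- apply: continuous_in_subspaceT => u; rewrite inE/= in_itv/= => uk.
  by apply: cvgM; [exact: isd_continuous (dw u)|exact: ch].
Qed.

Variables (h h' h'' H : R -> R) (C : R).
Hypothesis dH : forall u : R, 1 <= u -> is_derive u (1 : R) H (h u).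
Hypothesis dh : forall u : R, 1 <= u -> is_derive u (1 : R) h (h' u).
Hypothesis dh' : forall u : R, 1 <= u -> is_derive u (1 : R) h' (h'' u).
Hypothesis ch'' : forall u : R, 1 <= u -> {for u, continuous h''}.
Hypothesis h''_le : forall u : R, 1 <= u -> `|h'' u| <= C / u ^+ 2.

Let C0 : 0 <= C.
Proof. by have := h''_le (lexx 1); rewrite expr1n divr1; exact: le_trans. Qed.

Let cont_inv_sqr (u : R) : 0 < u -> {for u, continuous (fun u : R => C / u ^+ 2)}.
Proof.
move=> u0; have u20 : u ^+ 2 != 0 by rewrite expf_neq0// gt_eqF.
have hX := isd_mull C (@isd_inv R (fun u => u ^+ 2) u _ u20 (isd_X 2 (isd_id u))).
exact: (isd_continuous hX).
Qed.

Lemma integral_inv_sqr (a : R) : 0 < a ->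
  (\int[leb]_(u in `[a, +oo[) (C / u ^+ 2)%:E = (C / a)%:E)%E.
Proof.
move=> a0.
have dF (u : R) : a <= u -> is_derive u (1 : R) (fun u => - C * u^-1) (C / u ^+ 2).
  move=> au; have u0 : u != 0 by rewrite gt_eqF// (lt_le_trans a0).
  apply: isd_eq (isd_mull (- C) (isd_inv u0 (isd_id u))) => //=.
  by rewrite mulrNN div1r.
rewrite (@ge0_FTC2y_isd _ _ (fun u => - C * u^-1) a 0).
- by rewrite sub0r mulNr opprK.
- by move=> u au; rewrite divr_ge0// sqr_ge0.
- by move=> u au; apply: cont_inv_sqr; exact: lt_le_trans au.
- rewrite -[X in _ --> X](mulr0 (- C)); apply: cvgM; first exact: cvg_cst.
  apply/gtr0_cvgV0; last exact: cvg_id.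
  by near=> x; near: x; apply: nbhs_pinfty_gt; exact: num_real.
Unshelve. all: by end_near. Qed.

Let G u := saw u * h'' u.

Lemma measurable_trapezoid (a : R) : 1 <= a -> measurable_fun (`[a, +oo[%classic : set R) G.
Proof.
move=> a1; apply: measurable_funM; first exact: measurable_funTS measurable_saw.
apply: subspace_continuous_measurable_fun => //.
apply: continuous_in_subspaceT => u; rewrite inE/= in_itv/= andbT => au.
by apply: ch''; exact: le_trans au.
Qed.

Lemma trapezoid_norm (u : R) : 1 <= u -> `|G u| <= C / u ^+ 2.
Proof.
move=> u1; rewrite /G normrM; have /andP[s0 s1] := saw_bound u.
by rewrite (ger0_norm s0) (le_trans _ (h''_le u1))// ler_piMl.
Qed.

Lemma integrable_trapezoid (a : R) : 1 <= a ->
  leb.-integrable (`[a, +oo[%classic : set R) (EFin \o G) /\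
  `|\int[leb]_(u in `[a, +oo[) G u| <= C / a.
Proof.
move=> a1; have a0 : 0 < a by exact: lt_le_trans a1.
have bd : (\int[leb]_(u in `[a, +oo[) `|(G u)%:E| <= (C / a)%:E)%E.
  rewrite -integral_inv_sqr//; apply: ge0_le_integral => //.
  - by apply: measurableT_comp => //; apply/measurable_EFinP; exact: measurable_trapezoid.
  - apply/measurable_EFinP; apply: subspace_continuous_measurable_fun => //.
    apply: continuous_in_subspaceT => u; rewrite inE/= in_itv/= andbT => au.
    by apply: cont_inv_sqr; exact: lt_le_trans au.
  - move=> u; rewrite /= in_itv/= andbT => au; rewrite lee_fin trapezoid_norm//.
    exact: le_trans au.
have iG : leb.-integrable (`[a, +oo[%classic : set R) (EFin \o G).
  apply/integrableP; split; first by apply/measurable_EFinP; exact: measurable_trapezoid.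
  exact: le_lt_trans bd (ltry _).
split => //; rewrite -lee_fin (EFin_normr_Rintegral _ iG)//.
apply: le_trans bd; apply: le_abse_integral => //.
by apply/measurable_EFinP; exact: measurable_trapezoid.
Qed.

Lemma trapezoid_sum n :
  \int[leb]_(u in `[1, n.+1%:R]) G u =
  2 * (\sum_(k < n.+1) h k.+1%:R) - h 1 - h n.+1%:R - 2 * (H n.+1%:R - H 1).
Proof.
have iG (a b : R) : 1 <= a -> leb.-integrable (`[a, b]%classic : set R) (EFin \o G).
  move=> a1; apply: integrableS (integrable_trapezoid a1).1 => //.
  by move=> u /=; rewrite !in_itv/= andbT => /andP[].
elim: n => [|n IH].
  rewrite big_ord_recl big_ord0 addr0 set_itv1 Rintegral_set1; ring.
have n1 : 1 <= n.+1%:R :> R by rewrite ler1n.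
have nn : n.+1%:R <= n.+2%:R :> R by rewrite ler_nat.
have := @Rintegral_itvB R G (BLeft 1) (BRight n.+2%:R) n.+1%:R (iG 1 n.+2%:R (lexx 1)).
rewrite !bnd_simp => /(_ n1 nn) /eqP; rewrite subr_eq => /eqP ->.
rewrite IH Rintegral_itv_obnd_cbnd; last first.
  apply: integrableS (iG n.+1%:R n.+2%:R n1) => //.
  by move=> u /=; rewrite !in_itv/= => /andP[/ltW-> ->].
have up (u : R) : n.+1%:R <= u <= n.+2%:R -> 1 <= u.
  by move=> /andP[nu _]; exact: le_trans nu.
rewrite /Rintegral (@trapezoid_interval h h' h'' H n.+1 (fun u uk => dH (up u uk))
  (fun u uk => dh (up u uk)) (fun u uk => dh' (up u uk)) (fun u uk => ch'' (up u uk)))/=.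
by rewrite [in RHS]big_ord_recr/=; ring.
Qed.

(** The error of the trapezoid rule over [1, n + 1] converges, since the second
    derivative of h is O(u^-2). *)
Lemma trapezoid_limit :
  2 * (\sum_(k < n.+1) h k.+1%:R) - h 1 - h n.+1%:R - 2 * (H n.+1%:R - H 1)
    @[n --> \oo] --> \int[leb]_(u in `[1, +oo[) G u.
Proof.
have [i1 _] := integrable_trapezoid (lexx 1).
have tail0 : C / n.+1%:R @[n --> \oo] --> (0 : R).
  rewrite -[X in _ --> X](mulr0 C); apply: cvgM; first exact: cvg_cst.
  exact: cvg_harmonic.
have cI : (fun=> \int[leb]_(u in `[1, +oo[) G u : R) n @[n --> \oo] -->
    \int[leb]_(u in `[1, +oo[) G u by exact: cvg_cst.
apply/cvgrPdist_le => eps eps0; near=> n.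
rewrite -trapezoid_sum.
have n1 : 1 <= n.+1%:R :> R by rewrite ler1n.
rewrite (@Rintegral_itvB R G (BLeft 1) (BInfty _ false) n.+1%:R)//.
have [i2 bd] := integrable_trapezoid n1.
rewrite Rintegral_itv_obnd_cbnd; last first.
  apply: integrableS i2 => //; by move=> u /=; rewrite !in_itv/= !andbT => /ltW.
apply: le_trans bd _; near: n.
have := tail0; move/cvgr_le; apply; exact: eps0.
Unshelve. all: by end_near. Qed.

End trapezoid.

Section stirling.
Context {R : realType}.
Local Notation leb := (@lebesgue_measure R).

Lemma ln_factE n : ln (n.+1`!%:R : R) = \sum_(k < n.+1) ln (k.+1%:R : R).
Proof.
elim: n => [|n IH]; first by rewrite big_ord_recl big_ord0 addr0.
by rewrite big_ord_recr/= -IH factS natrM lnM ?posrE ?ltr0n ?fact_gt0// addrC.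
Qed.

(** The part of T_phi_star that does not involve phi. *)
Definition T0 : R := 2^-1 * \int[leb]_(u in `[1, +oo[) (saw u * (1 / u ^+ 2)).

(** The logarithm of the ratio in Stirling's formula for (n + 1)!; the shift avoids
    ln 0. *)
Definition stirling_seq n : R :=
  ln (n.+1`!%:R) - (n.+1%:R + 2^-1) * ln (n.+1%:R) + n.+1%:R.

Lemma stirling_seq_cvg : stirling_seq n @[n --> \oo] --> 1 - T0.
Proof.
pose H (u : R) := u * ln u - u.
have u0 (u : R) : 1 <= u -> 0 < u by exact: lt_le_trans.
have dH (u : R) : 1 <= u -> is_derive u (1 : R) H (ln u).
  move=> u1; apply: isd_eq (isd_sub (isd_mul (isd_id u) (isd_ln (u0 u u1) (isd_id u))) (isd_id u)) => //=.
  by rewrite mul1r divff ?gt_eqF ?u0//; ring.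
have dh (u : R) : 1 <= u -> is_derive u (1 : R) (@ln R) (u^-1).
  by move=> u1; apply: isd_eq (isd_ln (u0 u u1) (isd_id u)) => //=; rewrite mul1r.
have dh' (u : R) : 1 <= u -> is_derive u (1 : R) (fun u : R => u^-1) (- (1 / u ^+ 2)).
  by move=> u1; apply: isd_inv (isd_id u); rewrite gt_eqF ?u0.
have ch (u : R) : 1 <= u -> {for u, continuous (fun u : R => - (1 / u ^+ 2))}.
  move=> u1; have u20 : u ^+ 2 != 0 by rewrite expf_neq0// gt_eqF ?u0.
  have hX := isd_opp (isd_mull 1 (@isd_inv R (fun u => u ^+ 2) u _ u20 (isd_X 2 (isd_id u)))).
  exact: (isd_continuous hX).
have hle (u : R) : 1 <= u -> `|- (1 / u ^+ 2)| <= 1 / u ^+ 2.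
  by move=> u1; rewrite normrN ger0_norm// divr_ge0// sqr_ge0.
have := trapezoid_limit dH dh dh' ch hle.
have -> : \int[leb]_(u in `[1, +oo[) (saw u * - (1 / u ^+ 2)) = - (2 * T0).
  rewrite /T0 mulrA divff ?mul1r//.
  have [i1 _] := integrable_trapezoid ch hle (lexx 1).
  rewrite -[RHS]mulN1r -RintegralZl//.
    by apply: eq_Rintegral => u _; rewrite mulrN mulN1r.
  have := integrableN i1; apply: eq_integrable => // u _.
  by rewrite /= mulrN opprK.
move=> h.
have : 1 + 2^-1 * (2 * (\sum_(k < n.+1) ln (k.+1%:R : R)) - ln 1 - ln n.+1%:R
    - 2 * (H n.+1%:R - H 1)) @[n --> \oo] --> 1 + 2^-1 * (- (2 * T0)).
  by apply: cvgD; [exact: cvg_cst|apply: cvgM; [exact: cvg_cst|exact: h]].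
rewrite (_ : 1 + 2^-1 * - (2 * T0) = 1 - T0); last by rewrite mulrN mulrA mulVf// mul1r.
apply: cvg_trans; apply: near_eq_cvg; apply: nearW => n /=.
by rewrite /stirling_seq ln_factE /H ln1; field.
Qed.

End stirling.

(** * Wallis integrals and Stirling's constant *)

Section wallis.
Context {R : realType}.
Local Notation leb := (@lebesgue_measure R).
Local Notation I := (`[0, pi / 2]%classic : set R).

Definition wallis n : R := \int[leb]_(x in `[0, pi / 2]) (sin x ^+ n).

Let pi20 : 0 < pi / 2 :> R.
Proof. by rewrite divr_gt0// pi_gt0. Qed.

Let dsin (x : R) : is_derive x (1 : R) (@sin R) (cos x).
Proof. exact: is_derive_sin. Qed.

Let dcos (x : R) : is_derive x (1 : R) (@cos R) (- sin x).
Proof. exact: is_derive_cos. Qed.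

Let integrable_sinX n : leb.-integrable I (EFin \o (fun x => sin x ^+ n)).
Proof.
apply: continuous_compact_integrable; first exact: segment_compact.
by apply: continuous_subspaceT => x; exact: (isd_continuous (isd_X n (dsin x))).
Qed.

Lemma wallis0 : wallis 0 = pi / 2.
Proof.
rewrite /wallis; under eq_Rintegral do rewrite expr0.
rewrite Rintegral_cst//= mul1r lebesgue_measure_itv/= lte_fin pi20.
by rewrite -EFinD/= subr0.
Qed.

Lemma wallis1 : wallis 1 = 1.
Proof.
have dc (x : R) : is_derive x (1 : R) (fun x => - cos x) (sin x ^+ 1).
  by apply: isd_eq (isd_opp (dcos x)) => //=; rewrite opprK.
rewrite /wallis /Rintegral (@continuous_FTC2_isd _ _ (fun x => - cos x)).
- by rewrite cos_pihalf cos0/= oppr0 opprK add0r.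
- exact: pi20.
- by apply: continuous_subspaceT => x; exact: (isd_continuous (isd_X 1 (dsin x))).
Qed.

Lemma wallisSS n : n.+2%:R * wallis n.+2 = n.+1%:R * wallis n.
Proof.
pose F (x : R) := - cos x * sin x ^+ n.+1.
have dF (x : R) : is_derive x (1 : R) F (n.+2%:R * sin x ^+ n.+2 - n.+1%:R * sin x ^+ n).
  apply: isd_eq (isd_mul (isd_opp (dcos x)) (isd_X n.+1 (dsin x))) => //=.
  rewrite -(natr1 n.+1) !exprS; have h := cos2Dsin2 x.
  have -> : - cos x * (n.+1%:R * sin x ^+ n * cos x) = - (n.+1%:R * sin x ^+ n * (cos x ^+ 2)).
    ring.
  by rewrite (_ : cos x ^+ 2 = 1 - sin x ^+ 2); [ring|apply/eqP; rewrite eq_sym subr_eq eq_sym h].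
have cF (x : R) := isd_continuous (isd_sub (isd_mull n.+2%:R (isd_X n.+2 (dsin x)))
  (isd_mull n.+1%:R (isd_X n (dsin x)))).
have : \int[leb]_(x in `[0, pi / 2]) (n.+2%:R * sin x ^+ n.+2 - n.+1%:R * sin x ^+ n) = 0.
  rewrite /Rintegral (@continuous_FTC2_isd _ _ F)//.
  - by rewrite /F cos_pihalf sin0 expr0n/= oppr0 mul0r mulr0 subrr.
  - by apply: continuous_subspaceT => x; exact: cF.
rewrite RintegralB//; last 2 first.
- by apply: eq_integrable (integrableZl _ n.+2%:R (integrable_sinX n.+2)).
- by apply: eq_integrable (integrableZl _ n.+1%:R (integrable_sinX n)).
by rewrite !RintegralZl// => /eqP; rewrite subr_eq0 => /eqP.
Qed.

Lemma wallis_decr n : wallis n.+1 <= wallis n.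
Proof.
apply: le_Rintegral => // x; rewrite /= in_itv/= => /andP[x0 xpi].
have s0 : 0 <= sin x.
  by apply: sin_ge0_pi; rewrite x0/= (le_trans xpi)// ler_pdivrMr// ler_peMr ?pi_ge0// ler1n.
by rewrite exprS ler_piMl ?exprn_ge0// sin_le1.
Qed.

Lemma wallis_mul n : n.+1%:R * (wallis n * wallis n.+1) = pi / 2.
Proof.
elim: n => [|n IH]; first by rewrite wallis0 wallis1 mulr1 mul1r.
by rewrite mulrCA wallisSS -IH; ring.
Qed.

Lemma wallis_gt0 n : 0 < wallis n.
Proof.
have [//|h0] := ltP 0 (wallis n).
have h1 : wallis n.+1 <= 0 by exact: le_trans (wallis_decr n) h0.
have h2 : wallis n <= 0 by [].
have := wallis_mul n.
case: (n) h1 h0 {h2} => [|m] h1 h0; first by move: h0; rewrite wallis0 leNgt pi20.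
have h3 := wallis_mul m; have h4 := wallis_mul m.+1.
have : 0 < m.+1%:R * (wallis m * wallis m.+1) by rewrite h3.
rewrite pmulr_rgt0 ?ltr0n// => h5.
have h6 : 0 <= wallis m.
  apply: Rintegral_ge0 => x; rewrite /= in_itv/= => /andP[x0 xpi].
  rewrite exprn_ge0// sin_ge0_pi// x0/= (le_trans xpi)//.
  by rewrite ler_pdivrMr// ler_peMr ?pi_ge0// ler1n.
by move: h5; rewrite ltNge mulr_ge0_le0.
Qed.

Lemma wallis_fact n : wallis n.*2 * (4 ^+ n * n`!%:R ^+ 2) = pi / 2 * n.*2`!%:R.
Proof.
elim: n => [|n IH]; first by rewrite wallis0 !expr0 expr1n !mulr1.
rewrite doubleS !factS !natrM.
have -> : pi / 2 * (n.*2.+2%:R * (n.*2.+1%:R * n.*2`!%:R)) =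
   n.*2.+2%:R * n.*2.+1%:R * (pi / 2 * n.*2`!%:R) :> R by ring.
rewrite -IH; have h := wallisSS n.*2.
have -> : n.*2.+2%:R = 2 * n.+1%:R :> R by rewrite -natrM mul2n doubleS.
have -> : 2 * n.+1%:R * n.*2.+1%:R * (wallis n.*2 * (4 ^+ n * n`!%:R ^+ 2)) =
   2 * n.+1%:R * (n.*2.+1%:R * wallis n.*2) * (4 ^+ n * n`!%:R ^+ 2) by ring.
rewrite -h (_ : n.*2.+2%:R = 2 * n.+1%:R :> R); last by rewrite -natrM mul2n doubleS.
rewrite exprS; ring.
Qed.

(** The Wallis integrals decrease and n.+1 * (wallis n * wallis n.+1) is constant, so
    the square of wallis n is trapped. *)
Lemma wallis_bounds n : pi / 2 <= n.*2.+1%:R * wallis n.*2 ^+ 2 <= n.*2.+2%:R / n.*2.+1%:R * (pi / 2).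
Proof.
have w0 := wallis_gt0 n.*2; rewrite -(wallis_mul n.*2); apply/andP; split.
  by rewrite ler_pM2l ?ltr0n// expr2 ler_pM2l// wallis_decr.
have h := wallisSS n.*2; have h2 := wallis_decr n.*2.+1.
have n2 : 0 < n.*2.+2%:R :> R by rewrite ltr0n.
have n1 : 0 < n.*2.+1%:R :> R by rewrite ltr0n.
have -> : n.*2.+2%:R / n.*2.+1%:R * (n.*2.+1%:R * (wallis n.*2 * wallis n.*2.+1)) =
    n.*2.+2%:R * (wallis n.*2.+1 * wallis n.*2).
  by field; rewrite addrC natr1 gt_eqF.
by rewrite expr2 mulrA -h -mulrA ler_pM2l// ler_pM2r.
Qed.

Lemma ln_wallis_cvg :
  ln ((n.+1).*2.+1%:R * wallis (n.+1).*2 ^+ 2) @[n --> \oo] --> (ln (pi / 2) : R).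
Proof.
have pos n : 0 < n.*2.+1%:R * wallis n.*2 ^+ 2 :> R.
  by rewrite mulr_gt0// exprn_gt0// wallis_gt0.
apply: (@squeeze_cvgr _ _ _ _ (fun=> ln (pi / 2))
  (fun n => ln (1 + n.+1%:R^-1) + ln (pi / 2))).
- apply: nearW => n; have /andP[h1 h2] := wallis_bounds n.+1.
  rewrite ler_ln ?posrE// h1/= -lnM ?posrE ?addr_gt0 ?invr_gt0 ?ltr0n//.
  have b0 : 0 < (1 + n.+1%:R^-1) * (pi / 2) :> R.
    by rewrite (mulr_gt0 _ pi20)// addr_gt0// invr_gt0 ltr0n.
  rewrite (ler_ln (pos n.+1) b0).
  apply: (le_trans h2); rewrite ler_pM2r//.
  rewrite ler_pdivrMr ?ltr0n// mulrDl mul1r -[X in X%:R <= _]addn1 natrD lerD2l.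
  rewrite mulrC ler_pdivlMr ?ltr0n// mul1r ler_nat.
  by rewrite ltnS (leq_trans (leqnSn n))// -addnn leq_addr.
- exact: cvg_cst.
- rewrite -[X in _ --> X]add0r; apply: cvgD; last exact: cvg_cst.
  rewrite -(ln1 R); apply: continuous_cvg; first exact: continuous_ln.
  rewrite -[X in _ --> X]addr0; apply: cvgD; first exact: cvg_cst.
  exact: cvg_harmonic.
Qed.

(** The closed form of wallis in terms of factorials turns Stirling's limit into a
    linear equation for T0. *)
Lemma T0E : T0 = 1 - 2^-1 * ln (2 * pi) :> R.
Proof.
have s1 := @stirling_seq_cvg R.
have s2 : stirling_seq (n.+1).*2.-1 @[n --> \oo] --> (1 - T0 : R).
  have : ((n.+1).*2.-1)%N @[n --> \oo] --> \oo.
    apply/cvgnyPge => A; near=> n; rewrite doubleS/= -addnn.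
    apply: leq_trans (leqW (leq_addr _ _)); near: n; exact: nbhs_infty_ge.
  by move=> h; exact: cvg_comp h s1.
have id n : ln ((n.+1).*2.+1%:R * wallis (n.+1).*2 ^+ 2) =
  2 * ln (pi / 2) + 2 * stirling_seq (n.+1).*2.-1 - 4 * stirling_seq n + ln 2
   + ln (2 + n.+1%:R^-1) :> R.
  have n0 : 0 < n.+1%:R :> R by rewrite ltr0n.
  have lw : ln (wallis (n.+1).*2) = ln (pi / 2) + ln ((n.+1).*2`!%:R)
     - n.+1%:R * (2 * ln 2) - 2 * ln (n.+1`!%:R) :> R.
    have f0 m : 0 < m`!%:R :> R by rewrite ltr0n fact_gt0.
    have l4 : ln (4 ^+ n.+1) = n.+1%:R * (2 * ln 2) :> R.
      rewrite (_ : 4 = 2 ^+ 2); last by rewrite expr2 -natrM.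
      by rewrite -exprM lnXn// -[ln 2 *+ _]mulr_natl natrM; ring.
    have l5 : ln (n.+1`!%:R ^+ 2) = 2 * ln (n.+1`!%:R) :> R.
      by rewrite lnXn// -[ln _ *+ _]mulr_natl.
    have /(congr1 (@ln R)) := wallis_fact n.+1.
    have p4 : 0 < 4 ^+ n.+1 :> R by rewrite exprn_gt0.
    rewrite (lnM (wallis_gt0 _) (mulr_gt0 p4 (exprn_gt0 2 (f0 n.+1)))).
    rewrite (lnM p4 (exprn_gt0 2 (f0 n.+1))) l4 l5 (lnM pi20 (f0 _)) => h.
    by lra.
  have l2 : ln ((n.+1).*2%:R) = ln 2 + ln n.+1%:R :> R.
    by rewrite -mul2n natrM lnM ?posrE// ltr0n.
  have l3 : ln ((n.+1).*2.+1%:R) = ln (2 + n.+1%:R^-1) + ln n.+1%:R :> R.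
    rewrite -lnM ?posrE ?addr_gt0 ?invr_gt0//; congr ln.
    by rewrite mulrDl mulVf ?gt_eqF// -natrM mul2n natr1.
  rewrite lnM ?posrE ?exprn_gt0 ?wallis_gt0 ?ltr0n// lnXn ?wallis_gt0//.
  rewrite -[ln _ *+ _]mulr_natl.
  rewrite /stirling_seq prednK ?double_gt0// l2 l3 lw.
  have e2 : (n.+1).*2%:R = 2 * n.+1%:R :> R by rewrite -natrM mul2n.
  by rewrite e2; field.
have := ln_wallis_cvg; under eq_cvg do rewrite id.
move=> h.
have h' : 2 * ln (pi / 2) + 2 * stirling_seq (n.+1).*2.-1 - 4 * stirling_seq n + ln 2
   + ln (2 + n.+1%:R^-1) @[n --> \oo] --> 
   (2 * ln (pi / 2) + 2 * (1 - T0) - 4 * (1 - T0) + ln 2 + ln (2 + 0) : R).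
  apply: cvgD; last first.
    apply: continuous_cvg; first by apply: continuous_ln; rewrite addr0.
    by apply: cvgD; [exact: cvg_cst|exact: cvg_harmonic].
  apply: cvgD; last exact: cvg_cst.
  apply: cvgB; last by apply: cvgM; [exact: cvg_cst|exact: s1].
  by apply: cvgD; [exact: cvg_cst|apply: cvgM; [exact: cvg_cst|exact: s2]].
have := cvg_lim (@norm_hausdorff _ R) h'; rewrite (cvg_lim (@norm_hausdorff _ R) h) addr0 => /(_ _).
rewrite lnM ?posrE ?pi_gt0 ?invr_gt0// lnV ?posrE// => e.
rewrite lnM ?posrE ?pi_gt0//; lra.
Unshelve. all: by end_near. Qed.

End wallis.

(** * Derivatives of the Laplace exponent *)

Section levy_powers.
Context {R : realType}.
Variable mu : {finite_measure set (measurableTypeR R) -> \bar R}.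
Local Notation D := (`]0, +oo[%classic : set R).
Local Notation leb := (@lebesgue_measure R).

Let mD : measurable (D : set (measurableTypeR R)). Proof. exact: measurable_itv. Qed.

(** Up to the sign (-1)^k, the k-th derivative of psi; so psik 1 and - psik 2 are the
    first two derivatives of phi. *)
Definition psik (k : nat) (u : R) : R := \int[mu]_(v in D) (v ^+ k * expR (- (u * v))).

Lemma psik_bound k (u v : R) : 0 < u -> 0 < v ->
  `|v ^+ k * expR (- (u * v))| <= k`!%:R / u ^+ k.
Proof.
move=> u0 v0; rewrite ger0_norm ?mulr_ge0 ?exprn_ge0 ?expR_ge0 ?(ltW v0)//.
by rewrite expRN ler_pdivrMr ?expR_gt0//; exact: pow_le_exp.
Qed.

Lemma measurable_psik k (u : R) (E : set R) :
  measurable_fun E (fun v : R => v ^+ k * expR (- (u * v))).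
Proof.
apply: measurable_funTS.
by apply: measurable_funM; [exact: measurable_funX|exact: measurable_expRNr].
Qed.

Lemma integrable_psik k (u : R) : 0 < u ->
  mu.-integrable D (EFin \o (fun v => v ^+ k * expR (- (u * v)))).
Proof.
move=> u0; apply: levy_integrable; first exact: measurable_psik.
by move=> v v0; exact: psik_bound.
Qed.

Lemma psik_fin k (u : R) : 0 < u ->
  (psik k u)%:E = (\int[mu]_(v in D) (v ^+ k * expR (- (u * v)))%:E)%E.
Proof.
by move=> u0; rewrite fineK//; apply: integrable_fin_num => //; exact: integrable_psik.
Qed.

Lemma psik_ge0 k u : 0 <= psik k u.
Proof.
apply: Rintegral_ge0 => v; rewrite /= in_itv/= andbT => v0.
by rewrite mulr_ge0 ?expR_ge0// exprn_ge0// ltW.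
Qed.

Lemma psik_le k u : 0 < u -> psik k u <= k`!%:R / u ^+ k * levy_mass mu.
Proof.
move=> u0; apply: le_trans (ler_norm _) _; apply: le_levy_integral.
  exact: measurable_psik.
by move=> v v0; exact: psik_bound.
Qed.

Lemma psik0 u : psik 0 u = psi mu u.
Proof. by apply: eq_Rintegral => v _; rewrite expr0 mul1r. Qed.

Lemma isd_psik k (u : R) : 0 < u -> is_derive u (1 : R) (psik k) (- psik k.+1 u).
Proof.
move=> u0; pose g (y v : R) := v ^+ k * expR (- (y * v)).
have dg (y v : R) : is_derive y (1 : R) (g^~ v) (- (v ^+ k.+1 * expR (- (y * v)))).
  have d1 : is_derive y (1 : R) (fun y => y * v) v.
    by apply: isd_eq (isd_mull v (isd_id y)) => [z|]; rewrite ?mulr1// mulrC.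
  apply: (isd_eq _ _ (isd_mull (v ^+ k) (isd_expR (isd_opp d1)))) => //=.
  by rewrite exprS; ring.
have u20 : 0 < u / 2 by rewrite divr_gt0.
have I0 y : `]u / 2, 2 * u[%classic y -> 0 < y.
  by rewrite /= in_itv/= => /andP[xy _]; exact: lt_trans xy.
have Ia : `]u / 2, 2 * u[%classic u.
  by rewrite /= in_itv/= ltr_pdivrMr// ltr_pMr// mulrC ltr_pMr// ltr1n.
have intg y : `]u / 2, 2 * u[%classic y -> mu.-integrable D (EFin \o g y).
  by move=> /I0 y0; exact: integrable_psik.
have derg y v : `]u / 2, 2 * u[%classic y -> D v -> derivable (g^~ v) y 1.
  by move=> _ _; exact: isd_derivable (dg y v).
pose G (v : R) := k.+1`!%:R / (u / 2) ^+ k.+1.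
have G0 v : 0 <= G v by rewrite divr_ge0// exprn_ge0// ltW.
have iG : mu.-integrable D (EFin \o G) by exact: integrable_levy_cst.
have Gub y v : `]u / 2, 2 * u[%classic y -> D v -> `|partial1of2 g y v| <= G v.
  move=> Iy; have y0 := I0 y Iy; rewrite /= in_itv/= andbT => v0.
  rewrite /partial1of2 (isd_derive1 (dg y v)) normrN.
  apply: le_trans (psik_bound k.+1 y0 v0) _.
  rewrite /G ler_wpM2l// lef_pV2 ?posrE ?exprn_gt0//.
  have xy : u / 2 <= y by move: Iy; rewrite /= in_itv/= => /andP[/ltW].
  by rewrite lerXn2r ?nnegrE// ltW.
have h1 := derivable_under_integral mD Ia intg derg G0 iG Gub.
have h2 := differentiation_under_integral mD Ia intg derg G0 iG Gub.
apply: isd_eq (derivable_isd h1) => //.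
rewrite [LHS]h2 /psik -[RHS]mulN1r -RintegralZl//; last exact: integrable_psik.
apply: eq_Rintegral => v _.
by rewrite /partial1of2 (isd_derive1 (dg u v)) mulN1r.
Qed.

Variable q : R.
Local Notation c := (q + levy_mass mu).

Lemma isd_phi (u : R) : 0 < u -> is_derive u (1 : R) (phi mu q) (psik 1 u).
Proof.
move=> u0; have := isd_sub (isd_cst u c) (isd_psik 0 u0); rewrite sub0r opprK.
apply: isd_near; near=> y.
have y0 : 0 < y by near: y; exact: lt_nbhsr.
by rewrite psik0 phi_psi// ltW.
Unshelve. all: by end_near. Qed.

Lemma derive1_phi (u : R) : 0 < u -> derive1 (phi mu q) u = psik 1 u.
Proof. by move=> u0; exact: isd_derive1 (isd_phi u0). Qed.

Lemma derive2_phi (u : R) : 0 < u -> derive1n 2 (phi mu q) u = - psik 2 u.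
Proof.
move=> u0; rewrite derive1nS; apply: isd_derive1.
apply: isd_near (isd_psik 1 u0); near=> y.
have y0 : 0 < y by near: y; exact: lt_nbhsr.
by rewrite derive1n1 derive1_phi.
Unshelve. all: by end_near. Qed.

Lemma phi_le_mono u w : 0 <= u -> u <= w -> phi mu q u <= phi mu q w.
Proof.
move=> u0 uw; rewrite !phi_psi ?(le_trans u0 uw)//.
by rewrite lerB// psi_le.
Qed.

(** Small jumps are light enough for u |-> u * psi u to vanish at infinity and for
    phi' * phi_star to be integrable. *)
Definition light_small_jumps : Prop := (\int[mu]_(v in `]0%R, 1%R]) (v^-1)%:E < +oo)%E.

Hypothesis inv_lty : light_small_jumps.

(** Away from 0 the function v^-1 is bounded, and mu is finite. *)
Lemma integrable_inv : mu.-integrable D (EFin \o (fun v => v^-1)).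
Proof.
have mV (E : set R) : E `<=` D -> measurable (E : set (measurableTypeR R)) ->
    measurable_fun E (fun v : R => v^-1).
  move=> ED measurability_ebool; apply: (@measurable_funS _ _ _ _ D) => //.
  apply: subspace_continuous_measurable_fun => //.
  apply: continuous_in_subspaceT => v; rewrite inE/= in_itv/= andbT => v0.
  by apply: inv_continuous; rewrite gt_eqF.
have := inv_lty; rewrite /light_small_jumps => inv_fin.
apply/integrableP; split; first by apply/measurable_EFinP; exact: mV.
have -> : D = `]0, 1]%classic `|` `]1, +oo[%classic.
  by rewrite -itv_bndbnd_setU// bnd_simp.
have s1 : (`]0, 1]%classic : set R) `<=` D.
  by move=> v /=; rewrite !in_itv/= andbT => /andP[].
have s2 : (`]1, +oo[%classic : set R) `<=` D.
  by move=> v /=; rewrite !in_itv/= !andbT; exact: lt_trans.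
rewrite ge0_integral_setU//; last 2 first.
- apply: measurableT_comp => //; apply/measurable_EFinP; apply: mV.
    by move=> v [/s1|/s2].
  exact: measurableU.
- by apply/disj_setPS => v /= []; rewrite !in_itv/= andbT => /andP[_ v1]; rewrite ltNge v1.
apply: lte_add_pinfty.
  rewrite [X in (X < _)%E](_ : _ = (\int[mu]_(v in `]0%R, 1%R]) (v^-1)%:E)%E)//.
  apply: eq_integral => v; rewrite inE/= in_itv/= => /andP[v0 _].
  by rewrite ger0_norm// invr_ge0 ltW.
apply: (@le_lt_trans _ _ (\int[mu]_(v in `]1%R, +oo[) 1%:E)%E).
  apply: ge0_le_integral => //.
  - by apply: measurableT_comp => //; apply/measurable_EFinP; exact: mV.
  - move=> v; rewrite /= in_itv/= andbT => v1; have v0 : 0 < v by exact: lt_trans v1.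
    by rewrite lee_fin ger0_norm ?invr_ge0 ?(ltW v0)// invf_le1// ltW.
by rewrite integral_cst// mul1e ltey_eq fin_num_measure.
Qed.

Lemma mul_psi_cvg0 : u * psi mu u @[u --> +oo] --> (0 : R).
Proof.
have : \int[mu]_(v in D) (u * expR (- (u * v))) @[u --> +oo] --> (0 : R).
  apply: (levy_dominated_by (A := 0) integrable_inv).
  - by move=> u _; apply: measurable_funM => //; exact: measurable_expRNr.
  - move=> u v u0 v0; rewrite ger0_norm ?mulr_ge0 ?expR_ge0//.
    rewrite expRN ler_pdivrMr ?expR_gt0// mulrC ler_pdivlMr//.
    by apply: le_trans (expR_ge1Dx _); rewrite lerDr.
  - move=> v v0; have := cvg_pow_expRN 1 v0.
    by under eq_cvg do rewrite expr1 (mulrC v).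
apply: cvg_trans; apply: near_eq_cvg; near=> u.
have u0 : 0 <= u by near: u; apply: nbhs_pinfty_ge; exact: num_real.
by rewrite /psi RintegralZl//; exact: integrable_psi.
Unshelve. all: by end_near. Qed.

Lemma integral_mul_expRN (v x : R) : 0 < v -> 0 < x ->
  (\int[leb]_(u in `[x, +oo[) (u * (v ^+ 1 * expR (- (u * v))))%:E =
   ((x + v^-1) * expR (- (x * v)))%:E)%E.
Proof.
move=> v0 x0; pose F (u : R) := - ((u + v^-1) * expR (- (v * u))).
have dF (u : R) : is_derive u (1 : R) F (u * (v ^+ 1 * expR (- (u * v)))).
  apply: isd_eq (isd_opp (isd_mul (isd_add (isd_id u) (isd_cst u v^-1)) (isd_expRN v u))) => //=.
  by rewrite expr1 (mulrC u v); field; rewrite gt_eqF.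
have dg (u : R) := isd_mul (isd_id u) (isd_mull v (isd_expRN v u)).
have cg (u : R) : {for u, continuous (fun u : R => u * (v ^+ 1 * expR (- (u * v))))}.
  have -> : (fun u : R => u * (v ^+ 1 * expR (- (u * v)))) = (fun u : R => u * (v * expR (- (v * u)))).
    by apply/funext => y; rewrite expr1 (mulrC v y).
  exact: (isd_continuous (dg u)).
rewrite (@ge0_FTC2y_isd _ _ F x 0).
- by rewrite /F sub0r opprK (mulrC v).
- by move=> u xu; rewrite !mulr_ge0 ?expR_ge0 ?exprn_ge0 ?(ltW v0)// ltW// (lt_le_trans x0).
- by move=> u xu; exact: cg.
- rewrite /F -oppr0; apply: cvgN; rewrite -[X in _ --> X]addr0.
  have e1 := cvg_pow_expRN 1 v0.
  have e2 : v^-1 * expR (- (v * u)) @[u --> +oo] --> (0 : R).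
    by rewrite -[X in _ --> X](mulr0 v^-1); apply: cvgM; [exact: cvg_cst|exact: cvgy_expRN].
  rewrite (_ : (fun x : R => _) =
    (fun x : R => x ^+ 1 * expR (- (v * x)) + v^-1 * expR (- (v * x)))); first exact: cvgD e1 e2.
  by apply/funext => y; rewrite expr1 mulrDl.
Qed.

(** Tonelli's theorem reduces the tail integral of u psik 1 u to one explicit
    exponential integral for every jump size v. *)
Lemma integral_mul_psi1 (x : R) : 0 < x ->
  (\int[leb]_(u in `[x, +oo[) (u * psik 1 u)%:E =
   \int[mu]_(v in D) ((x + v^-1) * expR (- (x * v)))%:E)%E.
Proof.
move=> x0; pose g (u v : R) := (u * (v ^+ 1 * expR (- (u * v))))%:E.
transitivity (\int[leb]_(u in `[x, +oo[) \int[mu]_(v in D) g u v)%E.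
  apply: eq_integral => u; rewrite inE/= in_itv/= andbT => xu.
  have u0 : 0 < u by exact: lt_le_trans xu.
  by rewrite EFinM psik_fin// -integralZl//; exact: integrable_psik.
rewrite (@tonelli_on _ leb mu)//; last 2 first.
- apply: measurable_funTS; apply/measurable_EFinP.
  apply: measurable_funM => //; apply: measurable_funM; first exact: measurable_funX.
  apply: measurableT_comp => //; apply: measurableT_comp => //.
  exact: measurable_funM.
- move=> u v; rewrite /= !in_itv/= !andbT => xu v0; rewrite /g lee_fin.
  by rewrite !mulr_ge0 ?expR_ge0 ?exprn_ge0 ?(ltW v0)// ltW// (lt_le_trans x0).
apply: eq_integral => v; rewrite inE/= in_itv/= andbT => v0.
exact: integral_mul_expRN.
Qed.

Lemma mul_psi1_dominated (x v : R) : 0 < x -> 0 < v ->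
  `|(x + v^-1) * expR (- (x * v))| <= 2 * v^-1.
Proof.
move=> x0 v0; have k0 : 0 <= x + v^-1 by rewrite addr_ge0 ?invr_ge0 ?(ltW x0) ?(ltW v0).
rewrite ger0_norm ?mulr_ge0 ?expR_ge0// mulrDl (mulrDl 1 1) mul1r lerD//.
  rewrite expRN ler_pdivrMr ?expR_gt0// mulrC ler_pdivlMr//.
  by apply: le_trans (expR_ge1Dx _); rewrite lerDr.
by rewrite ler_piMr ?invr_ge0 ?(ltW v0)// expRN_le1// ltW.
Qed.

Lemma measurable_tail_kernel (x : R) : measurable_fun D (fun v : R => (x + v^-1) * expR (- (x * v))).
Proof.
apply: measurable_funM; last exact: measurable_expRNr.
apply: measurable_funD => //; apply/measurable_EFinP.
exact: measurable_int integrable_inv.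
Qed.

Let integrable_tail_kernel (x : R) : 0 < x ->
  mu.-integrable D (EFin \o (fun v => (x + v^-1) * expR (- (x * v)))).
Proof.
move=> x0; apply: (@le_integrable _ _ _ mu D mD _ (EFin \o (fun v => 2 * v^-1))).
- by apply/measurable_EFinP; exact: measurable_tail_kernel.
- move=> v; rewrite /= in_itv/= andbT => v0; rewrite lee_fin.
  by rewrite (le_trans (mul_psi1_dominated x0 v0))// ler_norm.
- by have := integrableZl mD 2 integrable_inv.
Qed.

Lemma mul_psi1_tail_fin (x : R) : 0 < x ->
  (\int[leb]_(u in `[x, +oo[) (u * psik 1 u)%:E =
   (\int[mu]_(v in D) ((x + v^-1) * expR (- (x * v))))%:E)%E.
Proof.
move=> x0; rewrite integral_mul_psi1// fineK//.
by apply: integrable_fin_num => //; exact: integrable_tail_kernel.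
Qed.

Lemma tail_kernel_cvg0 :
  \int[mu]_(v in D) ((x + v^-1) * expR (- (x * v))) @[x --> +oo] --> (0 : R).
Proof.
have i2 : mu.-integrable D (EFin \o (fun v => 2 * v^-1)).
  by have := integrableZl mD 2 integrable_inv.
apply: (levy_dominated_by (A := 1) i2).
- by move=> x _; exact: measurable_tail_kernel.
- by move=> x v x1 v0; apply: mul_psi1_dominated => //; exact: lt_le_trans x1.
- move=> v v0; have e1 := cvg_pow_expRN 1 v0.
  have e2 : v^-1 * expR (- (v * u)) @[u --> +oo] --> (0 : R).
    by rewrite -[X in _ --> X](mulr0 v^-1); apply: cvgM; [exact: cvg_cst|exact: cvgy_expRN].
  rewrite -(addr0 (0 : R)) (_ : (fun x : R => _) =
    (fun x : R => x ^+ 1 * expR (- (v * x)) + v^-1 * expR (- (v * x)))); first exact: cvgD e1 e2.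
  by apply/funext => x; rewrite expr1 (mulrC v x) mulrDl.
Qed.

End levy_powers.

(** * The jump term of the constant *)

Section phi_star_inverse.
Context {R : realType}.
Variable mu : {finite_measure set (measurableTypeR R) -> \bar R}.
Variable q : R.
Hypothesis q_ge0 : 0 <= q.
Hypothesis phi_pos : forall u : R, 0 < u -> 0 < phi mu q u.
Local Notation D := (`]0, +oo[%classic : set R).
Local Notation leb := (@lebesgue_measure R).
Local Notation c := (q + levy_mass mu).
Local Notation ph := (phi mu q).
Local Notation ps := (phi_star mu q).
Local Notation vps := (varphi_star mu q).

Let mD : measurable (D : set (measurableTypeR R)). Proof. exact: measurable_itv. Qed.
Let c0 : 0 < c. Proof. exact: phi_limit_gt0. Qed.

Lemma phi_star_gap_gt0 (u w v : R) : 0 < u -> u < w -> 0 < v ->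
  0 < w * (1 - expR (- (u * v))) - u * (1 - expR (- (w * v))).
Proof.
move=> u0 uw v0; have w0 : 0 < w by exact: lt_trans uw.
pose K (v : R) := w * (1 - expR (- (u * v))) - u * (1 - expR (- (w * v))).
have dK (x : R) : 0 <= x <= v ->
    is_derive x (1 : R) K (w * u * (expR (- (u * x)) - expR (- (w * x)))).
  move=> _; apply: isd_eq (isd_sub (isd_mull w (isd_sub (isd_cst x 1) (isd_expRN u x)))
    (isd_mull u (isd_sub (isd_cst x 1) (isd_expRN w x)))) => //=; ring.
have [z /andP[z0 zv]] := MVT_isd v0 dK.
have -> : K 0 = 0 by rewrite /K !mulr0 oppr0 expR0 subrr !mulr0 subrr.
rewrite !subr0 -/(K v) => ->.
rewrite !mulr_gt0// subr_gt0 ltr_expR ltrN2 ltr_pM2r//.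
Qed.

(** The difference w phi(u) - u phi(w) is (w - u) q plus the integral of a function
    of the jump size which is positive by convexity of the exponential. *)
Lemma phi_star_mono (u w : R) : 0 < u -> u < w -> ps u < ps w.
Proof.
move=> u0 uw; have w0 : 0 < w by exact: lt_trans uw.
rewrite /phi_star ltr_pdivrMr ?phi_pos// mulrAC ltr_pdivlMr ?phi_pos//.
have ib (x : R) : 0 < x -> mu.-integrable D (EFin \o (fun v => 1 - expR (- (x * v)))).
  move=> x0; have := integrableB mD (integrable_levy_cst mu 1) (integrable_psi mu (ltW x0)).
  by [].
have ik (a x : R) : 0 < x -> mu.-integrable D (EFin \o (fun v => a * (1 - expR (- (x * v))))).
  by move=> x0; have := integrableZl mD a (ib x x0).
pose k (v : R) := w * (1 - expR (- (u * v))) - u * (1 - expR (- (w * v))).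
have E : w * ph u - u * ph w = (w - u) * q + \int[mu]_(v in D) k v.
  rewrite /k RintegralB//; [|exact: ik|exact: ik].
  by rewrite !RintegralZl//; [rewrite /phi; ring|exact: ib|exact: ib].
rewrite -subr_gt0 E.
have k0 v : 0 < v -> 0 < k v by exact: phi_star_gap_gt0.
have kM v : 0 < v -> `|k v| <= w.
  move=> v0; rewrite gtr0_norm ?k0// /k lerBlDr (@le_trans _ _ w)//.
    by rewrite ler_piMr ?(ltW w0)// lerBlDr lerDl expR_ge0.
  by rewrite lerDl mulr_ge0 ?(ltW u0)// subr_ge0 expRN_le1// ltW.
have mk : measurable_fun D k.
  by apply: measurable_funB; apply: measurable_funM => //;
    apply: measurable_funB => //; exact: measurable_expRNr.
have [q0|q0] := ltP 0 q.
  rewrite ltr_pwDl ?mulr_gt0 ?subr_gt0//.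
  by apply: Rintegral_ge0 => v; rewrite /= in_itv/= andbT => /k0/ltW.
have q00 : q = 0 by apply/eqP; rewrite eq_le q0.
rewrite q00 mulr0 add0r; apply: (levy_integral_gt0 mk kM k0).
by move: c0; rewrite q00 add0r.
Qed.

Lemma phi_star_le (u w : R) : 0 < u -> u <= w -> ps u <= ps w.
Proof.
by move=> u0; rewrite le_eqVlt => /predU1P[->//|uw]; rewrite ltW// phi_star_mono.
Qed.

Lemma phi_star_leE (u w : R) : 0 < u -> 0 < w -> (ps u <= ps w) = (u <= w).
Proof.
move=> u0 w0; have [uw|wu] := leP u w; first by rewrite phi_star_le.
by apply/negbTE; rewrite -ltNge phi_star_mono.
Qed.

Lemma isd_phi_star (u : R) : 0 < u ->
  is_derive u (1 : R) ps (u * - (psik mu 1 u / ph u ^+ 2) + (ph u)^-1 * 1).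
Proof.
move=> u0; have p0 : ph u != 0 by rewrite gt_eqF// phi_pos.
exact: (isd_mul (isd_id u) (isd_inv p0 (isd_phi mu q u0))).
Qed.

Lemma phi_star_surj (y : R) : ps 1 <= y -> exists2 w, 1 <= w & ps w = y.
Proof.
move=> y1; pose b := Num.max 1 (c * y).
have b1 : 1 <= b by rewrite le_max lexx.
have b0 : 0 < b by exact: lt_le_trans b1.
have yb : y <= ps b.
  rewrite /phi_star ler_pdivlMr ?phi_pos//.
  apply: (@le_trans _ _ (c * y)); last by rewrite le_max lexx orbT.
  rewrite mulrC ler_wpM2r ?phi_le_c// ?(ltW b0)//.
  by apply: le_trans y1; rewrite divr_ge0// ltW// phi_pos.
have cps : {within `[1, b], continuous ps}.
  apply: continuous_in_subspaceT => u; rewrite inE/= in_itv/= => /andP[u1 _].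
  exact: isd_continuous (isd_phi_star (lt_le_trans ltr01 u1)).
have yI : Num.min (ps 1) (ps b) <= y <= Num.max (ps 1) (ps b).
  by rewrite ge_min le_max y1 yb orbT.
have [w] := IVT b1 cps yI.
by rewrite in_itv/= => /andP[w1 _] <-; exists w.
Qed.

Lemma varphi_starP (y : R) : ps 1 <= y ->
  1 <= vps y /\ forall u, 1 <= u -> (vps y <= u) = (y <= ps u).
Proof.
move=> /phi_star_surj[w w1 <-].
have w0 : 0 < w by exact: lt_le_trans w1.
have -> : vps (ps w) = w.
  have inj : {in D &, injective ps}; last first.
    by apply: (@pinvKV _ _ (fun=> 0) D ps inj); rewrite inE/= in_itv/= andbT.
  move=> a b; rewrite !inE/= !in_itv/= !andbT => a0 b0 eab.
  by apply/eqP; rewrite eq_le -(phi_star_leE a0 b0) -(phi_star_leE b0 a0) eab lexx.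
by split => // u u1; rewrite phi_star_leE// (lt_le_trans ltr01).
Qed.

(** Writing expR (- (w v)) as the integral of v expR (- (u v)) over u >= w replaces
    the inverse function by the condition y <= phi_star u, under which the integral
    over y is a length. *)
Lemma integral_inverse_kernel (v : R) : 0 < v ->
  (\int[leb]_(y in `[ps 1, +oo[) (expR (- (vps y * v)))%:E =
   \int[leb]_(u in `[1%R, +oo[) ((ps u - ps 1) * (v ^+ 1 * expR (- (u * v))))%:E)%E.
Proof.
move=> v0; pose psm (u : R) := ps (Num.max u 1).
have psmE u : 1 <= u -> psm u = ps u by move=> u1; rewrite /psm max_l.
have mpsm : measurable_fun setT psm.
  apply: nondecreasing_measurable => // a b ab; apply: phi_star_le.
    by rewrite lt_max ltr01 orbT.
  by rewrite ge_max !le_max ab lexx !orbT.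
pose g (y u : R) := (v ^+ 1 * expR (- (u * v)) * (y <= psm u)%R%:R)%:E.
transitivity (\int[leb]_(y in `[ps 1, +oo[) \int[leb]_(u in `[1%R, +oo[) g y u)%E.
  apply: eq_integral => y; rewrite inE/= in_itv/= andbT => y1.
  have [w1 wP] := varphi_starP y1.
  rewrite (@integral_bool _ _ (`[vps y, +oo[%classic : set R)); last first.
    move=> u; rewrite /= !in_itv/= !andbT; split => [[u1]|wu].
      by rewrite psmE// -wP.
    have u1 : 1 <= u by exact: le_trans wu.
    by split => //; rewrite psmE// -wP.
  under eq_integral do rewrite expr1 (mulrC _ v) EFinM.
  rewrite ge0_integralZl_EFin//; last 2 first.
  - by apply/measurable_EFinP; apply: measurable_funTS; exact: measurable_expRN.
  - exact: ltW.
  by rewrite integral_expRN_tail// -EFinM mulrCA divff ?gt_eqF// mulr1 (mulrC v).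
rewrite (@tonelli_on _ leb leb)//; last 2 first.
- apply: measurable_funTS; apply/measurable_EFinP; apply: measurable_funM.
    apply: measurable_funM => //.
    apply: measurableT_comp => //; apply: measurableT_comp => //.
    exact: measurable_funM.
  apply: (measurableT_comp (f := fun b : bool => b%:R : R)) => //.
  apply: measurable_fun_ler => //.
  exact: (measurableT_comp mpsm measurable_snd).
- by move=> y u _ _; rewrite lee_fin !mulr_ge0 ?expR_ge0 ?exprn_ge0// ltW.
apply: eq_integral => u; rewrite inE/= in_itv/= andbT => u1.
rewrite (@integral_bool _ _ (`[ps 1, ps u]%classic : set R) _ (fun=> v ^+ 1 * expR (- (u * v)))); last first.
  by move=> y; rewrite psmE// /= !in_itv/= andbT; split => [[-> ->]|/andP[-> ->]].
have mI : leb (`[ps 1, ps u]%classic : set R) = (ps u - ps 1)%:E.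
  rewrite lebesgue_measure_itv/= lte_fin; case: ltP => // uu.
  by congr EFin; apply/esym/eqP; rewrite subr_eq0 eq_le uu (phi_star_le ltr01 u1).
rewrite integral_cst//; transitivity ((v ^+ 1 * expR (- (u * v)))%:E * (ps u - ps 1)%:E)%E.
  by rewrite -mI.
by rewrite -EFinM mulrC.
Qed.

Lemma integral_jump_kernel :
  (\int[mu]_(v in D) \int[leb]_(y in `[ps 1, +oo[) (expR (- (vps y * v)))%:E =
   \int[leb]_(u in `[1%R, +oo[) ((ps u - ps 1) * psik mu 1 u)%:E)%E.
Proof.
pose psm (u : R) := ps (Num.max u 1).
have psmE u : 1 <= u -> psm u = ps u by move=> u1; rewrite /psm max_l.
have mpsm : measurable_fun setT psm.
  apply: nondecreasing_measurable => // a b ab; apply: phi_star_le.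
    by rewrite lt_max ltr01 orbT.
  by rewrite ge_max !le_max ab lexx !orbT.
pose g (v u : R) := ((psm u - ps 1) * (v ^+ 1 * expR (- (u * v))))%:E.
transitivity (\int[mu]_(v in D) \int[leb]_(u in `[1%R, +oo[) g v u)%E.
  apply: eq_integral => v; rewrite inE/= in_itv/= andbT => v0.
  rewrite (integral_inverse_kernel v0); apply: eq_integral => u.
  by rewrite inE/= in_itv/= andbT => u1; rewrite /g psmE.
rewrite (@tonelli_on _ mu leb)//; last 2 first.
- apply: measurable_funTS; apply/measurable_EFinP; apply: measurable_funM.
    by apply: measurable_funB => //; exact: (measurableT_comp mpsm measurable_snd).
  apply: measurable_funM; first exact: measurable_funX.
  apply: measurableT_comp => //; apply: measurableT_comp => //.
  exact: measurable_funM.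
- move=> v u; rewrite /= !in_itv/= !andbT => v0 u1; rewrite lee_fin.
  rewrite !mulr_ge0 ?expR_ge0 ?exprn_ge0 ?(ltW v0)// subr_ge0 psmE// phi_star_le//.
apply: eq_integral => u; rewrite inE/= in_itv/= andbT => u1.
have u0 : 0 < u by exact: lt_le_trans u1.
rewrite EFinM (psik_fin mu 1 u0) -(integralZl mD (integrable_psik mu 1 u0)).
by apply: eq_integral => v _; rewrite /g psmE.
Qed.

End phi_star_inverse.

(** * Asymptotics of the moments *)

Section moment_asymptotics.
Context {R : realType}.
Variable mu : {finite_measure set (measurableTypeR R) -> \bar R}.
Variable q : R.
Hypothesis q_ge0 : 0 <= q.
Hypothesis phi_pos : forall u : R, 0 < u -> 0 < phi mu q u.
Hypothesis inv_lty : light_small_jumps mu.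
Local Notation D := (`]0, +oo[%classic : set R).
Local Notation leb := (@lebesgue_measure R).
Local Notation c := (q + levy_mass mu).
Local Notation ph := (phi mu q).
Local Notation ps := (phi_star mu q).
Local Notation p := (moment_coef mu q).
Local Notation K := (fun x => \int[mu]_(v in D) ((x + v^-1) * expR (- (x * v)))).

Let c0 : 0 < c. Proof. exact: phi_limit_gt0. Qed.
Let ge1_gt0 (u : R) : 1 <= u -> 0 < u. Proof. exact: lt_le_trans. Qed.

(** This is phi' * phi_star. *)
Let g (u : R) := psik mu 1 u * ps u.

Let isd_iph (u : R) : 0 < u ->
  is_derive u (1 : R) (fun u => (ph u)^-1) (- (psik mu 1 u / ph u ^+ 2)).
Proof.
move=> u0; have p0 : ph u != 0 by rewrite gt_eqF// phi_pos.
exact: (isd_inv p0 (isd_phi mu q u0)).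
Qed.

Let g_ge0 (u : R) : 0 < u -> 0 <= g u.
Proof. by move=> u0; rewrite mulr_ge0 ?psik_ge0// /phi_star divr_ge0// ltW// phi_pos. Qed.

Let g_cont (u : R) : 0 < u -> {for u, continuous g}.
Proof.
move=> u0; exact: (isd_continuous (isd_mul (isd_psik mu 1 u0) (isd_phi_star phi_pos u0))).
Qed.

Let g_le (a u : R) : 0 < a -> a <= u -> g u <= (ph a)^-1 * (u * psik mu 1 u).
Proof.
move=> a0 au; have u0 : 0 < u by exact: lt_le_trans au.
rewrite /g /phi_star mulrC -mulrA mulrCA ler_wpM2r//.
  by rewrite mulr_ge0 ?psik_ge0// ltW.
by rewrite lef_pV2 ?posrE ?phi_pos// phi_le_mono// ltW.
Qed.

Let measurable_g (a : R) : 0 < a -> measurable_fun (`[a, +oo[%classic : set R) g.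
Proof.
move=> a0; apply: subspace_continuous_measurable_fun => //.
apply: continuous_in_subspaceT => u; rewrite inE/= in_itv/= andbT => au.
by apply: g_cont; exact: lt_le_trans au.
Qed.

Let g_tail_le (a x : R) : 0 < a -> a <= x ->
  (\int[leb]_(u in `[x, +oo[) (g u)%:E <= ((ph a)^-1 * K x)%:E)%E.
Proof.
move=> a0 ax; have x0 : 0 < x by exact: lt_le_trans ax.
have mp : measurable_fun (`[x, +oo[%classic : set R) (fun u : R => u * psik mu 1 u).
  apply: subspace_continuous_measurable_fun => //.
  apply: continuous_in_subspaceT => u; rewrite inE/= in_itv/= andbT => xu.
  exact: (isd_continuous (isd_mul (isd_id u) (isd_psik mu 1 (lt_le_trans x0 xu)))).
have pa0 : 0 <= (ph a)^-1 by rewrite invr_ge0 ltW// phi_pos.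
rewrite EFinM -(mul_psi1_tail_fin inv_lty x0) -ge0_integralZl_EFin//; last 2 first.
- by move=> u; rewrite /= in_itv/= andbT => xu; rewrite lee_fin mulr_ge0 ?psik_ge0// ltW// (lt_le_trans x0).
- exact/measurable_EFinP.
apply: ge0_le_integral => //.
- move=> u; rewrite /= in_itv/= andbT => xu; rewrite lee_fin g_ge0//; exact: lt_le_trans xu.
- by apply/measurable_EFinP; exact: measurable_g.
- by apply: emeasurable_funM => //; exact/measurable_EFinP.
- move=> u; rewrite /= in_itv/= andbT => xu; rewrite -EFinM lee_fin g_le//.
  exact: le_trans xu.
Qed.

Let integrable_g (a : R) : 0 < a -> leb.-integrable (`[a, +oo[%classic : set R) (EFin \o g).
Proof.
move=> a0; apply/integrableP; split; first by apply/measurable_EFinP; exact: measurable_g.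
apply: le_lt_trans (ltry ((ph a)^-1 * K a)); apply: le_trans (g_tail_le a0 (lexx a)).
rewrite le_eqVlt; apply/orP; left; apply/eqP; apply: eq_integral => u.
rewrite inE/= in_itv/= andbT => au.
by rewrite ger0_norm// g_ge0// (lt_le_trans a0).
Qed.

Let Tl (x : R) := \int[leb]_(u in `]x, +oo[) g u.

Let integrable_go (a : R) : 0 < a -> leb.-integrable (`]a, +oo[%classic : set R) (EFin \o g).
Proof.
move=> a0; apply: integrableS (integrable_g a0) => //.
by move=> u; rewrite /= !in_itv/= !andbT; exact: ltW.
Qed.

Let Tl_closed (x : R) : 0 < x -> (Tl x)%:E = (\int[leb]_(u in `[x, +oo[) (g u)%:E)%E.
Proof.
move=> x0; rewrite /Tl Rintegral_itv_obnd_cbnd; last exact: integrable_go.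
by rewrite fineK//; apply: integrable_fin_num => //; exact: integrable_g.
Qed.

Let Tl_bound (x : R) : 1 <= x -> 0 <= Tl x <= (ph 1)^-1 * K x.
Proof.
move=> x1; rewrite -!lee_fin Tl_closed ?ge1_gt0// g_tail_le// andbT.
apply: integral_ge0 => u; rewrite /= in_itv/= andbT => xu.
by rewrite lee_fin g_ge0// (lt_le_trans (ge1_gt0 x1)).
Qed.

Let Tl_cvg0 : Tl x @[x --> +oo] --> (0 : R).
Proof.
have kc : (ph 1)^-1 * K x @[x --> +oo] --> (0 : R).
  rewrite -[X in _ --> X](mulr0 (ph 1)^-1); apply: cvgM; first exact: cvg_cst.
  exact: tail_kernel_cvg0.
apply: (squeeze_cvgr _ (cvg_cst 0) kc); near=> x.
by apply: Tl_bound; near: x; apply: nbhs_pinfty_ge; exact: num_real.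
Unshelve. all: by end_near. Qed.

Let isd_Tl (x : R) : 1 <= x -> is_derive x (1 : R) Tl (- g x).
Proof.
move=> x1; have x0 := ge1_gt0 x1.
apply: (@isd_tail R g 2^-1); first by rewrite (lt_le_trans _ x1)// invf_lt1// ltr1n.
  by apply: integrable_go; rewrite invr_gt0.
exact: g_cont.
Qed.

Local Notation jumps_term := (fine (\int[mu]_(v in D)
   \int[leb]_(y in `[ps 1, +oo[) (expR (- (varphi_star mu q y * v)))%:E)%E).

(** Since phi' = psik 1, the tail at 1 is the jump term plus phi_star 1 times the
    increase of phi from 1 to infinity, that is c phi_star 1 - 1. *)
Let Tl1E : Tl 1 = jumps_term + c * ps 1 - 1.
Proof.
rewrite integral_jump_kernel//.
have i0 := integrable_g ltr01.
have cp (x : R) : 1 <= x -> {for x, continuous (psik mu 1)}.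
  by move=> x1; exact: isd_continuous (isd_psik mu 1 (ge1_gt0 x1)).
have dp (x : R) : 1 <= x -> is_derive x (1 : R) (fun u => - psik mu 0 u) (psik mu 1 x).
  by move=> x1; have := isd_opp (isd_psik mu 0 (ge1_gt0 x1)); rewrite opprK.
have I1 : (\int[leb]_(u in `[1%R, +oo[) (psik mu 1 u)%:E = (psi mu 1)%:E)%E.
  rewrite (@ge0_FTC2y_isd _ _ (fun u => - psik mu 0 u) 1 0).
  - by rewrite sub0r opprK psik0.
  - by move=> u _; exact: psik_ge0.
  - exact: cp.
  - rewrite -oppr0; apply: cvgN; under eq_cvg do rewrite psik0; exact: psi_cvg0.
have mp : measurable_fun (`[1, +oo[%classic : set R) (psik mu 1).
  apply: subspace_continuous_measurable_fun => //.
  by apply: continuous_in_subspaceT => u; rewrite inE/= in_itv/= andbT; exact: cp.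
have ip : leb.-integrable (`[1, +oo[%classic : set R) (EFin \o psik mu 1).
  apply/integrableP; split; first exact/measurable_EFinP.
  rewrite (_ : integral _ _ _ = (psi mu 1)%:E) ?ltry// -I1.
  by apply: eq_integral => u _; rewrite /= ger0_norm// psik_ge0.
have m1 : measurable (`[1, +oo[%classic : set (measurableTypeR R)) by exact: measurable_itv.
have ips : leb.-integrable (`[1, +oo[%classic : set R) (EFin \o (fun u => ps 1 * psik mu 1 u)).
  by have := integrableZl m1 (ps 1) ip; exact.
have -> : (\int[leb]_(u in `[1%R, +oo[) ((ps u - ps 1) * psik mu 1 u)%:E =
    \int[leb]_(u in `[1%R, +oo[) (g u - ps 1 * psik mu 1 u)%:E)%E.
  by apply: eq_integral => u _; rewrite /g; congr EFin; ring.
rewrite -/(Rintegral leb _ _) RintegralB// RintegralZl//.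
rewrite {2}/Rintegral I1/= /Tl Rintegral_itv_obnd_cbnd; last exact: integrable_go.
have h : ps 1 * ph 1 = 1 by rewrite /phi_star mul1r mulVf // gt_eqF // phi_pos.
have := h; rewrite phi_psi// => h'.
rewrite -addrA -[LHS]addr0 -addrA; congr (_ + _); rewrite -[X in _ - X]h'; ring.
Qed.

Let h1 (u : R) := psik mu 1 u * (ph u)^-1.
Let h2 (u : R) := psik mu 1 u * (- (psik mu 1 u / ph u ^+ 2)) + (ph u)^-1 * (- psik mu 2 u).

Let isd_lnphi (u : R) : 1 <= u -> is_derive u (1 : R) (fun u => ln (ph u)) (h1 u).
Proof. by move=> u1; have u0 := ge1_gt0 u1; exact: isd_ln (phi_pos u0) (isd_phi mu q u0). Qed.

Let isd_h1 (u : R) : 1 <= u -> is_derive u (1 : R) h1 (h2 u).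
Proof. by move=> u1; have u0 := ge1_gt0 u1; exact: isd_mul (isd_psik mu 1 u0) (isd_iph u0). Qed.

Let cont_h2 (u : R) : 1 <= u -> {for u, continuous h2}.
Proof.
move=> u1; have u0 := ge1_gt0 u1.
have p20 : ph u ^+ 2 != 0 by rewrite expf_neq0// gt_eqF// phi_pos.
have d2 := @isd_inv R (fun u => ph u ^+ 2) u _ p20 (isd_X 2 (isd_phi mu q u0)).
have d1 := isd_mul (isd_psik mu 1 u0) (isd_opp (isd_mul (isd_psik mu 1 u0) d2)).
exact: (isd_continuous (isd_add d1 (isd_mul (isd_iph u0) (isd_opp (isd_psik mu 2 u0))))).
Qed.

Let C : R := levy_mass mu ^+ 2 / ph 1 ^+ 2 + 2 * levy_mass mu / ph 1.

Let h2_le (u : R) : 1 <= u -> `|h2 u| <= C / u ^+ 2.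
Proof.
move=> u1; have u0 := ge1_gt0 u1.
have P1 := psik_le mu 1 u0; have P2 := psik_le mu 2 u0.
have Q1 := psik_ge0 mu 1 u; have Q2 := psik_ge0 mu 2 u; have l0 := levy_mass_ge0 mu.
have pu : 0 < ph u by exact: phi_pos.
have i1 : 0 <= (ph u)^-1 by rewrite invr_ge0 ltW.
have i2 : (ph u)^-1 <= (ph 1)^-1.
  by rewrite lef_pV2 ?posrE ?phi_pos// phi_le_mono.
have E : h2 u = - ((psik mu 1 u * (ph u)^-1) ^+ 2 + psik mu 2 u * (ph u)^-1).
  by rewrite /h2; field; rewrite gt_eqF.
have K1 : psik mu 1 u * (ph u)^-1 <= levy_mass mu / u * (ph 1)^-1.
  apply: ler_pM => //; apply: (le_trans P1).
  by rewrite (_ : 1`!%:R = 1)// expr1 mul1r mulrC.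
rewrite E normrN ger0_norm ?addr_ge0 ?sqr_ge0 ?mulr_ge0//.
have -> : C / u ^+ 2 = (levy_mass mu / u * (ph 1)^-1) ^+ 2 + 2 / u ^+ 2 * levy_mass mu * (ph 1)^-1.
  have [n1 n2] : ph 1 != 0 /\ u != 0 by split; rewrite gt_eqF// phi_pos.
  by rewrite /C; field; rewrite ?n1 ?n2.
apply: lerD; last by apply: ler_pM.
have A0 := mulr_ge0 Q1 i1; have B0 := le_trans A0 K1.
by apply: lerXn2r K1; rewrite nnegrE; [exact: A0|exact: B0].
Qed.

(** The bracket in T_phi_star is u^-2 plus the second derivative of ln phi. *)
Let T_split : T_phi_star mu q = T0 + 2^-1 * \int[leb]_(u in `[1, +oo[) (saw u * h2 u).
Proof.
have [i2 _] := integrable_trapezoid cont_h2 h2_le (lexx 1).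
pose hs (u : R) := 1 / u ^+ 2 : R.
have ch (u : R) : 1 <= u -> {for u, continuous hs}.
  move=> u1; have u20 : u ^+ 2 != 0 by rewrite expf_neq0// gt_eqF// ge1_gt0.
  have hX := isd_mull 1 (@isd_inv R (fun u => u ^+ 2) u _ u20 (isd_X 2 (isd_id u))).
  exact: (isd_continuous hX).
have hle (u : R) : 1 <= u -> `|hs u| <= 1 / u ^+ 2.
  by move=> u1; rewrite ger0_norm// divr_ge0// sqr_ge0.
have [i1 _] := integrable_trapezoid ch hle (lexx 1).
rewrite /T_phi_star /T0 -mulrDr; congr (_ * _).
rewrite -RintegralD//; apply: eq_Rintegral => u; rewrite inE/= in_itv/= andbT => u1.
have u0 := ge1_gt0 u1; rewrite -/(saw u) -mulrDr; congr (_ * _).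
rewrite (derive2_phi mu q u0 : derive1 (derive1 ph) u = _) derive1_phi// /h2; field.
by rewrite !gt_eqF// phi_pos.
Qed.

Let lnpE n : ln (p n.+1) = - \sum_(k < n.+1) ln (ph k.+1%:R).
Proof.
elim: n => [|n IH].
  rewrite /moment_coef !big_ord_recl !big_ord0 mulr1 addr0 lnV ?posrE ?phi_pos//.
have f0 : 0 < ph n.+2%:R by rewrite phi_pos.
have p0 : 0 < p n.+1 by exact: moment_coef_gt0.
have pE : p n.+2 = p n.+1 * (ph n.+2%:R)^-1.
  by rewrite /moment_coef big_ord_recr.
rewrite pE lnM ?posrE ?invr_gt0// lnV ?posrE// IH [in RHS]big_ord_recr/= opprD//.
Qed.

(** The factor multiplying n is at most psi(n) / phi 1, and n psi(n) vanishes. *)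
Let rate_gap_cvg0 :
  (n.+1%:R + 2^-1) * (ln c - ln (ph n.+1%:R)) @[n --> \oo] --> (0 : R).
Proof.
have cN : n.+1%:R * psi mu n.+1%:R @[n --> \oo] --> (0 : R).
  have hN : (n.+1%:R : R) @[n --> \oo] --> +oo.
    by have := @cvgr_idn R; rewrite -(cvg_shiftS (fun n : nat => n%:R : R)).
  exact: cvg_comp hN (mul_psi_cvg0 inv_lty).
have cN2 : 2 / ph 1 * (n.+1%:R * psi mu n.+1%:R) @[n --> \oo] --> (0 : R).
  by rewrite -[X in _ --> X](mulr0 (2 / ph 1)); apply: cvgM; [exact: cvg_cst|exact: cN].
apply: (squeeze_cvgr _ (cvg_cst 0) cN2); apply: nearW => n.
have n0 : 1 <= n.+1%:R :> R by rewrite ler1n.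
have np : 0 < n.+1%:R :> R by exact: ge1_gt0.
have f0 : 0 < ph n.+1%:R by exact: phi_pos.
have fc : ph n.+1%:R <= c by apply: phi_le_c; exact: ltW.
have lg : 0 <= ln c - ln (ph n.+1%:R) by rewrite subr_ge0 ler_ln.
have lle : ln c - ln (ph n.+1%:R) <= psi mu n.+1%:R / ph 1.
  have -> : ln c - ln (ph n.+1%:R) = ln (c / ph n.+1%:R).
    by rewrite lnM ?posrE ?invr_gt0// lnV ?posrE.
  have cf : 0 < c / ph n.+1%:R by rewrite divr_gt0.
  have := le_ln1Dx (x := c / ph n.+1%:R - 1).
  rewrite (addrC 1) subrK => /(_ _)/le_trans; apply; first by rewrite ltrBrDr addrC subrr.
  have -> : c / ph n.+1%:R - 1 = psi mu n.+1%:R * (ph n.+1%:R)^-1.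
    have e := phi_psi mu q (ltW np).
    have -> : psi mu n.+1%:R = c - ph n.+1%:R by rewrite e; ring.
    by field; rewrite gt_eqF.
  rewrite ler_wpM2l ?psi_ge0// lef_pV2 ?posrE ?phi_pos// phi_le_mono//.
apply/andP; split; first by rewrite mulr_ge0// addr_ge0// ?invr_ge0// ltW.
have ps0 := psi_ge0 mu n.+1%:R.
have i0 : 0 <= (ph 1)^-1 by rewrite invr_ge0 ltW// phi_pos.
apply: (@le_trans _ _ (2 * n.+1%:R * (psi mu n.+1%:R / ph 1))).
  by apply: ler_pM => //; lra.
by rewrite le_eqVlt; apply/orP; left; apply/eqP; ring.
Qed.

(** The trapezoid formula for ln phi, evaluated with an explicit antiderivative. *)
Lemma log_moment_cvg : ln (c ^+ n.+2 * p n.+1) @[n --> \oo] -->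
  T0 - T_phi_star mu q + 2^-1 * ln (ph 1) + (jumps_term + c * ps 1 - 1) + 2^-1 * ln c.
Proof.
(* an antiderivative of ln phi: the derivative of u ln phi(u) exceeds it by
   u phi'(u) / phi(u), which is the derivative of - Tl *)
pose H (u : R) := u * ln (ph u) + Tl u.
have dH (u : R) : 1 <= u -> is_derive u (1 : R) H (ln (ph u)).
  move=> u1; have u0 := ge1_gt0 u1.
  apply: isd_eq (isd_add (isd_mul (isd_id u) (isd_lnphi u1)) (isd_Tl u1)) => //=.
  by rewrite /h1 /g /phi_star; ring.
have hN : (n.+1%:R : R) @[n --> \oo] --> +oo.
  by have := @cvgr_idn R; rewrite -(cvg_shiftS (fun n : nat => n%:R : R)).
have TlN : Tl n.+1%:R @[n --> \oo] --> (0 : R) by exact: cvg_comp hN Tl_cvg0.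
have := trapezoid_limit dH isd_lnphi isd_h1 cont_h2 h2_le.
set E := (fun n : nat => _); set J := Rintegral _ _ _ => EJ.
have lim : - (2^-1 * E n) + 2^-1 * ln (ph 1) + (Tl 1 - Tl n.+1%:R) +
    (n.+1%:R + 2^-1) * (ln c - ln (ph n.+1%:R)) + 2^-1 * ln c @[n --> \oo] -->
    - (2^-1 * J) + 2^-1 * ln (ph 1) + (Tl 1 - 0) + 0 + 2^-1 * ln c.
  apply: cvgD; last exact: cvg_cst.
  apply: cvgD; last exact: rate_gap_cvg0.
  apply: cvgD; last by apply: cvgB; [exact: cvg_cst|exact: TlN].
  apply: cvgD; last exact: cvg_cst.
  by apply: cvgN; apply: cvgM; [exact: cvg_cst|exact: EJ].
have -> : T0 - T_phi_star mu q + 2^-1 * ln (ph 1) + (jumps_term + c * ps 1 - 1) + 2^-1 * ln c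
   = - (2^-1 * J) + 2^-1 * ln (ph 1) + (Tl 1 - 0) + 0 + 2^-1 * ln c.
  by rewrite T_split -Tl1E -/J; ring.
apply: cvg_trans lim; apply: near_eq_cvg; apply: nearW => n.
rewrite (@lnM _ (c ^+ n.+2) (p n.+1)) ?posrE ?exprn_gt0 ?moment_coef_gt0//.
have alg (S a b t t' l N : R) :
    - (2^-1 * (2 * S - a - b - 2 * (N * b + t' - (1 * a + t)))) + 2^-1 * a + (t - t') +
    (N + 2^-1) * (l - b) + 2^-1 * l = (N + 1) * l + - S by field.
by rewrite lnXn// lnpE -[ln c *+ _]mulr_natl /E /H -(natr1 n.+1); exact: alg.
Qed.

Let expR_half_ln (a : R) : 0 < a -> expR (2^-1 * ln a) = Num.sqrt a.
Proof.
move=> a0; rewrite -[in RHS](lnK a0) -[X in Num.sqrt (expR X)](mulVKf (x := 2) (ltac:(by []) : 2 != 0 :> R)).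
by rewrite expRM_natl sqrtr_sqr ger0_norm ?expR_ge0.
Qed.

(** Stirling's constant, which enters through T0, supplies the factor 2 pi. *)
Lemma moment_limit : c ^+ n.+1 * p n @[n --> \oo] -->
  Num.sqrt c * expR (c * ps 1 + jumps_term) *
    (expR (- T_phi_star mu q) / Num.sqrt (2 * pi * ps 1)).
Proof.
rewrite -(cvg_shiftS (fun n => c ^+ n.+1 * p n)).
have pp : 0 < 2 * pi :> R by rewrite mulr_gt0// pi_gt0.
have ps1 : ps 1 = (ph 1)^-1 by rewrite /phi_star mul1r.
have e1 : Num.sqrt (2 * pi * ps 1) = expR (2^-1 * (ln (2 * pi) - ln (ph 1))).
  rewrite -lnV ?posrE ?phi_pos// -lnM ?posrE ?invr_gt0 ?phi_pos// -ps1 expR_half_ln//.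
  by rewrite mulr_gt0// ps1 invr_gt0 phi_pos.
have -> : Num.sqrt c * expR (c * ps 1 + jumps_term) *
    (expR (- T_phi_star mu q) / Num.sqrt (2 * pi * ps 1)) =
  expR (T0 - T_phi_star mu q + 2^-1 * ln (ph 1) + (jumps_term + c * ps 1 - 1) + 2^-1 * ln c).
  have alg (J t l w a s : R) :
    2^-1 * l + (s + J) + (- t + - (2^-1 * (w - a))) =
    1 - 2^-1 * w - t + 2^-1 * a + (J + s - 1) + 2^-1 * l by field.
  by rewrite e1 -(expR_half_ln c0) -expRN -!expRD T0E; congr expR; exact: alg.
have h := cvg_comp _ _ log_moment_cvg (@continuous_expR R _).
apply: cvg_trans h; apply: near_eq_cvg; apply: nearW => n.
by rewrite /= lnK// posrE mulr_gt0 ?exprn_gt0// moment_coef_gt0.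
Qed.

End moment_asymptotics.

(** * Re-expansion of complex power series *)

Section complex_modulus.
Context {R : realType}.
Local Notation C := (R[i]).
Local Notation "x %:K" := (real_complex R x) (at level 2, format "x %:K").

(** The modulus as a real number; the norm of a complex number lives in the complex
    field itself. *)
Definition cmod (z : C) : R := complex.Re `|z|.

Lemma cmodE z : `|z| = (cmod z)%:K.
Proof. by rewrite RRe_real// normr_real. Qed.

Lemma cmod_ge0 z : 0 <= cmod z.
Proof. by rewrite -lecR -cmodE normr_ge0. Qed.

Lemma cmodM x y : cmod (x * y) = cmod x * cmod y.
Proof. by apply: (@complexI R); rewrite rmorphM/= -!cmodE normrM. Qed.

Lemma cmodD x y : cmod (x + y) <= cmod x + cmod y.
Proof. by rewrite -lecR rmorphD/= -!cmodE ler_normD. Qed.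

Lemma cmodN x : cmod (- x) = cmod x.
Proof. by rewrite /cmod normrN. Qed.

Lemma cmodB x y : cmod (x - y) = cmod (y - x).
Proof. by rewrite -cmodN opprB. Qed.

Lemma cmod0 : cmod 0 = 0.
Proof. by rewrite /cmod normr0. Qed.

Lemma cmod0_eq0 x : cmod x = 0 -> x = 0.
Proof. by move=> h; apply/eqP; rewrite -normr_eq0 cmodE h. Qed.

Lemma cmodX x n : cmod (x ^+ n) = cmod x ^+ n.
Proof. by apply: (@complexI R); rewrite rmorphXn/= -!cmodE normrX. Qed.

Lemma cmod_real (x : R) : cmod x%:K = `|x|.
Proof.
apply: (@complexI R); rewrite -cmodE normc_def/= expr0n/= addr0.
by rewrite sqrtr_sqr.
Qed.

Lemma cmod_nat n : cmod n%:R = n%:R.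
Proof. by rewrite -(rmorph_nat (real_complex R)) cmod_real ger0_norm. Qed.

Lemma cmod_sum (I : Type) (r : seq I) (P : pred I) (F : I -> C) :
  cmod (\sum_(i <- r | P i) F i) <= \sum_(i <- r | P i) cmod (F i).
Proof.
apply: (big_ind2 (fun a b => cmod a <= b)); first by rewrite cmod0.
- by move=> a b a' b' h h'; rewrite (le_trans (cmodD _ _))// lerD.
- by [].
Qed.

Lemma cmodB_le x y z : cmod (x - z) <= cmod (x - y) + cmod (y - z).
Proof. by rewrite (le_trans _ (cmodD _ _))// addrA subrK. Qed.

Lemma cmod_sqr (z : C) : cmod z ^+ 2 = complex.Re z ^+ 2 + complex.Im z ^+ 2.
Proof. by apply: (@complexI R); rewrite rmorphXn/= -cmodE -add_Re2_Im2. Qed.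

Lemma Re_le_cmod (z : C) : `|complex.Re z| <= cmod z.
Proof.
rewrite -(@ler_pXn2r _ 2)// ?nnegrE ?cmod_ge0// real_normK ?num_real// cmod_sqr.
by rewrite lerDl sqr_ge0.
Qed.

Lemma Im_le_cmod (z : C) : `|complex.Im z| <= cmod z.
Proof.
rewrite -(@ler_pXn2r _ 2)// ?nnegrE ?cmod_ge0// real_normK ?num_real// cmod_sqr.
by rewrite lerDr sqr_ge0.
Qed.

Lemma cmod_le (z : C) : cmod z <= `|complex.Re z| + `|complex.Im z|.
Proof.
rewrite -(@ler_pXn2r _ 2)// ?nnegrE ?cmod_ge0 ?addr_ge0// cmod_sqr.
rewrite sqrrD !real_normK ?num_real//.
by rewrite -addrA [X in _ <= _ + X]addrC addrA lerDl mulrn_wge0// mulr_ge0.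
Qed.

(** Convergence of complex sequences, expressed by a real sequence. *)
Definition tends (u : nat -> C) (l : C) := cmod (u n - l) @[n --> \oo] --> (0 : R).

Lemma tends_squeeze (u : nat -> C) (l : C) (v : nat -> R) :
  (\forall n \near \oo, cmod (u n - l) <= v n) -> v n @[n --> \oo] --> (0 : R) -> tends u l.
Proof.
move=> uv v0; apply: (squeeze_cvgr _ (cvg_cst 0) v0); near=> n.
by rewrite cmod_ge0/=; near: n.
Unshelve. all: by end_near. Qed.

Lemma tends_unique u l l' : tends u l -> tends u l' -> l = l'.
Proof.
move=> h h'; apply/eqP; rewrite -subr_eq0; apply/eqP; apply: cmod0_eq0.
apply/eqP; rewrite eq_le cmod_ge0 andbT.
have : cmod (u n - l) + cmod (u n - l') @[n --> \oo] --> (0 + 0 : R) by exact: cvgD.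
rewrite addr0 => h2; apply: (ler_cvg_to (cvg_cst _) h2); apply: nearW => n.
by rewrite (cmodB (u n) l) cmodB_le.
Qed.

Lemma tends_sub u v l : tends (fun n => u n - v n) 0 -> tends v l -> tends u l.
Proof.
move=> h h'; have h2 : cmod (u n - v n - 0) + cmod (v n - l) @[n --> \oo] --> (0 + 0 : R) by exact: cvgD.
rewrite addr0 in h2; apply: tends_squeeze h2; apply: nearW => n.
by rewrite subr0 cmodB_le.
Qed.

Lemma tends_sym u v l : tends (fun n => u n - v n) l -> tends (fun n => v n - u n) (- l).
Proof.
move=> h; apply: tends_squeeze h; apply: nearW => n.
by rewrite (_ : v n - u n - - l = - (u n - v n - l)) ?cmodN//; ring.
Qed.

Lemma tends_real (u : nat -> R) (l : R) : u n @[n --> \oo] --> l ->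
  tends (fun n => (u n)%:K) l%:K.
Proof.
move=> /cvgr_dist_lt ul; apply/cvgrPdist_lt => eps eps0; near=> n.
rewrite sub0r normrN -rmorphB/= cmod_real normr_id distrC.
by near: n; exact: ul.
Unshelve. all: by end_near. Qed.

Lemma tends_cvg (u : nat -> (C : numFieldType)) (l : (C : numFieldType)) :
  tends u l -> u n @[n --> \oo] --> l.
Proof.
move=> /cvgr_dist_lt ul; apply/cvgrPdist_lt => eps eps0.
have epsE : eps = (complex.Re eps)%:K by rewrite RRe_real// gtr0_real.
have e0 : 0 < complex.Re eps by rewrite -ltcR -epsE.
near=> n; rewrite distrC cmodE epsE ltcR.
suff : `|0 - cmod (u n - l)| < complex.Re eps by rewrite sub0r normrN ger0_norm ?cmod_ge0.
by near: n; exact: ul.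
Unshelve. all: by end_near. Qed.

Lemma geometric_cvg0 (M t : R) : 0 <= t < 1 -> M * t ^+ n @[n --> \oo] --> (0 : R).
Proof.
move=> /andP[t0 t1]; rewrite -[X in _ --> X](mulr0 M); apply: cvgM; first exact: cvg_cst.
by apply: cvg_expr; rewrite ger0_norm.
Qed.

Lemma geometric_cauchy_real (r : nat -> R) (M t : R) : 0 <= t < 1 ->
  (forall N K, (N <= K)%N -> `|r K - r N| <= M * t ^+ N) ->
  exists l : R, r n @[n --> \oo] --> l.
Proof.
move=> t01 rP; suff : cvg (r n @[n --> \oo]) by move=> h; exists (lim (r n @[n --> \oo])).
apply: cauchy_cvg; apply/cauchy_exP => eps eps0.
have /cvgr_dist_lt/(_ eps eps0)[N _ NP] := geometric_cvg0 M t01.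
exists (r N); exists N => // K /= NK; rewrite /ball/= distrC.
apply: le_lt_trans (rP N K NK) _; have := NP N (leqnn N).
by rewrite /= sub0r normrN; apply: le_lt_trans; exact: ler_norm.
Qed.

(** Completeness, applied to the real and the imaginary parts separately. *)
Lemma geometric_cauchy (u : nat -> C) (M t : R) : 0 <= t < 1 ->
  (forall N K, (N <= K)%N -> cmod (u K - u N) <= M * t ^+ N) -> exists l, tends u l.
Proof.
move=> t01 uP.
have [a aP] : exists l : R, complex.Re (u n) @[n --> \oo] --> l.
  apply: (geometric_cauchy_real (M := M) t01) => N K NK; apply: le_trans (uP N K NK).
  by rewrite -raddfB Re_le_cmod.
have [b bP] : exists l : R, complex.Im (u n) @[n --> \oo] --> l.
  apply: (geometric_cauchy_real (M := M) t01) => N K NK; apply: le_trans (uP N K NK).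
  by rewrite -raddfB Im_le_cmod.
exists (a +i* b)%C.
have h : `|complex.Re (u n) - a| + `|complex.Im (u n) - b| @[n --> \oo] --> (0 + 0 : R).
  apply: cvgD; rewrite -(normr0 R); apply: cvg_norm.
    by rewrite -(subrr a); apply: cvgB => //; exact: cvg_cst.
  by rewrite -(subrr b); apply: cvgB => //; exact: cvg_cst.
rewrite addr0 in h; apply: tends_squeeze h; apply: nearW => n.
by apply: le_trans (cmod_le _) _; rewrite !raddfB/=.
Qed.

Lemma geometric_tail_le (t : R) N K : 0 <= t < 1 ->
  \sum_(N <= k < K) t ^+ k <= t ^+ N / (1 - t).
Proof.
move=> /andP[t0 t1]; have t10 : 0 < 1 - t by rewrite subr_gt0.
rewrite ler_pdivlMr//.
have [KN|NK] := leqP K N; first by rewrite big_geq// mul0r exprn_ge0.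
suff -> : (\sum_(N <= k < K) t ^+ k) * (1 - t) = t ^+ N - t ^+ K.
  by rewrite lerBlDr lerDl exprn_ge0.
rewrite mulr_suml (eq_bigr (fun k => - (t ^+ k.+1 - t ^+ k))); last first.
  by move=> k _; rewrite exprS; ring.
by rewrite sumrN telescope_sumr ?opprB// ltnW.
Qed.

Lemma binomial_partial_le (A H : R) k J : 0 <= A -> 0 <= H ->
  \sum_(j < J) 'C(k, j)%:R * A ^+ (k - j) * H ^+ j <= (A + H) ^+ k.
Proof.
move=> A0 H0; have t0 j : 0 <= 'C(k, j)%:R * A ^+ (k - j) * H ^+ j.
  by rewrite !mulr_ge0 ?exprn_ge0.
rewrite exprDn (eq_bigr (fun j : 'I_k.+1 => 'C(k, j)%:R * A ^+ (k - j) * H ^+ j)); last first.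
  by move=> j _; rewrite -mulr_natl mulrA.
pose F j := 'C(k, j)%:R * A ^+ (k - j) * H ^+ j.
rewrite -(big_mkord xpredT F) -(big_mkord xpredT F).
have [Jk|kJ] := leqP J k.+1.
  rewrite [leRHS](big_cat_nat (leq0n J) Jk)//= lerDl sumr_ge0// => j _; exact: t0.
rewrite (big_cat_nat (leq0n _) (ltnW kJ))//= [X in _ + X]big1_seq ?addr0// => j.
by rewrite mem_index_iota => /andP[_ /andP[kj _]]; rewrite /F bin_small// !mul0r.
Qed.

End complex_modulus.

Section recentering.
Context {R : realType}.
Local Notation C := (R[i]).
Variables (a : nat -> C) (M rho : R) (w0 : C).
Hypothesis rho0 : 0 < rho.
Hypothesis aM : forall k, cmod (a k) * rho ^+ k <= M.

Definition psum (b : nat -> C) (w : C) N := \sum_(k < N) b k * w ^+ k.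

(** The partial sums of the j-th coefficient, when the series with coefficients a is
    re-expanded around w0. *)
Definition recentered (j K : nat) : C := \sum_(0 <= k < K) 'C(k, j)%:R * a k * w0 ^+ (k - j).

Let A := cmod w0.
Let A0 : 0 <= A. Proof. exact: cmod_ge0. Qed.
Let M0 : 0 <= M. Proof. by apply: le_trans (aM 0); rewrite mulr_ge0 ?cmod_ge0 ?exprn_ge0 ?ltW. Qed.

Let ratio (H : R) : 0 <= H -> A + H < rho -> 0 <= (A + H) / rho < 1.
Proof. by move=> H0 AH; rewrite divr_ge0 ?addr_ge0 ?(ltW rho0)//= ltr_pdivrMr// mul1r. Qed.

(** All interchanges of summations below are controlled by this tail. *)
Let coef_tail (H : R) N K : 0 <= H -> A + H < rho ->
  \sum_(N <= k < K) cmod (a k) * (A + H) ^+ k <=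
  M / (1 - (A + H) / rho) * ((A + H) / rho) ^+ N.
Proof.
move=> H0 AH; have t01 := ratio H0 AH.
apply: (@le_trans _ _ (M * \sum_(N <= k < K) ((A + H) / rho) ^+ k)).
  rewrite mulr_sumr; apply: ler_sum => k _.
  have := ler_wpM2r (exprn_ge0 k (proj1 (andP t01))) (aM k).
  apply: le_trans; rewrite expr_div_n -mulrA [rho ^+ k * _]mulrC divfK//.
  by rewrite expf_neq0// gt_eqF.
by rewrite -mulrA [_^-1 * _]mulrC ler_wpM2l// geometric_tail_le.
Qed.

Lemma psum_cauchy (w : C) N K : cmod w < rho -> (N <= K)%N ->
  cmod (psum a w K - psum a w N) <= M / (1 - cmod w / rho) * (cmod w / rho) ^+ N.
Proof.
move=> wr NK; have w0r := cmod_ge0 w.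
have t01 : 0 <= cmod w / rho < 1 by rewrite divr_ge0 ?(ltW rho0)//= ltr_pdivrMr// mul1r.
pose F k := a k * w ^+ k.
rewrite /psum -(big_mkord xpredT F) -(big_mkord xpredT F) (big_cat_nat (leq0n N) NK)//= addrAC subrr add0r.
apply: le_trans (cmod_sum _ _ _) _.
apply: (@le_trans _ _ (M * \sum_(N <= k < K) (cmod w / rho) ^+ k)); last first.
  by rewrite -mulrA [_^-1 * _]mulrC ler_wpM2l// geometric_tail_le.
rewrite mulr_sumr; apply: ler_sum => k _; rewrite /F cmodM cmodX.
have := ler_wpM2r (exprn_ge0 k (proj1 (andP t01))) (aM k).
apply: le_trans; rewrite expr_div_n -mulrA [rho ^+ k * _]mulrC divfK//.
by rewrite expf_neq0// gt_eqF.
Qed.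

Lemma psum_tends (w : C) : cmod w < rho -> exists l, tends (psum a w) l.
Proof.
move=> wr; have t01 : 0 <= cmod w / rho < 1.
  by rewrite divr_ge0 ?cmod_ge0 ?(ltW rho0)//= ltr_pdivrMr// mul1r.
by apply: (geometric_cauchy t01) => N K; exact: psum_cauchy.
Qed.

Let recentered_diff (H : R) J N K : 0 <= H -> A + H < rho -> (N <= K)%N ->
  \sum_(j < J) cmod (recentered j K - recentered j N) * H ^+ j <=
  M / (1 - (A + H) / rho) * ((A + H) / rho) ^+ N.
Proof.
move=> H0 AH NK; apply: le_trans (coef_tail N K H0 AH).
apply: (@le_trans _ _ (\sum_(j < J) \sum_(N <= k < K)
    cmod (a k) * ('C(k, j)%:R * A ^+ (k - j) * H ^+ j))).
  apply: ler_sum => j _; rewrite /recentered (big_cat_nat (leq0n N) NK)//= addrAC subrr add0r.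
  apply: le_trans (ler_wpM2r (exprn_ge0 j H0) (cmod_sum _ _ _)) _.
  rewrite mulr_suml; apply: ler_sum => k _; rewrite !cmodM cmodX cmod_nat -/A.
  by rewrite le_eqVlt; apply/orP; left; apply/eqP; ring.
rewrite exchange_big/=; apply: ler_sum => k _; rewrite -mulr_sumr ler_wpM2l ?cmod_ge0//.
exact: binomial_partial_le.
Qed.

Let psum_binomial (h : C) N : psum a (w0 + h) N = \sum_(j < N) recentered j N * h ^+ j.
Proof.
under [RHS]eq_bigr do rewrite /recentered mulr_suml.
rewrite exchange_big/= big_mkord; apply: eq_bigr => k _.
rewrite exprDn mulr_sumr (big_ord_widen N (fun j => a k * (w0 ^+ (k - j) * h ^+ j *+ 'C(k, j)))) ?ltn_ord//.
rewrite big_mkcond/=; apply: eq_bigr => j _; case: ifPn => [_|].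
  by rewrite -mulr_natl; ring.
by rewrite -leqNgt => kj; rewrite bin_small// !mul0r.
Qed.

Lemma recentered_tends j : cmod w0 < rho -> exists l, tends (recentered j) l.
Proof.
move=> wr; pose H := (rho - A) / 2; have H0 : 0 < H by rewrite divr_gt0// subr_gt0.
have AH : A + H < rho by rewrite /H; have : A < rho by []; lra.
apply: (geometric_cauchy (M := M / (1 - (A + H) / rho) / H ^+ j) (ratio (ltW H0) AH)) => N K NK.
have := recentered_diff j.+1 (ltW H0) AH NK.
rewrite big_ord_recr/= => le1; rewrite mulrAC ler_pdivlMr ?exprn_gt0//; apply: le_trans le1.
by rewrite lerDr sumr_ge0// => i _; rewrite mulr_ge0 ?cmod_ge0 ?exprn_ge0// ltW.
Qed.

(** Truncated at N the re-expansion is an identity between polynomials. The error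
    made by passing to the limit coefficients is at most the tail of the series of
    |a_k| (|w0| + |h|)^k. *)
Lemma recentering (b : nat -> C) : (forall j, tends (recentered j) (b j)) ->
  forall h, cmod w0 + cmod h < rho ->
  tends (fun N => psum b h N - psum a (w0 + h) N) 0.
Proof.
move=> bP h AH; have H0 := cmod_ge0 h; have t01 := ratio H0 AH.
apply: tends_squeeze (geometric_cvg0 (M / (1 - (A + cmod h) / rho)) t01).
apply: nearW => N; rewrite subr0 psum_binomial /psum -sumrB.
have sK : \sum_(j < N) cmod (b j - recentered j K) * cmod h ^+ j @[K --> \oo] --> (0 : R).
  have : forall J, \sum_(j < J) cmod (b j - recentered j K) * cmod h ^+ j @[K --> \oo] --> (0 : R).
    elim=> [|J IH]; first by under eq_cvg do rewrite big_ord0; exact: cvg_cst.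
    have bJ : cmod (b J - recentered J K) * cmod h ^+ J @[K --> \oo] --> (0 * cmod h ^+ J : R).
      apply: cvgM; last exact: cvg_cst.
      by under eq_cvg do rewrite cmodB; exact: bP.
    have := cvgD IH bJ; rewrite mul0r addr0 => IJ.
    rewrite (_ : (fun K : nat => _) = (fun K => \sum_(j < J) cmod (b j - recentered j K) *
      cmod h ^+ j + cmod (b J - recentered J K) * cmod h ^+ J)); first exact: IJ.
    by apply/funext => K; rewrite big_ord_recr.
  by apply.
have sK2 : \sum_(j < N) cmod (b j - recentered j K) * cmod h ^+ j +
    M / (1 - (A + cmod h) / rho) * ((A + cmod h) / rho) ^+ N @[K --> \oo] -->
    0 + M / (1 - (A + cmod h) / rho) * ((A + cmod h) / rho) ^+ N.
  by apply: cvgD; [exact: sK|exact: cvg_cst].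
rewrite add0r in sK2; apply: (ler_cvg_to (cvg_cst _) sK2).
near=> K; have NK : (N <= K)%N by near: K; exact: nbhs_infty_ge.
apply: le_trans (lerD (lexx _) (recentered_diff N H0 AH NK)).
apply: le_trans (cmod_sum _ _ _) _; rewrite -big_split/=; apply: ler_sum => j _.
by rewrite -mulrBl cmodM cmodX -mulrDl ler_wpM2r ?exprn_ge0// cmodB_le.
Unshelve. all: by end_near. Qed.

End recentering.

(** * Analytic extension to the half-plane *)

Section taylor_descent.
Context {R : realType}.

Definition derivative_chain (h : nat -> R -> R) :=
  forall n (x : R), 0 < x -> is_derive x (1 : R) (h n) (h n.+1 x).

(** The bounds that Cauchy's inequalities would give for a function that is analytic
    in the half-plane: they hold on disks of every radius r y < y around y. *)
Definition cauchy_bounds (h : nat -> R -> R) :=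
  forall r a : R, 0 < r < 1 -> 0 < a -> exists2 M : R, 0 <= M &
    forall n (y : R), a <= y -> `|h n y| * (r * y) ^+ n <= M * n`!%:R.

Lemma natS_geometric_le (t : R) n : 0 <= t < 1 -> n.+1%:R * t ^+ n <= (1 - t)^-1.
Proof.
move=> t01; have /andP[t0 t1] := t01.
have := geometric_tail_le 0 n.+1 t01; rewrite expr0 div1r; apply: le_trans.
rewrite big_mkord -[in leLHS](card_ord n.+1) mulr_natl -sumr_const; apply: ler_sum => k _.
by rewrite ler_wiXn2l// ?(ltW t1)// -ltnS.
Qed.

Lemma natS_geometric_cvg0 (K t : R) : 0 < t < 1 -> 0 <= K ->
  K * (n.+1%:R * t ^+ n) @[n --> \oo] --> (0 : R).
Proof.
move=> /andP[t0 t1] K0; pose s := (1 + t) / 2.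
have s0 : 0 < s by rewrite /s; lra.
have s1 : 0 <= s < 1 by rewrite /s; lra.
have ts : 0 <= t / s < 1.
  by rewrite divr_ge0 ?(ltW t0) ?(ltW s0)//= ltr_pdivrMr// mul1r /s; lra.
apply: (squeeze_cvgr _ (cvg_cst 0) (geometric_cvg0 (K / (1 - t / s)) s1)).
apply: nearW => n; rewrite !mulr_ge0 ?exprn_ge0 ?(ltW t0)//=.
rewrite -mulrA ler_wpM2l//.
have := ler_wpM2r (exprn_ge0 n (ltW s0)) (natS_geometric_le n ts).
by rewrite expr_div_n -mulrA divfK// expf_neq0// gt_eqF.
Qed.

(** The loss of a factor n + 1 is paid for by a slightly larger radius. *)
Lemma cauchy_bounds_shift1 h : cauchy_bounds h -> cauchy_bounds (fun n => h n.+1).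
Proof.
move=> hb r a /andP[r0 r1] a0; pose s := (1 + r) / 2.
have s0 : 0 < s by rewrite /s; lra.
have s01 : 0 < s < 1 by rewrite /s; lra.
have rs : 0 <= r / s < 1.
  by rewrite divr_ge0 ?(ltW r0) ?(ltW s0)//= ltr_pdivrMr// mul1r /s; lra.
have [M M0 MP] := hb s a s01 a0.
have i0 : 0 <= (1 - r / s)^-1 by rewrite invr_ge0 subr_ge0 ltW//; case/andP: rs.
exists (M * (1 - r / s)^-1 / (s * a)).
  by apply: divr_ge0; [exact: mulr_ge0 M0 i0|exact: mulr_ge0 (ltW s0) (ltW a0)].
move=> n y ay; have y0 : 0 < y by exact: lt_le_trans ay.
have h1 := MP n.+1 y ay.
have sy0 : 0 < s * y by rewrite mulr_gt0.
have -> : `|h n.+1 y| * (r * y) ^+ n =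
    `|h n.+1 y| * (s * y) ^+ n.+1 * (r / s) ^+ n / (s * y).
  have -> : r * y = (s * y) * (r / s) by field; rewrite gt_eqF.
  by rewrite exprMn exprSr; field; rewrite !gt_eqF.
have rsn : 0 <= (r / s) ^+ n by rewrite exprn_ge0//; case/andP: rs.
apply: (@le_trans _ _ (M * n.+1`!%:R * (r / s) ^+ n / (s * y))).
  by rewrite ler_wpM2r ?invr_ge0 ?(ltW sy0)// ler_wpM2r.
have -> : M * n.+1`!%:R * (r / s) ^+ n / (s * y) =
    M * n`!%:R * (n.+1%:R * (r / s) ^+ n) / (s * y) by rewrite factS natrM; ring.
have -> : M / (1 - r / s) / (s * a) * n`!%:R = M * n`!%:R * (1 - r / s)^-1 / (s * a) by ring.
apply: ler_pM; rewrite ?invr_ge0 ?(ltW sy0)//.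
- by rewrite !mulr_ge0.
- by rewrite ler_wpM2l ?mulr_ge0// natS_geometric_le.
- have sas : s * a <= s * y by rewrite ler_pM2l.
  by rewrite (lef_pV2 sy0 (mulr_gt0 s0 a0)).
Qed.

Lemma cauchy_bounds_shift h j : cauchy_bounds h -> cauchy_bounds (fun n => h (j + n)%N).
Proof.
move=> hb; elim: j => [//|j IH].
have -> : (fun n => h (j.+1 + n)%N) = (fun n => (fun m => h (j + m)%N) n.+1).
  by apply/funext => n; rewrite addSnnS.
exact: (cauchy_bounds_shift1 IH).
Qed.

Lemma derivative_chain_shift h j : derivative_chain h -> derivative_chain (fun n => h (j + n)%N).
Proof. by move=> hd n x x0; rewrite addnS; exact: hd. Qed.

(** The Taylor expansion at x1 reaches every point x0 between 0 and x1: in the form of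
    remainder given by the mean value theorem, t - x0 is at most (1 - x0 / x1) t, and
    the bounds at t hold with any ratio r < 1. *)
Lemma taylor_descent (h : nat -> R -> R) (x0 x1 : R) :
  derivative_chain h -> cauchy_bounds h -> 0 < x0 -> x0 < x1 ->
  \sum_(m < n.+1) h m x1 / m`!%:R * (x0 - x1) ^+ m @[n --> \oo] --> h 0%N x0.
Proof.
move=> hd hb x00 x01; have x10 : 0 < x1 by exact: lt_trans x01.
pose Phi n (t : R) := \sum_(m < n.+1) h m t / m`!%:R * (x0 - t) ^+ m.
have dPhi n (t : R) : 0 < t ->
    is_derive t (1 : R) (Phi n) (h n.+1 t / n`!%:R * (x0 - t) ^+ n).
  move=> t0; elim: n => [|n IH].
    apply: isd_eq (hd 0%N t t0) => [y|]; last by rewrite fact0 divr1 expr0 mulr1.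
    by rewrite /Phi big_ord_recl big_ord0 fact0 divr1 expr0 mulr1 addr0.
  have dx := isd_X n.+1 (isd_sub (isd_cst t x0) (isd_id t)).
  have dn := isd_mul (isd_mull (n.+1`!%:R^-1) (hd n.+1 t t0)) dx.
  apply: isd_eq (isd_add IH dn) => [y|].
    by rewrite /Phi [in RHS]big_ord_recr/=; congr (_ + _); ring.
  rewrite sub0r /= factS natrM; field.
  by rewrite !pnatr_eq0 -!lt0n fact_gt0 /= addrC natr1 pnatr_eq0.
have Phi0 n : Phi n x0 = h 0%N x0.
  rewrite /Phi big_ord_recl /= fact0 divr1 expr0 mulr1 big1 ?addr0// => i _.
  by rewrite subrr expr0n/= mulr0.
pose s := 1 - x0 / x1.
have s0 : 0 < s by rewrite subr_gt0 ltr_pdivrMr// mul1r.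
have s1 : s < 1 by rewrite /s ltrBlDr ltrDl divr_gt0.
(* s bounds (t - x0) / t for t in [x0, x1], so that any r above s gives a
   geometric decay of the remainder *)
have [r r01 sr] : exists2 r : R, 0 < r < 1 & s < r by exists ((1 + s) / 2); lra.
have r0 : 0 < r by case/andP: r01.
have [th th01 thr] : exists2 th : R, 0 < th < 1 & th * r = s.
  by exists (s / r); rewrite ?divfK ?gt_eqF// divr_gt0//= ltr_pdivrMr// mul1r.
have th0 : 0 < th by case/andP: th01.
have [M M0 MP] := hb r x0 r01 x00.
have K0 : 0 <= M * (x1 - x0) / (r * x0).
  apply: divr_ge0; last exact: mulr_ge0 (ltW r0) (ltW x00).
  by rewrite mulr_ge0// subr_ge0 ltW.
have := natS_geometric_cvg0 th01 K0 => lim0.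
rewrite -[X in _ --> X]addr0; apply/cvgrPdist_le => eps eps0; near=> n.
rewrite addr0 -(Phi0 n) -/(Phi n x1) distrC.
apply: (@le_trans _ _ (M * (x1 - x0) / (r * x0) * (n.+1%:R * th ^+ n))); last first.
  by near: n; move/cvgr_le: lim0; apply.
have [xi /andP[x0xi xix1] ->] := MVT_isd (f := Phi n) (f' := fun t => h n.+1 t / n`!%:R * (x0 - t) ^+ n)
  x01 (fun t tI => dPhi n t (lt_le_trans x00 (proj1 (andP tI)))).
have xi0 : 0 < xi by exact: lt_trans x0xi.
have n0 : 0 < n`!%:R :> R by rewrite ltr0n fact_gt0.
rewrite !normrM normfV (gtr0_norm n0) normrX (ler0_norm (x := x0 - xi)) ?subr_le0 ?(ltW x0xi)//.
rewrite (gtr0_norm (x := x1 - x0)) ?subr_gt0// opprB.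
set B := `|h n.+1 xi| / n`!%:R; have B0 : 0 <= B by rewrite divr_ge0// ltW.
have rxi : 0 < r * xi by rewrite mulr_gt0.
have BM : B * (r * xi) ^+ n.+1 <= M * n.+1%:R.
  have -> : B * (r * xi) ^+ n.+1 = `|h n.+1 xi| * (r * xi) ^+ n.+1 / n`!%:R by rewrite /B mulrAC.
  rewrite ler_pdivrMr//.
  have -> : M * n.+1%:R * n`!%:R = M * n.+1`!%:R by rewrite factS natrM mulrA.
  by apply: MP; exact: ltW.
have e1 : (xi - x0) ^+ n <= (r * xi) ^+ n * th ^+ n.
  rewrite -exprMn; apply: lerXn2r.
  - by rewrite nnegrE subr_ge0 ltW.
  - by rewrite nnegrE; exact: mulr_ge0 (ltW rxi) (ltW th0).
  have -> : r * xi * th = s * xi by rewrite -thr; ring.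
  rewrite /s mulrBl mul1r lerD2l lerN2 mulrAC ler_pdivrMr// ler_pM2l//; exact: ltW.
have x10' : 0 <= x1 - x0 by rewrite subr_ge0 ltW.
apply: (@le_trans _ _ (B * ((r * xi) ^+ n * th ^+ n) * (x1 - x0))).
  by rewrite ler_wpM2r// ler_wpM2l.
have -> : B * ((r * xi) ^+ n * th ^+ n) * (x1 - x0) =
    B * (r * xi) ^+ n.+1 * (th ^+ n * (x1 - x0) / (r * xi)).
  by rewrite exprSr; field; rewrite !gt_eqF.
have -> : M * (x1 - x0) / (r * x0) * (n.+1%:R * th ^+ n) =
    M * n.+1%:R * (th ^+ n * (x1 - x0) / (r * x0)) by ring.
have tn0 : 0 <= th ^+ n by rewrite exprn_ge0// ltW.
apply: ler_pM; rewrite ?mulr_ge0 ?exprn_ge0 ?invr_ge0 ?(ltW rxi) ?(ltW th0)//.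
rewrite ler_wpM2l ?mulr_ge0// lef_pV2 ?posrE ?mulr_gt0// ler_pM2l//.
exact: ltW.
Unshelve. all: by end_near. Qed.

End taylor_descent.

Section half_plane_extension.
Context {R : realType}.
Local Notation C := (R[i]).
Local Notation "x %:K" := (real_complex R x) (at level 2, format "x %:K").
Variable h : nat -> R -> R.
Hypothesis hd : derivative_chain h.
Hypothesis hb : cauchy_bounds h.

Definition taylor_coef (x : R) (k : nat) : C := (h k x / k`!%:R)%:K.

Lemma taylor_coef_bound (x rho : R) : 0 < rho -> rho < x ->
  exists M, forall k, cmod (taylor_coef x k) * rho ^+ k <= M.
Proof.
move=> r0 rx; have x0 : 0 < x by exact: lt_trans rx.
have rr : 0 < rho / x < 1 by rewrite divr_gt0//= ltr_pdivrMr// mul1r.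
have [M M0 MP] := hb rr x0; exists M => k.
have k0 : 0 < k`!%:R :> R by rewrite ltr0n fact_gt0.
rewrite /taylor_coef cmod_real normrM normfV (gtr0_norm k0) mulrAC ler_pdivrMr//.
by have := MP k x (lexx x); rewrite divfK// gt_eqF.
Qed.

(** Re-expanding at x0 the Taylor series at x1 gives the Taylor series at x0: the
    coefficients are themselves Taylor series of the derivatives. *)
Lemma recentered_taylor (x0 x1 : R) j : 0 < x0 -> x0 < x1 ->
  tends (recentered (taylor_coef x1) (x0 - x1)%:K j) (taylor_coef x0 j).
Proof.
move=> x00 x01.
pose u K : R := \sum_(0 <= k < K) 'C(k, j)%:R * (h k x1 / k`!%:R) * (x0 - x1) ^+ (k - j).
have -> : recentered (taylor_coef x1) (x0 - x1)%:K j = (fun K => (u K)%:K).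
  apply/funext => K; rewrite /u rmorph_sum/=; apply: eq_bigr => k _.
  by rewrite /taylor_coef !rmorphM/= rmorphXn/= rmorph_nat.
apply: tends_real; rewrite -(cvg_shiftn j.+1).
have := @taylor_descent _ (fun n => h (j + n)%N) x0 x1
  (derivative_chain_shift j hd) (cauchy_bounds_shift j hb) x00 x01.
rewrite addn0 => lim.
have : j`!%:R^-1 * (\sum_(m < n.+1) h (j + m)%N x1 / m`!%:R * (x0 - x1) ^+ m) @[n --> \oo]
    --> j`!%:R^-1 * h j x0 by apply: cvgM; [exact: cvg_cst|exact: lim].
rewrite [X in _ --> X -> _]mulrC; apply: cvg_trans; apply: near_eq_cvg; apply: nearW => n.
rewrite /= /u addnS -addSn (big_cat_nat (leq0n j) (leq_addl _ _))/=.
rewrite [X in _ = X + _]big1_seq ?add0r; last first.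
  by move=> k; rewrite mem_index_iota => /andP[_ /andP[_ kj]]; rewrite bin_small// !mul0r.
rewrite (@big_addn _ _ _ 0 (n.+1 + j)%N j) addnK big_mkord mulr_sumr; apply: eq_bigr => m _.
rewrite addnK (addnC m j).
have := bin_fact (leq_addr m j); rewrite addKn => /(congr1 (fun n => n%:R : R)).
rewrite !natrM => <-.
have f0 (i : nat) : i`!%:R != 0 :> R by rewrite pnatr_eq0 -lt0n fact_gt0.
have c0 : 'C(j + m, j)%:R != 0 :> R by rewrite pnatr_eq0 -lt0n bin_gt0 leq_addr.
by field; rewrite ?f0 ?c0.
Qed.

(** If |z - x0| < x0 < x1 then |x0 - x1| + |z - x0| < x1, so that re-expansion applies. *)
Lemma taylor_consistent (x0 x1 : R) (z : C) : 0 < x0 -> x0 < x1 -> cmod (z - x0%:K) < x0 ->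
  tends (fun N => psum (taylor_coef x0) (z - x0%:K) N - psum (taylor_coef x1) (z - x1%:K) N) 0.
Proof.
move=> x00 x01 zx.
have w0E : cmod (x0 - x1)%:K = x1 - x0.
  by rewrite cmod_real distrC gtr0_norm// subr_gt0.
pose d := (x1 - x0) + cmod (z - x0%:K); pose rho := (d + x1) / 2.
have z0 := cmod_ge0 (z - x0%:K).
have d1 : d < x1 by rewrite /d; lra.
have d0 : 0 < d by rewrite /d; lra.
have rho0 : 0 < rho by rewrite /rho; lra.
have rho1 : rho < x1 by rewrite /rho; lra.
have drho : d < rho by rewrite /rho; lra.
have [M MP] := taylor_coef_bound rho0 rho1.
have := recentering rho0 MP (fun j => recentered_taylor j x00 x01) (h := z - x0%:K).
rewrite w0E => /(_ drho).
by rewrite (_ : (x0 - x1)%:K + (z - x0%:K) = z - x1%:K)// rmorphB/=; ring.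
Qed.

Lemma disk_half_plane (x : R) (z : C) : cmod (z - x%:K) < x -> 0 < complex.Re z.
Proof.
move=> zx; have := le_lt_trans (Re_le_cmod _) zx; rewrite raddfB/=.
by rewrite ltr_norml => /andP[+ _]; lra.
Qed.

(** The point |z|^2 / Re z works: the squared distance to it is x^2 - |z|^2. *)
Lemma half_plane_disk (z : C) : 0 < complex.Re z -> exists2 x : R, 0 < x & cmod (z - x%:K) < x.
Proof.
move=> z0; have m0 : 0 < cmod z ^+ 2.
  by rewrite cmod_sqr ltr_pwDl ?exprn_gt0// sqr_ge0.
exists (cmod z ^+ 2 / complex.Re z); first by rewrite divr_gt0.
set x := _ / _; have x0 : 0 < x by rewrite divr_gt0.
rewrite -(@ltr_pXn2r _ 2)// ?nnegrE ?cmod_ge0 ?(ltW x0)//.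
rewrite cmod_sqr !raddfB/= subr0.
have e : x * complex.Re z = cmod z ^+ 2 by rewrite /x divfK// gt_eqF.
rewrite cmod_sqr in e m0; rewrite -subr_lt0.
rewrite (_ : _ - _ = complex.Re z ^+ 2 + complex.Im z ^+ 2 - 2 * (x * complex.Re z)); last by ring.
by rewrite e; lra.
Qed.

Lemma taylor_sum_exists (z : C) : 0 < complex.Re z ->
  exists l, forall x : R, 0 < x -> cmod (z - x%:K) < x ->
    tends (psum (taylor_coef x) (z - x%:K)) l.
Proof.
move=> /half_plane_disk[x x0 zx].
have rho01 : cmod (z - x%:K) < (cmod (z - x%:K) + x) / 2 < x by lra.
have /andP[r1 r2] := rho01.
have r0 : 0 < (cmod (z - x%:K) + x) / 2 by apply: le_lt_trans r1; exact: cmod_ge0.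
have [M MP] := taylor_coef_bound r0 r2.
have [l lP] := psum_tends r0 MP r1; exists l => y y0 zy.
have [xy|yx|<-//] := ltgtP x y; last exact: tends_sub (taylor_consistent y0 yx zy) lP.
have := tends_sym (taylor_consistent x0 xy zx); rewrite oppr0 => h1.
exact: tends_sub h1 lP.
Qed.

(** The common sum of the Taylor series at all real points whose disk contains z. *)
Definition half_plane_sum (z : C) : C :=
  xget 0 [set l | forall x : R, 0 < x -> cmod (z - x%:K) < x ->
    tends (psum (taylor_coef x) (z - x%:K)) l].

Lemma half_plane_sumP (x : R) (z : C) : 0 < x -> cmod (z - x%:K) < x ->
  tends (psum (taylor_coef x) (z - x%:K)) (half_plane_sum z).
Proof.
move=> x0 zx; have [l lP] := taylor_sum_exists (disk_half_plane zx).
exact: (@xgetPex _ 0 [set l | forall x : R, 0 < x -> cmod (z - x%:K) < x ->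
    tends (psum (taylor_coef x) (z - x%:K)) l] (ex_intro _ l lP) x x0 zx).
Qed.

Lemma half_plane_sum_analytic : analytic_on (@cone R) half_plane_sum.
Proof.
move=> z0 [/half_plane_disk[x x0 zx] _].
set w0 := z0 - x%:K in zx; pose rho := (cmod w0 + x) / 2.
have w00 := cmod_ge0 w0.
have r1 : cmod w0 < rho by rewrite /rho; lra.
have r2 : rho < x by rewrite /rho; lra.
have r0 : 0 < rho by exact: le_lt_trans r1.
have [M MP] := taylor_coef_bound r0 r2.
have [b bP] := choice (fun j => recentered_tends r0 MP j r1).
exists (rho - cmod w0), b; split; first by rewrite subr_gt0.
move=> z zz; have zd : cmod (z - z0) < rho - cmod w0 by rewrite -ltcR -cmodE.
have h1 := recentering r0 MP bP (h := z - z0).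
have e : w0 + (z - z0) = z - x%:K by rewrite /w0; ring.
rewrite e in h1; rewrite ltrBrDl in zd.
have zx2 : cmod (z - x%:K) < x.
  by rewrite -e; apply: le_lt_trans (cmodD _ _) _; exact: lt_trans r2.
apply: tends_cvg.
have := tends_sub (h1 zd) (half_plane_sumP x0 zx2).
apply: cvg_trans; apply: near_eq_cvg; apply: nearW => N.
by rewrite /series/= big_mkord.
Qed.

Lemma half_plane_sum_real (x : R) : 0 < x -> half_plane_sum x%:K = (h 0 x)%:K.
Proof.
move=> x0; have zx : cmod (x%:K - x%:K) < x by rewrite subrr cmod0.
apply: tends_unique (half_plane_sumP x0 zx) _.
apply: tends_squeeze (cvg_cst (0 : R)); near=> N.
have N0 : (0 < N)%N by near: N; exact: nbhs_infty_gt.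
rewrite -(prednK N0) /psum big_ord_recl expr0 mulr1 big1 => [|i _]; last first.
  by rewrite subrr expr0n mulr0.
by rewrite addr0 /taylor_coef /= fact0 divr1 subrr cmod0.
Unshelve. all: by end_near. Qed.

End half_plane_extension.

(** * Conclusions for the density *)

Section density_analytic.
Context {R : realType}.
Local Notation leb := (@lebesgue_measure R).
Variable mu : {finite_measure set (measurableTypeR R) -> \bar R}.
Variables (q : R) (f : R -> R).
Hypothesis phi_pos : forall u : R, 0 < u -> 0 < phi mu q u.
Hypothesis f_ge0 : forall x : R, 0 < x -> 0 <= f x.
Hypothesis f_smooth : forall n (x : R), 0 < x -> derivable (derive1n n f) x 1.
Local Notation c := (q + levy_mass mu).
Hypothesis f_moments : forall n,
  (\int[leb]_(x in `]0%R, +oo[) (x ^+ n * f x)%:E = (n`!%:R * moment_coef mu q n)%:E)%E.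

Let c0 : 0 < c. Proof. exact: phi_limit_gt0. Qed.

(** As psi tends to 0 and r c < th, only finitely many of the scaled factors exceed 1. *)
Lemma deriv_factor_le (r th : R) : 0 < r -> 0 < th -> r * c < th ->
  exists2 B : R, 0 <= B & forall n, (r / th) ^+ n * deriv_factor mu q n n <= B.
Proof.
move=> r0 th0 rth; pose F (i : nat) := r / th * (c + psi mu i%:R).
have rt0 : 0 <= r / th by rewrite divr_ge0// ltW.
have F0 i : 0 <= F i by rewrite mulr_ge0// addr_ge0 ?psi_ge0// ltW.
have eps0 : 0 < (th - r * c) / r by rewrite divr_gt0// subr_gt0.
have [N NP] : exists N : nat, forall i, (N <= i)%N -> F i <= 1.
  have pN : psi mu n%:R @[n --> \oo] --> (0 : R) by exact: cvg_comp (@cvgr_idn R) (psi_cvg0 mu).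
  have /cvgr_dist_lt/(_ _ eps0)[N _ NP] := pN; exists N => i Ni.
  have := NP i Ni; rewrite /= sub0r normrN ger0_norm ?psi_ge0// => /ltW pe.
  rewrite /F mulrAC ler_pdivrMr// mul1r mulrDr -lerBrDl mulrC -ler_pdivlMr//.
pose B := Num.max 1 (r / th * (c + levy_mass mu)).
have B1 : 1 <= B by rewrite le_max lexx.
have FB i : F i <= B.
  rewrite le_max; apply/orP; right; rewrite ler_wpM2l// lerD2l.
  by rewrite -psi0 psi_le.
exists (B ^+ N); first by rewrite exprn_ge0// (le_trans ler01).
have dF n : (r / th) ^+ n * deriv_factor mu q n n = \prod_(j < n) F (n - j)%N.
  by rewrite big_split/= prodr_const card_ord.
suff H n : \prod_(j < n) F (n - j)%N <= B ^+ minn n N.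
  by move=> n; rewrite dF (le_trans (H n))// ler_weXn2l// geq_minr.
elim: n => [|n IH]; first by rewrite big_ord0 min0n expr0.
rewrite big_ord_recl subn0.
rewrite (eq_bigr (fun j : 'I_n => F (n - j)%N)); last by move=> j _; rewrite /bump/= subSS.
have P0 : 0 <= \prod_(j < n) F (n - j)%N by apply: prodr_ge0 => j _; exact: F0.
have [nN|Nn] := ltnP n N.
  rewrite (minn_idPl nN) exprS; rewrite (minn_idPl (ltnW nN)) in IH.
  exact: ler_pM.
rewrite (minn_idPr (leqW Nn)); rewrite (minn_idPr Nn) in IH.
by apply: le_trans IH; rewrite ler_piMl// NP// ltnW.
Qed.

Lemma density_cauchy_bounds : cauchy_bounds (fun n => derive1n n f).
Proof.
apply: (@cauchy_bounds_shift1 _ (tail_derivative f)) => r a /andP[r0 r1] a0.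
pose th := c * ((1 + r) / 2).
have th0 : 0 < th by rewrite mulr_gt0//; lra.
have thc : 0 < th < c by rewrite th0/= gtr_pMr//; lra.
have rth : r * c < th by rewrite mulrC ltr_pM2l//; lra.
have [K K0 KP] := tail_derivative_bound phi_pos f_ge0 f_smooth f_moments thc.
have [B B0 BP] := deriv_factor_le r0 th0 rth.
exists (K * B); first exact: mulr_ge0.
move=> n y ay; have y0 : 0 < y by exact: lt_le_trans ay.
have := ler_wpM2r (exprn_ge0 n (ltW r0)) (KP n n y (leqnn n) y0).
rewrite (_ : `|tail_derivative f n y| * y ^+ n * r ^+ n = `|tail_derivative f n y| * (r * y) ^+ n); last first.
  by rewrite exprMn; ring.
move=> /le_trans; apply.
rewrite (_ : K * (n`!%:R / th ^+ n) * deriv_factor mu q n n * r ^+ n =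
  K * n`!%:R * ((r / th) ^+ n * deriv_factor mu q n n)); last first.
  by rewrite expr_div_n; ring.
have -> : K * B * n`!%:R = K * n`!%:R * B by ring.
by rewrite ler_wpM2l// mulr_ge0.
Qed.

Lemma density_half_plane : exists2 F : R[i] -> R[i],
  analytic_on (@cone R) F & forall x : R, 0 < x -> F (x%:C)%C = ((f x)%:C)%C.
Proof.
have hd : derivative_chain (fun n => derive1n n f).
  by move=> n x x0; rewrite derive1nS; exact: derivable_isd (@f_smooth n x x0).
exists (half_plane_sum (fun n => derive1n n f)).
  exact: half_plane_sum_analytic hd density_cauchy_bounds.
by move=> x x0; exact: (half_plane_sum_real hd density_cauchy_bounds x0).
Qed.

Let normalized_derivative n :
  derive1n n f x / (f x * (- c) ^+ n) @[x --> +oo] --> (1 : R).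
Proof.
have cn : (- c) ^+ n != 0 by rewrite expf_neq0// oppr_eq0 gt_eqF.
have h : derive1n n f x / f x * ((- c) ^+ n)^-1 @[x --> +oo] --> (- c) ^+ n * ((- c) ^+ n)^-1.
  apply: cvgM; last exact: cvg_cst.
  exact: (derivative_ratio phi_pos f_ge0 f_smooth f_moments).
rewrite divff// in h; apply: cvg_trans h; apply: near_eq_cvg; apply: nearW => x.
by rewrite invfM mulrA.
Qed.

Lemma derivative_equiv n (L : R) : 0 < L ->
  f x * expR (c * x) @[x --> +oo] --> L ->
  asymp_equiv (derive1n n f) (fun x => (-1) ^+ n * c ^+ n * L * expR (- (c * x))).
Proof.
move=> L0 fL; rewrite /asymp_equiv.
have h : derive1n n f x / (f x * (- c) ^+ n) * (f x * expR (c * x) / L) @[x --> +oo] -->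
    (1 : R) * (L / L).
  apply: cvgM; first exact: normalized_derivative.
  by apply: cvgM; [exact: fL|exact: cvg_cst].
rewrite mul1r divff ?gt_eqF// in h.
have [x2 x20 fpos] := density_eventually_pos phi_pos f_ge0 f_smooth f_moments.
apply: cvg_trans h; apply: near_eq_cvg; near=> x.
have f0 : 0 < f x by apply: fpos; near: x; apply: nbhs_pinfty_ge; exact: num_real.
have cn : (- c) ^+ n != 0 by rewrite expf_neq0// oppr_eq0 gt_eqF.
have e0 : expR (c * x) != 0 by rewrite gt_eqF ?expR_gt0.
rewrite -exprMn mulN1r expRN; move: cn e0 (lt0r_neq0 f0) (lt0r_neq0 L0).
move: (expR (c * x)) ((- c) ^+ n) (f x) (derive1n n f x) => E s fx dfx s0 E0 fx0 L1.
by field; rewrite ?s0 ?E0 ?fx0 ?L1.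
Unshelve. all: by end_near. Qed.

(** Only ln f x / x --> - c is needed: any prefactor can be moved into r. *)
Lemma derivative_log_equiv n (L : R) : 0 < L ->
  exists2 r : R -> R, r x / x @[x --> +oo] --> (0 : R) &
    asymp_equiv (derive1n n f) (fun x => (-1) ^+ n * c ^+ n * L * expR (- (c * (x + r x)))).
Proof.
move=> L0; pose D x := derive1n n f x / ((-1) ^+ n * c ^+ n * L).
pose U x := derive1n n f x / (f x * (- c) ^+ n).
have DxE x : 0 < f x -> D x = U x * f x / L.
  move=> f0; rewrite /D /U -exprMn mulN1r.
  have cn : (- c) ^+ n != 0 by rewrite expf_neq0// oppr_eq0 gt_eqF.
  move: cn (lt0r_neq0 f0) (lt0r_neq0 L0).
  move: ((- c) ^+ n) (f x) (derive1n n f x) => s fx dfx s0 fx0 L1.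
  by field; rewrite ?s0 ?fx0 ?L1.
(* r turns the equivalence into an equality for large x *)
pose r x := - x - ln (D x) / c; exists r.
  have [x2 x20 fpos] := density_eventually_pos phi_pos f_ge0 f_smooth f_moments.
  have lnU : ln (U x) @[x --> +oo] --> ln (1 : R).
    exact: cvg_comp (normalized_derivative n) (continuous_ln ltr01).
  have h : - 1 - ((ln (U x) - ln L) * x^-1 + ln (f x) / x) / c @[x --> +oo] -->
      - 1 - ((ln 1 - ln L) * 0 + - c) / c.
    apply: cvgB; first exact: cvg_cst.
    apply: cvgM; last exact: cvg_cst.
    apply: cvgD; last exact: (ln_density_ratio phi_pos f_ge0 f_smooth f_moments).
    by apply: cvgM; [apply: cvgB; [exact: lnU|exact: cvg_cst]|exact: cvgy_inv].
  rewrite mulr0 add0r mulNr divff ?gt_eqF// subrr in h.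
  apply: cvg_trans h; apply: near_eq_cvg; near=> x.
  have x0 : 0 < x by near: x; apply: nbhs_pinfty_gt; exact: num_real.
  have f0 : 0 < f x by apply: fpos; near: x; apply: nbhs_pinfty_ge; exact: num_real.
  have U0 : 0 < U x.
    near: x; have := normalized_derivative n.
    by move/cvgr_gt; apply.
  have iL0 : 0 < L^-1 by rewrite invr_gt0.
  have lnDE : ln (D x) = ln (U x) + ln (f x) - ln L.
    by rewrite (DxE x f0) (lnM (mulr_gt0 U0 f0) iL0) (lnM U0 f0) (lnV L0).
  rewrite /r lnDE.
  move: (ln (U x)) (ln (f x)) (ln L) (lt0r_neq0 x0) (lt0r_neq0 c0) => a b l x1 c1.
  by field; rewrite ?x1 ?c1.
rewrite /asymp_equiv; have h : (fun _ : R => (1 : R)) x @[x --> +oo] --> (1 : R) by exact: cvg_cst.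
have [x2 x20 fpos] := density_eventually_pos phi_pos f_ge0 f_smooth f_moments.
apply: cvg_trans h; apply: near_eq_cvg; near=> x.
have f0 : 0 < f x by apply: fpos; near: x; apply: nbhs_pinfty_ge; exact: num_real.
have cn : (- c) ^+ n != 0 by rewrite expf_neq0// oppr_eq0 gt_eqF.
have U0 : 0 < U x.
  near: x; have := normalized_derivative n.
  by move/cvgr_gt; apply.
have K0 : (-1) ^+ n * c ^+ n * L != 0 by rewrite -exprMn mulN1r mulf_neq0// gt_eqF.
have D0 : 0 < D x by rewrite (DxE x f0) divr_gt0// mulr_gt0.
have -> : - (c * (x + r x)) = ln (D x) by rewrite /r; field; rewrite gt_eqF.
rewrite (lnK D0) (_ : _ * D x = derive1n n f x); last by rewrite /D [LHS]mulrC divfK.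
rewrite divff//; apply: contraTneq D0 => d0; by rewrite /D d0 mul0r ltxx.
Unshelve. all: by end_near. Qed.

End density_analytic.

Theorem corollary3p4 (R : realType) (d : measure_display)
    (T : measurableType d) (P : probability T R)
    (mu : {finite_measure set (measurableTypeR R) -> \bar R}) (q : R)
    (X : R -> {RV P >-> R}) (e : {RV P >-> \bar R}) (f : R -> R) (n : nat)
    (mu_pos : mu `]-oo, 0%R]%classic = 0%E)
    (q_ge0 : 0 <= q)
    (phi_nontrivial : exists2 z : R, 0 <= z & phi mu q z != 0)
    (X_cpp : compound_poisson_subordinator mu X)
    (e_exp : exponential_time q e)
    (X_e_indep : indep_systems P (sigma_process `[0, +oo[ X) (sigma_rv e))
    (f_density : smooth_density P (exponential_functional (killed X e)) f) :
  ((\int[mu]_(v in `]0%R, 1%R]) (v^-1)%:E < +oo)%E ->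
    asymp_equiv (derive1n n f) (fun x =>
      (-1) ^+ n * phi_infty mu q ^+ n * Num.sqrt (phi_infty mu q) *
      expR (phi_infty mu q * phi_star mu q 1 +
            fine (\int[mu]_(v in `]0%R, +oo[)
                    \int[lebesgue_measure]_(y in `[phi_star mu q 1, +oo[)
                      (expR (- (varphi_star mu q y * v)))%:E)%E) *
      (expR (- T_phi_star mu q) / Num.sqrt (2 * pi * phi_star mu q 1)) *
      expR (- (phi_infty mu q * x))))
  /\
  ((\int[mu]_(v in `]0%R, 1%R]) (v^-1)%:E = +oo)%E ->
    exists2 r : R -> R,
      r x / x @[x --> +oo] --> (0 : R) &
      asymp_equiv (derive1n n f) (fun x =>
        (-1) ^+ n * phi_infty mu q ^+ n * Num.sqrt (phi_infty mu q) *
        expR (phi_infty mu q * phi_star mu q 1) *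
        (expR (- T_phi_star mu q) / Num.sqrt (2 * pi * phi_star mu q 1)) *
        expR (- (phi_infty mu q * (x + r x)))))
  /\
  (exists2 F : R[i] -> R[i],
     analytic_on cone F & forall x : R, 0 < x -> F (x%:C)%C = ((f x)%:C)%C).
Proof.
have phi_pos : forall u : R, 0 < u -> 0 < phi mu q u by move=> u; exact: phi_gt0.
have f_ge0 := density_ge0 f_density.
have f_smooth := density_smooth f_density.
have f_moments := moment_density q_ge0 X_cpp e_exp X_e_indep (fun k => phi_pos k.+1%:R (ltr0Sn R k)) f_density.
have c0 : 0 < q + levy_mass mu by exact: phi_limit_gt0.
have ps1 : 0 < phi_star mu q 1 by rewrite /phi_star mul1r invr_gt0; exact: phi_pos.
have const_gt0 (A B : R) : 0 < Num.sqrt (q + levy_mass mu) * expR A *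
    (expR B / Num.sqrt (2 * pi * phi_star mu q 1)).
  have p2 : 0 < 2 * pi * phi_star mu q 1 by rewrite (mulr_gt0 _ ps1)// mulr_gt0// pi_gt0.
  by apply: mulr_gt0; [rewrite mulr_gt0 ?expR_gt0 ?sqrtr_gt0|rewrite divr_gt0 ?expR_gt0 ?sqrtr_gt0].
have assoc (s a A B E : R) : s * (a * A * B) * E = s * a * A * B * E by rewrite !mulrA.
rewrite !phi_inftyE; split; last split.
- move=> inv_lty.
  have L := gamma_average_limit phi_pos f_ge0 f_smooth f_moments
    (moment_limit q_ge0 phi_pos inv_lty).
  have := derivative_equiv phi_pos f_ge0 f_smooth f_moments n (const_gt0 _ _) L.
  by under eq_fun do rewrite assoc.
- move=> _.
  have [r r0 rP] := derivative_log_equiv phi_pos f_ge0 f_smooth f_moments n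
    (const_gt0 ((q + levy_mass mu) * phi_star mu q 1) (- T_phi_star mu q)).
  exists r => //; move: rP.
  by under eq_fun do rewrite assoc.
- exact: (density_half_plane phi_pos f_ge0 f_smooth f_moments).
Qed.
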